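(* Let $(L,Q)$ and $(L',Q')$ be isospectral definite ternary quadratic lattices over $A=\mathbb F_q[t]$, and let $(\mu_1,\mu_2,\mu_3)$ be the successive minima of $(L,Q)$. If $\mu_1=\mu_2$ or $\mu_2=\mu_3$, then $(L,Q)$ and $(L',Q')$ are isometric.
   Context: $\mathbb F_q$ is a finite field with $q$ odd, $A=\mathbb F_q[t]$, $K=\mathbb F_q(t)$, $K_\infty=\mathbb F_q((1/t))$. For $x\in K$, $\deg x$ is the degree of the numerator minus that of the denominator, $\deg 0=-\infty$. A quadratic lattice $(L,Q)$ over $A$ is a free $A$-module of finite rank with a $K$-valued quadratic form $Q$; $B(\mathbf x,\mathbf y)=Q(\mathbf x+\mathbf y)-Q(\mathbf x)-Q(\mathbf y)$. Ternary means rank 3; definite means $Q$ anisotropic over $K_\infty$. The Gram matrix of a basis $\mathbf v_1,\dots,\mathbf v_n$ is $(m_{ij})$, $m_{ij}=\frac12B(\mathbf v_i,\mathbf v_j)$; a basis is reduced if $\deg m_{ii}\le\deg m_{jj}$ for $i\le j$ and $\deg m_{ij}<\deg m_{ii}$ for $i<j$. Definite lattices have reduced bases and $(\deg m_{11},\dots,\deg m_{nn})$ is independent of the reduced basis: these are the successive minima. $R(L,Q,a)=|\{\mathbf v\in L:Q(\mathbf v)=a\}|$; isospectral means $R(L,Q,a)=R(L',Q',a)$ for all $a\in K$. Isometric means there is an $A$-module isomorphism $\sigma:L\to L'$ with $Q'\circ\sigma=Q$. *)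

(* Defs.v *)
From HB Require Import structures.
From mathcomp Require Import all_boot all_order all_algebra.
From mathcomp Require Import fraction generic_quotient.
From mathcomp Require Import finmap boolp classical_sets functions cardinality.
From mathcomp Require Import fsbigop constructive_ereal.
From mathcomp Require Import zify.

Set Implicit Arguments.
Unset Strict Implicit.
Unset Printing Implicit Defensive.

Import Order.TTheory GRing.Theory Num.Theory.
Local Open Scope ring_scope.

(* The field F((1/t)) of formal Laurent series in 1/t: a series \sum_n a_n t^n
   is the family of its coefficients, indexed by the exponent n of t (not of
   1/t); only finitely many positive exponents occur. *)

Definition bounded_above (F : nmodType) : {pred int -> F} :=
  fun f => `[< exists N : int, forall n, N < n -> f n = 0 >].

Record laurent (F : nmodType) := Laurent {
  lcoef :> int -> F;
  lcoef_bounded : lcoef \in @bounded_above F }.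

HB.instance Definition _ (F : nmodType) := [isSub for @lcoef F].
HB.instance Definition _ (F : nmodType) := [Choice of laurent F by <:].

Section LaurentZmodule.
Variable F : zmodType.

Fact bounded_above_zmod_closed : zmod_closed (@bounded_above F).
Proof.
split=> [|f g]; first by apply/asboolP; exists 0.
move=> /asboolP[M fM] /asboolP[N gN]; apply/asboolP; exists (Num.max M N) => n.
rewrite gt_max => /andP[Mn Nn].
by rewrite -[(f - g) n]/(f n - g n) fM// gN// subr0.
Qed.

HB.instance Definition _ :=
  GRing.isZmodClosed.Build (int -> F) (@bounded_above F)
    bounded_above_zmod_closed.
HB.instance Definition _ := [SubChoice_isSubZmodule of laurent F by <:].

End LaurentZmodule.

Lemma laurentP (F : nmodType) (f g : laurent F) :
  (forall n, f n = g n) <-> f = g.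
Proof. by split=> [fg|->//]; apply: val_inj; apply/funext. Qed.

Section LaurentRing.
Variable F : fieldType.
Implicit Types (f g h : laurent F) (a b c : nat -> F) (M N : int).

Lemma lcoefD f g n : (f + g) n = f n + g n. Proof. by []. Qed.
Lemma lcoefB f g n : (f - g) n = f n - g n. Proof. by []. Qed.
Lemma lcoef0 n : (0 : laurent F) n = 0. Proof. by []. Qed.

Definition lbound (f : int -> F) M := forall n, M < n -> f n = 0.

Lemma lboundP f : exists M, lbound f M.
Proof. by case: f => f /= /asboolP. Qed.

Definition lmul_coef (f g : int -> F) (n : int) : F :=
  \sum_(i \in [set: int]) f i * g (n - i).

Let fsumE (G : int -> F) (r : seq int) : uniq r ->
  (forall i, i \notin r -> G i = 0) ->
  \sum_(i \in [set: int]) G i = \sum_(i <- r) G i.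
Proof.
move=> ur Gr; rewrite (fsbigE r)//; last by move=> i _; exact: Gr.
by apply: eq_bigl => i; rewrite in_setT.
Qed.

(* below, a : nat -> F stands for the power series \sum_k a_k t^-k *)
Let tail (f : int -> F) M : nat -> F := fun k => f (M - k%:Z).
Let trunc m a : {poly F} := \poly_(k < m.+1) a k.
Let conv a b m : F := \sum_(i < m.+1) a i * b (m - i)%N.

Let convE a b m d : (m <= d)%N -> conv a b m = (trunc d a * trunc d b)`_m.
Proof.
move=> md; rewrite coefM; apply: eq_bigr => i _.
by rewrite !coef_poly !ifT//; have := ltn_ord i; lia.
Qed.

Let convC a b m : conv a b m = conv b a m.
Proof. by rewrite !(convE _ _ (leqnn m)) mulrC. Qed.

Let convA a b c m : conv a (conv b c) m = conv (conv a b) c m.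
Proof.
rewrite [LHS](_ : _ = (trunc m a * (trunc m b * trunc m c))`_m).
  rewrite mulrA coefM; apply: eq_bigr => i _.
  rewrite -convE; last by have := ltn_ord i; lia.
  by rewrite coef_poly ifT//; have := ltn_ord i; lia.
rewrite coefM; apply: eq_bigr => i _.
rewrite -convE ?leq_subr//.
by rewrite coef_poly ifT//; have := ltn_ord i; lia.
Qed.

Let lmul_coefE f g M N m : lbound f M -> lbound g N ->
  lmul_coef f g (M + N - m%:Z) = conv (tail f M) (tail g N) m.
Proof.
move=> fM gN; rewrite /lmul_coef.
rewrite (fsumE (r := [seq M - k%:Z | k <- iota 0 m.+1])).
- rewrite big_map -[iota 0 _]/(index_iota 0 m.+1) big_mkord.
  by apply: eq_bigr => i _; rewrite /tail; congr (_ * g _); have := ltn_ord i; lia.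
- by rewrite map_inj_uniq ?iota_uniq// => i j; lia.
- move=> i; have [Mi|iM] := ltP M i; first by rewrite fM ?mul0r.
  have [mi|im] := leP (M - m%:Z) i.
    case/mapP; exists `|M - i|%N; last by lia.
    by rewrite mem_iota; lia.
  by rewrite gN ?mulr0//; lia.
Qed.

Let lmul_bound f g M N : lbound f M -> lbound g N ->
  lbound (lmul_coef f g) (M + N).
Proof.
move=> fM gN n MNn; rewrite /lmul_coef fsbig1// => i _.
have [Mi|iM] := ltP M i; first by rewrite fM ?mul0r.
by rewrite gN ?mulr0//; lia.
Qed.

Fact lmul_subproof f g : lmul_coef f g \in @bounded_above F.
Proof.
have [M fM] := lboundP f; have [N gN] := lboundP g.
by apply/asboolP; exists (M + N); apply: lmul_bound.
Qed.

Definition lmul f g : laurent F := Laurent (lmul_subproof f g).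

(* c t^k *)
Definition lmonom_coef (c : F) (k : int) : int -> F :=
  fun n => if n == k then c else 0.

Let lmonom_bound (c : F) k : lbound (lmonom_coef c k) k.
Proof. by move=> n kn; rewrite /lmonom_coef gt_eqF. Qed.

Fact lmonom_subproof (c : F) k : lmonom_coef c k \in @bounded_above F.
Proof. by apply/asboolP; exists k; apply: lmonom_bound. Qed.

Definition lmonom (c : F) k : laurent F := Laurent (lmonom_subproof c k).
Definition lone : laurent F := lmonom 1 0.

Lemma lcoef_monom (c : F) k n : lmonom c k n = if n == k then c else 0.
Proof. by []. Qed.

Let laurent_ext M f g : lbound f M -> lbound g M ->
  (forall m : nat, f (M - m%:Z) = g (M - m%:Z)) -> f = g.
Proof.
move=> fM gM fg; apply/laurentP => n; have [Mn|nM] := ltP M n.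
  by rewrite fM ?gM.
by rewrite (_ : n = M - `|M - n|%N%:Z) ?fg//; lia.
Qed.

Let tail_lmul f g M N : lbound f M -> lbound g N ->
  tail (lmul f g) (M + N) = conv (tail f M) (tail g N).
Proof. by move=> fM gN; apply/funext => m; exact: lmul_coefE. Qed.

Fact lmulA : associative lmul.
Proof.
move=> f g h; have [L fL] := lboundP f; have [M gM] := lboundP g.
have [N hN] := lboundP h.
have fgb := lmul_bound fL gM; have ghb := lmul_bound gM hN.
apply: (@laurent_ext (L + (M + N))) => [| |m].
- exact: (lmul_bound (g := lmul g h)).
- by rewrite addrA; exact: (lmul_bound (f := lmul f g)).
rewrite [LHS](lmul_coefE (g := lmul g h))// addrA.
by rewrite [RHS](lmul_coefE (f := lmul f g))// !tail_lmul.
Qed.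

Fact lmulC : commutative lmul.
Proof.
move=> f g; have [M fM] := lboundP f; have [N gN] := lboundP g.
apply: (@laurent_ext (M + N)) => [| |m]; first exact: lmul_bound.
  by rewrite addrC; exact: lmul_bound.
by rewrite [LHS]lmul_coefE// [M + N]addrC [RHS]lmul_coefE.
Qed.

Fact lmul1 : left_id lone lmul.
Proof.
move=> f; have [M fM] := lboundP f; have b1 : lbound lone 0 by exact: lmonom_bound.
apply: (@laurent_ext M) => // [|m].
  by rewrite -[M]add0r; exact: (lmul_bound (f := lone)).
rewrite -{1}[M]add0r [LHS](lmul_coefE (f := lone))//.
rewrite /conv big_ord_recl big1 ?addr0 => [|i _].
  by rewrite /tail lcoef_monom subr0 eqxx mul1r subn0.
have e : (0 - (lift ord0 i)%:Z == 0 :> int) = false by rewrite lift0; lia.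
by rewrite /tail lcoef_monom e mul0r.
Qed.

Let lbound_le f M N : M <= N -> lbound f M -> lbound f N.
Proof. by move=> MN fM n Nn; rewrite fM// (le_lt_trans MN). Qed.

Fact lmulDl : left_distributive lmul +%R.
Proof.
move=> f g h; have [K fK] := lboundP f; have [L gL] := lboundP g.
have [N hN] := lboundP h; pose M := Num.max K L.
have fM : lbound f M by apply: lbound_le fK; rewrite le_max lexx.
have gM : lbound g M by apply: lbound_le gL; rewrite le_max lexx orbT.
have fgM : lbound (f + g) M by move=> n Mn; rewrite lcoefD fM// gM// addr0.
apply: (@laurent_ext (M + N)) => [| |m]; first exact: lmul_bound.
  move=> n MNn; rewrite lcoefD [X in X + _](lmul_bound fM hN)// add0r.
  exact: (lmul_bound gM hN).
rewrite lcoefD [LHS]lmul_coefE// [X in _ = X + _]lmul_coefE//.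
rewrite [X in _ = _ + X]lmul_coefE// -big_split.
by apply: eq_bigr => i _; rewrite /= -mulrDl.
Qed.

Fact lone_neq0 : lone != 0.
Proof.
by apply/eqP => /laurentP/(_ 0)/eqP; rewrite /= /lmonom_coef eqxx oner_eq0.
Qed.

HB.instance Definition _ := GRing.Zmodule_isComNzRing.Build (laurent F)
  lmulA lmulC lmul1 lmulDl lone_neq0.

Lemma lcoefM f g n : (f * g) n = \sum_(i \in [set: int]) f i * g (n - i).
Proof. by []. Qed.

Let conv_inv a : a 0%N != 0 -> exists b, forall m, conv a b m = (m == 0%N)%:R.
Proof.
move=> a0.
pose fix B m : seq F := if m is m'.+1 then
  rcons (B m') (- (a 0%N)^-1 * \sum_(i < m) a i.+1 * (B m')`_(m' - i))
  else [:: (a 0%N)^-1].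
have sB m : size (B m) = m.+1 by elim: m => //= m IH; rewrite size_rcons IH.
pose b k := (B k)`_k.
have BE m k : (k <= m)%N -> (B m)`_k = b k.
  elim: m k => [|m IH] k; first by rewrite leqn0 => /eqP->.
  rewrite leq_eqVlt => /predU1P[->//|km].
  by rewrite [B _]/= nth_rcons sB km IH.
exists b => -[|m].
  by rewrite /conv big_ord_recl big_ord0 addr0 /b /= mulfV.
rewrite /conv big_ord_recl subn0 {1}/b [B _]/= nth_rcons sB ltnn eqxx.
rewrite mulrA mulrN mulfV// mulN1r.
under eq_bigr do rewrite BE ?leq_subr//.
by rewrite addNr.
Qed.

Let linv_exists f : f != 0 -> exists g, g * f = 1.
Proof.
move=> f0; have [N fN] := lboundP f.
have exk : exists k, f (N - k%:Z) != 0.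
  apply: contrapT => /forallNP nf; case/eqP: f0.
  apply: (@laurent_ext N) => // m.
  by apply/eqP; rewrite lcoef0; apply: contrapT => /negP; apply: nf.
have [k fk kmin] := ex_minnP exk; pose M := N - k%:Z.
have fM : lbound f M.
  move=> n Mn; have [Nn|nN] := ltP N n; first exact: fN.
  apply/eqP; apply: contraT => fn.
  have := kmin `|N - n|%N; rewrite (_ : N - _ = n); last by lia.
  by move=> /(_ fn); rewrite /M in Mn; lia.
have [|b bP] := @conv_inv (tail f M); first by rewrite /tail subr0.
pose gc n : F := if n <= - M then b `|- M - n|%N else 0.
have gcb : lbound gc (- M) by move=> n Mn; rewrite /gc leNgt Mn.
have gcB : gc \in @bounded_above F by apply/asboolP; exists (- M).
pose g := Laurent gcB; exists g; rewrite mulrC.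
apply: (@laurent_ext 0) => [| |m].
- by rewrite -(addrN M); exact: (lmul_bound (g := g)).
- exact: lmonom_bound.
rewrite -{1}(addrN M) [LHS](lmul_coefE (g := g))//.
rewrite (_ : tail g (- M) = b) ?bP; last first.
  apply/funext => i; rewrite /tail /= /gc ifT; last by lia.
  by congr b; lia.
rewrite lcoef_monom; case: m => [|m]; first by rewrite subr0 eqxx.
by have -> : (0 - m.+1%:Z == 0 :> int) = false by lia.
Qed.

Definition linv f : laurent F :=
  match pselect (f != 0) with
  | left f0 => sval (cid (linv_exists f0))
  | right _ => 0
  end.

Fact lmulV f : f != 0 -> linv f * f = 1.
Proof.
by move=> f0; rewrite /linv; case: pselect => // {}f0; case: cid.
Qed.

Fact linv0 : linv 0 = 0.
Proof. by rewrite /linv; case: pselect => // f0; exfalso; rewrite eqxx in f0. Qed.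

HB.instance Definition _ :=
  GRing.ComNzRing_isField.Build (laurent F) lmulV linv0.

End LaurentRing.

Local Notation "x %:F" := (@FracField.tofrac _ x).

Section Embedding.
Variable F : fieldType.
Implicit Types p q : {poly F}.

Definition laurent_of_poly_coef p (n : int) : F := if n is Posz k then p`_k else 0.

Fact laurent_of_poly_subproof p :
  laurent_of_poly_coef p \in @bounded_above F.
Proof.
apply/asboolP; exists (size p)%:Z => -[k|//] /= kp.
by rewrite nth_default//; lia.
Qed.

Definition laurent_of_poly p : laurent F := Laurent (laurent_of_poly_subproof p).

Fact laurent_of_poly_zmod_morphism : zmod_morphism laurent_of_poly.
Proof.
move=> p q; apply/laurentP => -[n|n]; first by rewrite lcoefB /= coefB.
by rewrite lcoefB /= subr0.
Qed.

HB.instance Definition _ := GRing.isZmodMorphism.Build _ _ laurent_of_poly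
  laurent_of_poly_zmod_morphism.

Fact laurent_of_poly_monoid_morphism : monoid_morphism laurent_of_poly.
Proof.
split.
  apply/laurentP => -[n|n] //=; rewrite /lmonom_coef coef1.
  by case: n => [|n].
move=> p q; apply/laurentP => n; rewrite lcoefM; case: n => n.
  rewrite (fsbigE (map Posz (iota 0 n.+1)))//; first last.
  - move=> [i|i] _ ni; last by rewrite mul0r.
    have {}ni : (n < i)%N.
      rewrite ltnNge; apply: contra ni => ni.
      by rewrite mem_map ?mem_iota// => x y [].
    rewrite (_ : n%:Z - i%:Z = Negz (i - n).-1) ?mulr0//.
    by rewrite NegzE prednK; lia.
  - by rewrite map_inj_uniq ?iota_uniq// => x y [].
  rewrite big_map -[iota 0 _]/(index_iota 0 n.+1) big_mkord.
  under eq_bigl do rewrite in_setT.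
  rewrite /= coefM; apply: eq_bigr => i _.
  by rewrite subzn// -ltnS.
rewrite fsbig1// => -[i|i] _; last by rewrite mul0r.
by rewrite (_ : Negz n - i%:Z = Negz (n + i)) ?mulr0// !NegzE; lia.
Qed.

HB.instance Definition _ := GRing.isMonoidMorphism.Build _ _ laurent_of_poly
  laurent_of_poly_monoid_morphism.

Lemma laurent_of_poly_eq0 p : (laurent_of_poly p == 0) = (p == 0).
Proof.
apply/eqP/eqP => [/laurentP p0|->]; last by rewrite rmorph0.
by apply/polyP => i; rewrite coef0; exact: (p0 i%:Z).
Qed.

Definition numer (x : {fraction {poly F}}) : {poly F} := \n_(repr x).
Definition denom (x : {fraction {poly F}}) : {poly F} := \d_(repr x).

Lemma denom_neq0 x : denom x != 0. Proof. exact: denom_ratioP. Qed.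

Lemma numer_denom x : x = (numer x)%:F / (denom x)%:F.
Proof.
have d0 : (denom x)%:F != 0 by rewrite tofrac_eq0 denom_neq0.
apply: (mulIf d0); rewrite mulfVK// /numer /denom -{1}[x]reprK.
unlock FracField.tofrac; rewrite -[LHS]FracField.pi_mul; apply/eqmodP => /=.
rewrite FracField.equivfE /FracField.mulf.
by rewrite !numden_Ratio ?mulr1 ?oner_neq0 ?denom_ratioP// mulrC.
Qed.

Definition laurent_of_frac (x : {fraction {poly F}}) : laurent F :=
  laurent_of_poly (numer x) / laurent_of_poly (denom x).

Lemma laurent_of_fracE p q : q != 0 ->
  laurent_of_frac (p%:F / q%:F) = laurent_of_poly p / laurent_of_poly q.
Proof.
move=> q0; set x := _ / _; have d0 := denom_neq0 x.
apply/eqP; rewrite /laurent_of_frac eqr_div ?laurent_of_poly_eq0//.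
rewrite -!rmorphM; apply/eqP; congr (laurent_of_poly _).
apply/eqP; rewrite -tofrac_eq !tofracM -eqr_div ?tofrac_eq0//.
by rewrite -numer_denom.
Qed.

Fact laurent_of_frac_zmod_morphism : zmod_morphism laurent_of_frac.
Proof.
move=> x y; have dx := denom_neq0 x; have dy := denom_neq0 y.
rewrite {1}[x]numer_denom {1}[y]numer_denom -mulNr addf_div ?tofrac_eq0//.
rewrite -tofracN -!tofracM -tofracD laurent_of_fracE ?mulf_neq0//.
rewrite /laurent_of_frac -mulNr addf_div ?laurent_of_poly_eq0//.
by rewrite rmorphD !rmorphM rmorphN.
Qed.

HB.instance Definition _ := GRing.isZmodMorphism.Build _ _ laurent_of_frac
  laurent_of_frac_zmod_morphism.

Fact laurent_of_frac_monoid_morphism : monoid_morphism laurent_of_frac.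
Proof.
split.
  rewrite -[1](@mulfK _ 1%:F) ?tofrac_eq0 ?oner_neq0// mul1r.
  by rewrite laurent_of_fracE ?oner_neq0// rmorph1 divr1.
move=> x y; have dx := denom_neq0 x; have dy := denom_neq0 y.
rewrite {1}[x]numer_denom {1}[y]numer_denom mulf_div -!tofracM.
by rewrite laurent_of_fracE ?mulf_neq0// /laurent_of_frac mulf_div !rmorphM.
Qed.

HB.instance Definition _ := GRing.isMonoidMorphism.Build _ _ laurent_of_frac
  laurent_of_frac_monoid_morphism.

(* [deg 0 = -oo]; recall that [size p] is [deg p + 1] *)
Definition deg (x : {fraction {poly F}}) : \bar int :=
  if x == 0 then -oo%E
  else ((size (numer x))%:Z - (size (denom x))%:Z)%:E.

Lemma degE p q : p != 0 -> q != 0 ->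
  deg (p%:F / q%:F) = ((size p)%:Z - (size q)%:Z)%:E.
Proof.
move=> p0 q0; set x := _ / _.
have x0 : x != 0 by rewrite mulf_neq0 ?invr_eq0 ?tofrac_eq0.
have d0 := denom_neq0 x; rewrite /deg (negPf x0); congr (_%:E).
have n0 : numer x != 0.
  by apply: contraNneq x0 => n0; rewrite [x]numer_denom n0 tofrac0 mul0r.
have : size (numer x * q) = size (p * denom x).
  congr (size (_ : {poly F})).
  apply/eqP; rewrite -tofrac_eq !tofracM -eqr_div ?tofrac_eq0//.
  by rewrite -numer_denom.
rewrite !size_mul//; move: n0 d0 p0 q0; rewrite -!size_poly_gt0.
by move: (size (numer x)) (size (denom x)) (size p) (size q); lia.
Qed.

End Embedding.

Section QuadraticLattice.
Variable F : fieldType.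
Local Notation A := {poly F}.
Local Notation K := {fraction A}.
Local Notation Koo := (laurent F).

(* A [vectType A] is a free A-module of finite rank [dim L]. *)
Definition polar (L : vectType A) (Q : L -> K) (x y : L) : K :=
  Q (x + y) - Q x - Q y.

(* [polar Q] is symmetric, so linearity on the left is bilinearity *)
Record quadratic_form (L : vectType A) := QuadraticForm {
  qform :> L -> K;
  qformZ : forall (a : A) (x : L), qform (a *: x) = a%:F ^+ 2 * qform x;
  qformB : forall (a : A) (x y z : L),
    polar qform (a *: x + y) z = a%:F * polar qform x z + polar qform y z }.

Variables (L : vectType A) (Q : quadratic_form L).

Definition is_basis n (v : 'I_n -> L) :=
  bijective (fun c : 'rV[A]_n => \sum_i c 0 i *: v i).

Definition gram n (v : 'I_n -> L) : 'M[K]_n :=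
  \matrix_(i, j) (polar Q (v i) (v j) / 2%:R).

(* Q extended to L \otimes K_oo, in the coordinates of the basis v, is
   x |-> x G x^T with G the Gram matrix of v. *)
Definition definite :=
  forall n (v : 'I_n -> L), is_basis v ->
  forall x : 'rV[Koo]_n,
    x *m map_mx (@laurent_of_frac F) (gram v) *m x^T = 0 -> x = 0.

Definition reduced n (v : 'I_n -> L) :=
  (forall i j : 'I_n, (i <= j)%N -> (deg (gram v i i) <= deg (gram v j j))%E) /\
  (forall i j : 'I_n, (i < j)%N -> (deg (gram v i j) < deg (gram v i i))%E).

Definition successive_minima n (mu : n.-tuple (\bar int)) :=
  exists v : 'I_n -> L, [/\ is_basis v, reduced v &
    forall i, tnth mu i = deg (gram v i i)].

End QuadraticLattice.

Local Open Scope classical_set_scope.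
Local Open Scope card_scope.

(* [A #= B] compares cardinals; the sets below are finite for definite forms. *)
Definition isospectral (F : fieldType) (L L' : vectType {poly F})
    (Q : quadratic_form L) (Q' : quadratic_form L') :=
  forall a : {fraction {poly F}},
    [set v : L | Q v = a] #= [set v' : L' | Q' v' = a].

Definition isometric (F : fieldType) (L L' : vectType {poly F})
    (Q : quadratic_form L) (Q' : quadratic_form L') :=
  exists sigma : {linear L -> L'},
    bijective sigma /\ forall v, Q' (sigma v) = Q v.

(* Main.v *)
From HB Require Import structures.
From Pilot Require Import Defs.
From mathcomp Require Import boolp classical_sets cardinality fsbigop constructive_ereal.
From mathcomp Require Import all_boot all_order all_algebra all_field zify ring.

(* After scaling, the successive minima are (0, 0, 2k+1) or (0, 2k+1, 2k+1): the
   leading coefficients of three minima of equal parity would form a ternary form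
   over F_q, which has a nontrivial zero.

   Minima (0, 0, 2k+1): the vectors with value of degree <= 0 form an F_q-plane
   on which Q is, up to negative degree, an anisotropic binary form q0.  Sums of
   powers of Q over this plane, weighted by powers of q0, recover the Gram matrix
   of v1, v2.  The vectors with value close to Q(v3) are the +-v3 + x with x in the
   plane; weighted sums and Gauss sums of their values determine the products of
   the residues of B(v1, v3) and B(v2, v3) well enough to produce an isometry of
   q0 which matches these entries and preserves the Gram matrix of the plane.

   Minima (0, 2k+1, 2k+1): Poisson summation over (K_oo / A)^3 turns the values of
   Q on L into those of the dual form on a box of the dual lattice, up to a Gauss
   sum depending on the leading coefficients only.  The dual lattice, scaled and
   reordered, has minima (0, 0, 2k+1), so that the first case applies to it; the
   inverse transpose of the isometry obtained is an isometry of L with L'. *)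

Set Implicit Arguments.
Unset Strict Implicit.
Unset Printing Implicit Defensive.

Import Order.TTheory GRing.Theory Num.Theory VectorInternalTheory.
Local Open Scope ring_scope.
Local Notation lbound f := (Pilot.Defs.lbound (lcoef f%R)).

(** * Laurent series *)

(** A sum over vectors of L can be compared with one over L' only if its terms are functions of the
    value of the form. The weights q0^-j qualify because q0 is, up to a factor, the coefficient of
    t^0 of the value itself. Weighted second moments see a single contraction of a binary form and
    not the form; hence the fourth moment for the off-diagonal entry. For the third vector, write
    w(v) for the pair of residues of v B(v1, v3) and v B(v2, v3). No w(v) is determined; what is
    known is the dual norm pairing of w(u) and w(v) for all u, v, from the weighted sums, and the
    adjugate of the residue form of the plane at w(v), from the Gauss sums. These two invariants
    yield one isometry over F_q valid for all v at once, by cases on the rank of the span of the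
    w(v). The case (0, 0, 2k+1) uses only a bijection preserving the values of degree at most 2k+1,
    because Poisson summation gives no more for the dual lattices. *)

Section LaurentDegree.
Variable F : fieldType.
Local Notation E := (laurent F).
Implicit Types (f g h : E) (m n : int).

Lemma lcoef_sum I (r : seq I) (P : pred I) (f : I -> E) n :
  (\sum_(i <- r | P i) f i) n = \sum_(i <- r | P i) f i n.
Proof. by apply: (big_morph (fun f : E => f n)). Qed.

Lemma lcoefN f n : (- f) n = - f n. Proof. by []. Qed.

Lemma lbound_le f m n : lbound f m -> m <= n -> lbound f n.
Proof. by move=> fm mn k nk; apply: fm; apply: le_lt_trans nk. Qed.

Lemma lbound0 n : lbound (0 : E) n. Proof. by move=> k _; rewrite lcoef0. Qed.

Lemma lboundD f g n : lbound f n -> lbound g n -> lbound (f + g) n.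
Proof. by move=> fn gn k nk; rewrite lcoefD fn// gn// addr0. Qed.

Lemma lboundN f n : lbound f n -> lbound (- f) n.
Proof. by move=> fn k nk; rewrite lcoefN fn// oppr0. Qed.

Lemma lboundB f g n : lbound f n -> lbound g n -> lbound (f - g) n.
Proof. by move=> fn gn; apply: lboundD => //; apply: lboundN. Qed.

Lemma lbound_pred f n : lbound f n -> f n = 0 -> lbound f (n - 1).
Proof.
move=> fn f0 k nk; have [->//|kn] := eqVneq k n; apply: fn; lia.
Qed.

Lemma lcoefM_top f g m n : lbound f m -> lbound g n -> (f * g) (m + n) = f m * g n.
Proof.
move=> fm gn; rewrite lcoefM (fsbigE [:: m])//.
- by rewrite big_cons big_nil classical_sets.in_setT /= addr0 (_ : m + n - m = n)//; lia.
- move=> i _; rewrite inE => /eqP im; have [mi|im'] := ltP m i.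
    by rewrite fm// mul0r.
  by rewrite gn ?mulr0//; lia.
Qed.

Lemma lboundM f g m n : lbound f m -> lbound g n -> lbound (f * g) (m + n).
Proof.
move=> fm gn k mnk; rewrite lcoefM fsbig1// => i _.
have [mi|im'] := ltP m i; first by rewrite fm// mul0r.
by rewrite gn ?mulr0//; lia.
Qed.

Lemma lboundMle f g m n k :
  lbound f m -> lbound g n -> m + n <= k -> lbound (f * g) k.
Proof. by move=> fm gn; apply: lbound_le; apply: lboundM. Qed.

Lemma lcoef_monomM (c : F) k f n : (lmonom c k * f) n = c * f (n - k).
Proof.
rewrite lcoefM (fsbigE [:: k])//.
- by rewrite big_cons big_nil classical_sets.in_setT Monoid.mulm1 lcoef_monom eqxx.
- by move=> i _; rewrite inE lcoef_monom => /negPf->; rewrite mul0r.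
Qed.

Lemma lbound_monom (c : F) k : lbound (lmonom c k) k.
Proof. by move=> n kn; rewrite lcoef_monom; case: eqP => //; lia. Qed.

Lemma lmonomM (c d : F) k l : lmonom c k * lmonom d l = lmonom (c * d) (k + l).
Proof.
apply/laurentP => n; rewrite lcoef_monomM !lcoef_monom.
have -> : (n - k == l) = (n == k + l) by apply/eqP/eqP; lia.
by case: eqP => // _; rewrite mulr0.
Qed.

Lemma lmonom10 : lmonom 1 0 = 1 :> E. Proof. by []. Qed.

Lemma lmonom_neq0 (c : F) k : c != 0 -> lmonom c k != 0.
Proof.
by move=> c0; apply: contra_neq c0 => /laurentP/(_ k); rewrite lcoef_monom eqxx.
Qed.

Lemma lbound_eq0 f : (forall n : nat, lbound f (- n%:Z)) -> f = 0.
Proof.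
move=> fn; apply/laurentP => k; rewrite lcoef0; apply: (fn (`|k|.+1)%N); lia.
Qed.

(** [ldeg 0] is the default 0 rather than minus infinity. Degree bounds are therefore stated with
    [lbound], which the zero series satisfies for every n. *)
Definition ldeg f : int :=
  xget 0 [set n : int | lbound f n /\ f n != 0].

Lemma ldeg_exists f : f != 0 -> exists n, lbound f n /\ f n != 0.
Proof.
move=> f0; have [N fN] := lboundP f.
have exk : exists k : nat, f (N - k%:Z) != 0.
  apply: contrapT => /forallNP nf; case/eqP: f0; apply/laurentP => k.
  rewrite lcoef0; have [kN|] := ltP N k; first exact: fN.
  move=> kN; have := nf `|N - k|%N; rewrite (_ : N - _ = k); last lia.
  by move=> /negP; rewrite negbK => /eqP.
have [k fk kmin] := ex_minnP exk; exists (N - k%:Z); split=> // n Mn.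
have [Nn|nN] := ltP N n; first exact: fN.
apply/eqP; apply: contraT => fn.
have := kmin `|N - n|%N; rewrite (_ : N - _ = n); last by lia.
by move=> /(_ fn); lia.
Qed.

Lemma ldegP f : f != 0 -> lbound f (ldeg f) /\ f (ldeg f) != 0.
Proof.
move=> /ldeg_exists[n nP]; rewrite /ldeg; case: xgetP => [m _ //|/(_ n)//].
Qed.

Lemma ldeg_bound f : f != 0 -> lbound f (ldeg f).
Proof. by move=> /ldegP[]. Qed.

Lemma ldeg_lead f : f != 0 -> f (ldeg f) != 0.
Proof. by move=> /ldegP[]. Qed.

Lemma ldeg_eq f n : lbound f n -> f n != 0 -> ldeg f = n.
Proof.
move=> fn f0; have /ldegP[fd fd0] : f != 0.
  by apply: contra_neq f0 => ->; rewrite lcoef0.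
have [lt|lt|//] := ltgtP (ldeg f) n.
- by rewrite fd ?eqxx in f0.
- by rewrite fn ?eqxx in fd0.
Qed.

Lemma ldeg_le f n : f != 0 -> lbound f n -> ldeg f <= n.
Proof.
by move=> /ldeg_lead f0 fn; rewrite leNgt; apply: contra_neqN f0 => /fn.
Qed.

Lemma ldeg_neq0 f n : f n != 0 -> f != 0.
Proof. by apply: contra_neq => ->; rewrite lcoef0. Qed.

Lemma le_ldeg f n : f != 0 -> ldeg f <= n -> lbound f n.
Proof. by move=> /ldeg_bound; apply: lbound_le. Qed.

Lemma ldegM f g : f != 0 -> g != 0 -> ldeg (f * g) = ldeg f + ldeg g.
Proof.
move=> f0 g0; apply: ldeg_eq; first by apply: lboundM; apply: ldeg_bound.
by rewrite lcoefM_top ?mulf_neq0 ?ldeg_lead//; apply: ldeg_bound.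
Qed.

Lemma lbound1 : lbound (1 : E) 0.
Proof. exact: lbound_monom. Qed.

Lemma lcoef1 : (1 : E) 0 = 1.
Proof. by rewrite -lmonom10 lcoef_monom. Qed.

Lemma ldeg1 : ldeg 1 = 0.
Proof. by apply: ldeg_eq; [exact: lbound1|rewrite lcoef1 oner_neq0]. Qed.

Lemma ldegV f : f != 0 -> ldeg f^-1 = - ldeg f.
Proof.
move=> f0; have := ldegM f0 (invr_neq0 f0); rewrite divff// ldeg1; lia.
Qed.

Lemma lboundV f n : lbound f n -> f n != 0 -> lbound f^-1 (- n).
Proof.
move=> fn fn0; rewrite -(ldeg_eq fn fn0) -ldegV ?(ldeg_neq0 fn0)//.
by apply: ldeg_bound; rewrite invr_neq0// (ldeg_neq0 fn0).
Qed.

Lemma lcoefV_top f n : lbound f n -> f n != 0 -> f^-1 (- n) = (f n)^-1.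
Proof.
move=> fn fn0; have f0 := ldeg_neq0 fn0.
have := lcoefM_top fn (lboundV fn fn0); rewrite divff// subrr lcoef1 => e.
by apply: (mulfI fn0); rewrite -e divff.
Qed.

Definition lcst (c : F) : E := laurent_of_poly c%:P.

Lemma lcst_monom c : lcst c = lmonom c 0.
Proof.
apply/laurentP => -[n|n] //=; rewrite /laurent_of_poly_coef /lmonom_coef coefC.
by case: n.
Qed.

Lemma lcst_is_zmod_morphism : zmod_morphism lcst.
Proof. by move=> a b; rewrite /lcst !rmorphB. Qed.
Lemma lcst_is_monoid_morphism : monoid_morphism lcst.
Proof. by split=> [|a b]; rewrite /lcst ?rmorph1 ?rmorphM. Qed.
HB.instance Definition _ := GRing.isZmodMorphism.Build F E lcst
  lcst_is_zmod_morphism.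
HB.instance Definition _ := GRing.isMonoidMorphism.Build F E lcst
  lcst_is_monoid_morphism.

Lemma lcoef_cstM c f n : (lcst c * f) n = c * f n.
Proof. by rewrite lcst_monom lcoef_monomM subr0. Qed.

Lemma lbound_cst c : lbound (lcst c) 0.
Proof. by rewrite lcst_monom; apply: lbound_monom. Qed.

Lemma lbound_cstM c f n : lbound f n -> lbound (lcst c * f) n.
Proof. by move=> fn k nk; rewrite lcoef_cstM fn// mulr0. Qed.

Lemma lbound_twice f n : lbound f n -> lbound (2%:R * f) n.
Proof. by move=> fn; rewrite -(rmorph_nat lcst); apply: lbound_cstM. Qed.

Lemma lcoef_top0 f n m : lbound f n -> n < m -> f m = 0.
Proof. by move=> fn nm; apply: fn. Qed.

Lemma lcst_eq0 c : (lcst c == 0) = (c == 0).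
Proof. by rewrite fmorph_eq0. Qed.

Lemma lcoef_poly (p : {poly F}) (n : nat) : laurent_of_poly p n%:Z = p`_n.
Proof. by []. Qed.

Lemma lcoef_poly_neg (p : {poly F}) n : n < 0 -> laurent_of_poly p n = 0.
Proof. by case: n => // n; lia. Qed.

Lemma lbound_poly (p : {poly F}) (n : nat) :
  (size p <= n)%N <-> lbound (laurent_of_poly p) (n%:Z - 1).
Proof.
split=> [pn [k|k] nk //=|pn]; first by rewrite nth_default// (leq_trans pn)//; lia.
by apply/leq_sizeP => j nj; rewrite -lcoef_poly pn//; lia.
Qed.

Lemma ldeg_poly (p : {poly F}) : p != 0 ->
  ldeg (laurent_of_poly p) = (size p)%:Z - 1.
Proof.
move=> p0; apply: ldeg_eq; first exact/lbound_poly.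
have : (0 < size p)%N by rewrite size_poly_gt0.
case e : (size p) => [//|n] _; rewrite (_ : n.+1%:Z - 1 = n%:Z); last lia.
by rewrite lcoef_poly -[n]/(n.+1.-1) -e -lead_coefE lead_coef_eq0.
Qed.

Lemma ldeg_poly_ge0 (p : {poly F}) : p != 0 -> 0 <= ldeg (laurent_of_poly p).
Proof. by move=> p0; rewrite ldeg_poly//; move: p0; rewrite -size_poly_gt0; lia. Qed.

Lemma lpolyX : laurent_of_poly 'X = lmonom 1 1 :> E.
Proof.
apply/laurentP => -[n|n] //=; rewrite /laurent_of_poly_coef /lmonom_coef coefX.
by case: n => [|[|n]].
Qed.

Lemma lmonomX (k : nat) : lmonom 1 k%:Z = laurent_of_poly 'X^k :> E.
Proof.
rewrite rmorphXn/= lpolyX; elim: k => [|k IH]; first by rewrite expr0 lmonom10.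
by rewrite exprS -IH lmonomM mul1r; congr lmonom; lia.
Qed.

(** The polynomial part of the series. For a negative degree the absolute value only adds zero
    coefficients. *)
Definition lfloor f : {poly F} := \poly_(i < `|ldeg f|.+1) f i%:Z.

Lemma coef_lfloor f (i : nat) : (lfloor f)`_i = f i%:Z.
Proof.
rewrite coef_poly; case: ltnP => // li; have [->|/ldegP[fd _]] := eqVneq f 0.
  by rewrite lcoef0.
by rewrite fd//; lia.
Qed.

Lemma lfloorP f : lbound (f - laurent_of_poly (lfloor f)) (-1).
Proof.
by move=> [k|k] nk; [rewrite lcoefB /= coef_lfloor subrr|lia].
Qed.

Lemma size_lfloor f (n : nat) : lbound f (n%:Z - 1) -> (size (lfloor f) <= n)%N.
Proof.
by move=> fn; apply/leq_sizeP => j nj; rewrite coef_lfloor fn//; lia.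
Qed.

(** The residue pairing. An identity between series is proved by testing it against all [lres v],
    which turns it into identities over F; a monomial v isolates one coefficient. *)
Definition lres f g : F := (f * g) (-1).

Lemma lresDl f g h : lres (f + g) h = lres f h + lres g h.
Proof. by rewrite /lres mulrDl lcoefD. Qed.
Lemma lresDr f g h : lres h (f + g) = lres h f + lres h g.
Proof. by rewrite /lres mulrDr lcoefD. Qed.
Lemma lresNr f g : lres f (- g) = - lres f g.
Proof. by rewrite /lres mulrN lcoefN. Qed.
Lemma lresBr f g h : lres h (f - g) = lres h f - lres h g.
Proof. by rewrite lresDr lresNr. Qed.
Lemma lresZl c f g : lres (lcst c * f) g = c * lres f g.
Proof. by rewrite /lres -mulrA lcoef_cstM. Qed.
Lemma lresZr c f g : lres f (lcst c * g) = c * lres f g.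
Proof. by rewrite /lres mulrCA lcoef_cstM. Qed.
Lemma lres0r f : lres f 0 = 0. Proof. by rewrite /lres mulr0. Qed.
Lemma lres0l f : lres 0 f = 0. Proof. by rewrite /lres mul0r. Qed.
Lemma lres_small f g m n : lbound f m -> lbound g n -> m + n < -1 -> lres f g = 0.
Proof. by move=> fm gn mn; rewrite /lres (lboundM fm gn). Qed.
Lemma lres_top f g m n : lbound f m -> lbound g n -> m + n = -1 ->
  lres f g = f m * g n.
Proof. by move=> fm gn mn; rewrite /lres -mn lcoefM_top. Qed.
Lemma lres_monom c k f : lres (lmonom c k) f = c * f (-1 - k).
Proof. by rewrite /lres lcoef_monomM. Qed.

Lemma lres_eq0 f : (forall v, lres v f = 0) -> f = 0.
Proof.
move=> vf; apply/laurentP => n; rewrite lcoef0.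
have := vf (lmonom 1 (- 1 - n)); rewrite lres_monom mul1r => <-.
by congr (f _); lia.
Qed.

(** Completeness: the coefficient of t^-j no longer changes from step j on, and the limit collects
    these final coefficients. *)
Lemma laurent_limit (s : nat -> E) : (forall n : nat, lbound (s n) 0) ->
  (forall n : nat, lbound (s n.+1 - s n) (- n.+1%:Z)) ->
  exists L, forall n : nat, lbound (L - s n) (- n.+1%:Z).
Proof.
move=> s0 sn; pose c (k : int) : F := if 0 < k then 0 else s `|k|%N k.
have cB : c \in @bounded_above F.
  by apply/asboolP; exists 0 => k k0; rewrite /c k0.
exists (Laurent cB) => n k nk; rewrite lcoefB /= /c; case: ifPn => [k0|].
  by rewrite s0// subr0.
rewrite -leNgt => k0.
have st (m : nat) : (`|k| <= m)%N -> s m k = s `|k|%N k.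
  elim: m => [|m IH] km; first by congr (s _ k); lia.
  have [->//|km'] := eqVneq `|k|%N m.+1.
  rewrite -IH; last lia.
  by apply/eqP; rewrite -subr_eq0 -lcoefB; apply/eqP/sn; lia.
by rewrite -(st n) ?subrr//; lia.
Qed.

Lemma sqrt_one_plus f : 2%:R != 0 :> F -> lbound f (-1) ->
  exists2 s : E, s ^+ 2 = 1 + f & s != 0.
Proof.
move=> two f1; have e2 : 2%:R = lcst 2%:R :> E by rewrite rmorph_nat.
have two' : 2%:R != 0 :> E by rewrite e2 lcst_eq0.
have half : lbound (2%:R^-1 : E) 0.
  rewrite e2; have := lboundV (@lbound_cst 2%:R); rewrite oppr0; apply.
  by rewrite lcst_monom lcoef_monom.
(* Newton's iteration with the derivative 2s frozen at s = 1. An error r becomes -r(s - 1) +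
   (r/2)^2, so each step gains at least one degree. *)
pose nx (s : E) := s - (s ^+ 2 - (1 + f)) * 2%:R^-1.
pose s (n : nat) := iter n nx 1.
have sP (n : nat) : lbound (s n - 1) (-1) /\ lbound ((s n) ^+ 2 - (1 + f)) (- n.+1%:Z).
  elim: n => [|n [IH1 IH2]].
    split; first by rewrite subrr; apply: lbound0.
    by rewrite expr1n opprD addrA subrr sub0r; apply: lboundN.
  set r := s n ^+ 2 - (1 + f) in IH2.
  have -> : s n.+1 = s n - r * 2%:R^-1 by [].
  split.
    rewrite addrAC; apply: lboundB => //.
    by apply: (lboundMle IH2 half); lia.
  have -> : (s n - r / 2%:R) ^+ 2 - (1 + f) =
    - (r * (s n - 1)) + (r * 2%:R^-1) * (r * 2%:R^-1).
    by rewrite /r; field.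
  apply: lboundD.
    by apply: lboundN; apply: (lboundMle IH2 IH1); lia.
  by apply: (lboundMle (lboundM IH2 half) (lboundM IH2 half)); lia.
have s0 (n : nat) : lbound (s n) 0.
  rewrite -[s n](subrK 1); apply: lboundD; last exact: lbound1.
  by apply: lbound_le (sP n).1 _.
have sd (n : nat) : lbound (s n.+1 - s n) (- n.+1%:Z).
  rewrite (_ : _ - _ = - ((s n ^+ 2 - (1 + f)) * 2%:R^-1)); last first.
    by rewrite /= /nx; field.
  by apply: lboundN; apply: (lboundMle (sP n).2 half); lia.
have [L LP] := laurent_limit s0 sd.
have L0 : lbound L 0.
  rewrite -[L](subrK (s 0%N)); apply: lboundD => //.
  by apply: lbound_le (LP 0%N) _.
exists L.
  apply/eqP; rewrite -subr_eq0; apply/eqP/lbound_eq0 => n.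
  rewrite (_ : L ^+ 2 - _ = (L - s n) * (L + s n) + (s n ^+ 2 - (1 + f))); last ring.
  apply: lboundD; last by apply: lbound_le (sP n).2 _; lia.
  by apply: (lboundMle (LP n) (lboundD L0 (s0 n))); lia.
have : L 0 != 0.
  have := LP 0%N 0; rewrite lcoefB lcoef1 => /(_ isT)/eqP.
  by rewrite subr_eq0 => /eqP->; rewrite oner_neq0.
exact: ldeg_neq0.
Qed.

End LaurentDegree.

(** * Sums over finite fields *)

Section FiniteField.
Variable F : finFieldType.
Hypothesis q_odd : odd #|F|.
Implicit Types (a b c d x y : F).

Lemma natr_card : #|F|%:R = 0 :> F.
Proof.
have : \sum_(x : F) x = \sum_(x : F) (x + 1).
  by rewrite (reindex_inj (addIr 1)).
rewrite big_split/= sumr_const => /eqP.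
by rewrite -subr_eq0 opprD addNKr oppr_eq0 => /eqP.
Qed.

Lemma two_neq0 : 2%:R != 0 :> F.
Proof.
apply/eqP => two; have := natr_card; rewrite -(odd_double_half #|F|) q_odd.
by rewrite natrD -muln2 natrM two mulr0 addr0 => /eqP; rewrite oner_eq0.
Qed.

Lemma oppr_neq x : x != 0 -> - x != x.
Proof.
apply: contra_neq => /eqP; rewrite -subr_eq0 -opprD oppr_eq0 -mulr2n -mulr_natl.
by rewrite mulf_eq0 (negPf two_neq0) => /eqP.
Qed.

Lemma sum_nz_one : \sum_(z : F * F | z != 0) 1 = - 1 :> F.
Proof.
have : \sum_(z : F * F) 1 = 0 :> F.
  by rewrite sumr_const card_prod natrM natr_card mulr0.
rewrite (bigD1 (0 : F * F))//= => /eqP; rewrite addrC addr_eq0 => /eqP <-.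
by apply: eq_bigl => z.
Qed.

Definition squares : {set F} := [set x ^+ 2 | x in F].

Lemma squaresP a : reflect (exists x, a = x ^+ 2) (a \in squares).
Proof.
apply: (iffP imsetP) => [[x _ ->]|[x ->]]; first by exists x.
by exists x; rewrite ?inE.
Qed.

(** An element x is determined by x^2 and by the bit telling whether x is the chosen root of x^2.
    Equality is excluded because q is odd, and the pigeonhole arguments below need the strict
    inequality. *)
Lemma card_squares : (#|F| < 2 * #|squares|)%N.
Proof.
have qs : (#|F| <= 2 * #|squares|)%N.
  pose r (y : F) := odflt 0 [pick x | x ^+ 2 == y].
  have rP x : r (x ^+ 2) ^+ 2 = x ^+ 2.
    by rewrite /r; case: pickP => [z /eqP//|/(_ x)]; rewrite eqxx.
  pose g (x : F) := (x == r (x ^+ 2), x ^+ 2).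
  have gi : injective g.
    move=> x y [e1 e2]; move: e1; rewrite -e2; have := rP x; set t := r _ => tx.
    have := tx; rewrite e2 => /eqP; move/eqP: tx; rewrite !eqf_sqr !(eq_sym t).
    rewrite !eqr_oppLR => /orP tx /orP ty exy.
    have [yt|yt] := eqVneq y t; first by move: exy; rewrite yt eqxx => /eqP.
    case: ty => [/eqP ty|/eqP ->]; first by rewrite ty eqxx in yt.
    by case: tx => [|/eqP //]; rewrite exy (negPf yt).
  have -> : (2 * #|squares| = #|setX [set: bool] squares|)%N.
    by rewrite cardsX cardsT card_bool.
  rewrite -(card_codom gi); apply: subset_leq_card.
  apply/subsetP => u /codomP[x ->]; rewrite inE/= inE/=.
  by apply/squaresP; exists x.
rewrite ltn_neqAle qs andbT; apply: contraTneq q_odd => ->.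
by rewrite mul2n odd_double.
Qed.

Lemma card_scale_squares c a : a != 0 -> #|[set c - a * x | x in squares]| = #|squares|.
Proof. by move=> a0; rewrite card_imset// => x y /addrI/oppr_inj/(mulfI a0). Qed.

(** Pigeonhole: the values a x^2 and the values c - b y^2 each fill more than half of F. The shape 0
    - (- a) x lets [card_scale_squares] count both sets. *)
Lemma binary_universal a b c : a != 0 -> b != 0 ->
  exists x, exists y, a * x ^+ 2 + b * y ^+ 2 = c.
Proof.
move=> a0 b0; set A := [set 0 - (- a) * x | x in squares].
set B := [set c - b * x | x in squares].
have cA : #|A| = #|squares| by apply: card_scale_squares; rewrite oppr_eq0.
have cB : #|B| = #|squares| by apply: card_scale_squares.
have : A :&: B != set0.
  rewrite -card_gt0; have := cardsUI A B; rewrite cA cB.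
  have := subset_leq_card (subsetT (A :|: B)); rewrite cardsT.
  have := card_squares; move: #|squares| #|A :|: B| #|A :&: B| #|F|; lia.
case/set0Pn => z /setIP[/imsetP[_ /squaresP[x ->]] zx /imsetP[_ /squaresP[y ->]] zy].
by exists x, y; rewrite -[c](subrK (b * y ^+ 2)) -zy zx; ring.
Qed.

(** As a is not a square, a * squares and squares meet only in 0, so by [card_squares] they cover F.
    Hence b lies in a * squares. *)
Lemma nonsquareM a b : a \notin squares -> b \notin squares -> a * b \in squares.
Proof.
move=> na nb; have a0 : a != 0.
  by apply: contraNneq na => ->; apply/squaresP; exists 0; rewrite expr0n.
set A := [set 0 - (- a) * x | x in squares].
have cA : #|A| = #|squares| by apply: card_scale_squares; rewrite oppr_eq0.
have : A :&: squares \subset [set 0].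
  apply/subsetP => z /setIP[/imsetP[_ /squaresP[x ->] ->] /squaresP[y]].
  rewrite sub0r mulNr opprK inE => e; have [->|x0] := eqVneq x 0.
    by rewrite expr0n mulr0.
  case/negP: na; apply/squaresP; exists (y / x); rewrite expr_div_n -e.
  by rewrite mulfK// expf_neq0.
move=> /subset_leq_card; rewrite cards1 => I1.
have : b \in A :|: squares.
  suff -> : A :|: squares = setT by rewrite inE.
  apply/eqP; rewrite eqEcard subsetT cardsT.
  have := cardsUI A squares; rewrite cA; have := card_squares; move: I1.
  move: #|squares| #|A :|: squares| #|A :&: squares| #|F|; lia.
rewrite inE (negPf nb) orbF => /imsetP[_ /squaresP[x ->] ->].
by apply/squaresP; exists (a * x); ring.
Qed.

(** * Moments weighted by powers of a norm form *)

Section Moments.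
Variable d : F.
Hypothesis d_nonsq : d \notin squares.

(* The norm form of F(sqrt d).  Its weighted moments below are computed with the
   substitutions z -> sqrt d * z and z -> (1 + sqrt d) * z, which scale it. *)
Definition nrm (z : F * F) : F := z.1 ^+ 2 - d * z.2 ^+ 2.

Lemma nrm_eq0 z : (nrm z == 0) = (z == 0).
Proof.
case: z => x y; rewrite -[RHS]/((x == 0) && (y == 0)) /nrm/= subr_eq0.
have [->|y0] := eqVneq y 0; first by rewrite expr0n mulr0 sqrf_eq0 andbT.
rewrite andbF; apply: contraNF d_nonsq => /eqP e; apply/squaresP; exists (x / y).
by rewrite expr_div_n e mulfK// expf_neq0.
Qed.

Lemma nonsq_neq0 : d != 0.
Proof. by apply: contraNneq d_nonsq => ->; apply/squaresP; exists 0; rewrite expr0n. Qed.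

(** Since the inverse of 0 is 0, the zero vector has weight 0 when j > 0, and the sums effectively
    run over nonzero vectors. *)
Lemma sum_nrm_scale (h : F * F -> F * F) (k : F) (j : nat) (f : F * F -> F) :
  injective h -> (forall z, nrm (h z) = k * nrm z) -> k != 0 ->
  \sum_z nrm z ^- j * f z = k ^- j * \sum_z nrm z ^- j * f (h z).
Proof.
move=> hi hk k0; rewrite (reindex_inj hi) mulr_sumr; apply: eq_bigr => z _.
by rewrite hk exprMn invfM mulrA.
Qed.

Lemma sum_odd j (f : F * F -> F) : (forall z, f (z.1, - z.2) = - f z) ->
  \sum_z nrm z ^- j * f z = 0.
Proof.
move=> fo; set s := \sum_z _; apply/eqP; apply: contraTT isT => /oppr_neq/eqP[].
rewrite {2}/s (@sum_nrm_scale (fun z => (z.1, - z.2)) 1 j f)//.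
- rewrite expr1n invr1 mul1r /s -sumrN; apply: eq_bigr => z _.
  by rewrite fo mulrN.
- by move=> [x y] [x' y'] [-> /oppr_inj->].
- by move=> z; rewrite /nrm sqrrN mul1r.
- exact: oner_neq0.
Qed.

Lemma sum_nrm_pow j (f : F * F -> F) : (forall z, f z = nrm z ^+ j) -> (0 < j)%N ->
  \sum_z nrm z ^- j * f z = - 1.
Proof.
move=> fE j0; rewrite -sum_nz_one [LHS](bigD1 (0 : F * F))//= fE.
have -> : nrm 0 = 0 by apply/eqP; rewrite nrm_eq0.
rewrite expr0n gtn_eqF// mulr0 add0r; apply: eq_bigr => z z0.
by rewrite fE mulVf// expf_neq0// nrm_eq0.
Qed.

Let swap (z : F * F) := (d * z.2, z.1).
Let swap_inj : injective swap.
Proof. by move=> [x y] [x' y'] [/(mulfI nonsq_neq0)-> ->]. Qed.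
Let swapE z : nrm (swap z) = - d * nrm z.
Proof. by rewrite /nrm /=; ring. Qed.

(** Multiplication by sqrt d gives S = -dT for the moments of x^2 and y^2, and summing nrm/nrm gives
    S - dT = -1, so both are nonzero. What the sum detects is the contraction of the form (a, b, c)
    with the inverse of the norm form. *)
Lemma moment2 : exists2 s : F, s != 0 & forall a b c : F,
  \sum_z nrm z ^- 1 * (a * z.1 ^+ 2 + b * (z.1 * z.2) + c * z.2 ^+ 2) =
  s * (a - c / d).
Proof.
have d0 := nonsq_neq0.
set S := \sum_z nrm z ^- 1 * z.1 ^+ 2; set T := \sum_z nrm z ^- 1 * z.2 ^+ 2.
have U0 : \sum_z nrm z ^- 1 * (z.1 * z.2) = 0.
  by apply: sum_odd => z; rewrite mulrN.
have ST : S = - d * T.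
  rewrite /S (@sum_nrm_scale swap (- d))//= ?oppr_eq0//.
  rewrite -/T; under eq_bigr do rewrite exprMn mulrCA.
  rewrite -mulr_sumr -/T; field; rewrite oppr_eq0.
  exact: d0.
have : S - d * T = - 1.
  rewrite -(@sum_nrm_pow 1 nrm)//.
  rewrite /S /T mulr_sumr -sumrB; apply: eq_bigr => z _.
  by set n := nrm z ^- 1; rewrite /nrm; ring.
rewrite ST => e.
have T0 : T != 0 by apply: contra_eq_neq e => ->; rewrite !mulr0 subr0 eq_sym oppr_eq0 oner_eq0.
exists S; first by rewrite ST mulf_neq0// oppr_eq0.
move=> a b c; under eq_bigr do rewrite !mulrDr (mulrCA _ a) (mulrCA _ b) (mulrCA _ c).
by rewrite !big_split /= -!mulr_sumr U0 -/S -/T ST; field.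
Qed.

(** The moments X, Y, Z of x^4, x^2 y^2, y^4 satisfy X = d^2 Z, X - 2dY + d^2 Z = -1 and X = -3dY.
    Hence -8dY = -1, and Y is nonzero even in characteristic 3, where X and Z vanish. As Y is the
    coefficient of (2 x12)^2, the sum determines x12 up to sign once x11 and x22 are known. *)
Lemma moment4 : exists s3 s1 s2 : F, s1 != 0 /\ forall x11 x12 x22 : laurent F,
  \sum_z lcst (nrm z ^- 2) * (lcst (z.1 ^+ 2) * x11 +
     2%:R * (lcst (z.1 * z.2) * x12) + lcst (z.2 ^+ 2) * x22) ^+ 2 =
  lcst s3 * x11 ^+ 2 + lcst s1 * (2%:R * x12) ^+ 2 + 2%:R * lcst s1 * x11 * x22
  + lcst s2 * x22 ^+ 2.
Proof.
have d0 := nonsq_neq0; have two := two_neq0.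
set X := \sum_z nrm z ^- 2 * z.1 ^+ 4; set Z := \sum_z nrm z ^- 2 * z.2 ^+ 4.
set Y := \sum_z nrm z ^- 2 * (z.1 ^+ 2 * z.2 ^+ 2).
have O1 : \sum_z nrm z ^- 2 * (z.1 ^+ 3 * z.2) = 0.
  by apply: sum_odd => z /=; rewrite mulrN.
have O2 : \sum_z nrm z ^- 2 * (z.1 * z.2 ^+ 3) = 0.
  by apply: sum_odd => z /=; ring.
have XZ : X = d ^+ 2 * Z.
  rewrite /X (@sum_nrm_scale swap (- d))//= ?oppr_eq0//.
  under eq_bigr do rewrite exprMn mulrCA.
  rewrite -mulr_sumr -/Z; field; rewrite oppr_eq0.
  exact: d0.
have XYZ : X - 2%:R * d * Y + d ^+ 2 * Z = - 1.
  rewrite -(@sum_nrm_pow 2 (fun z => nrm z ^+ 2))//.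
  rewrite /X /Y /Z !mulr_sumr -sumrB -big_split /=; apply: eq_bigr => z _.
  by set n := nrm z ^- 2; rewrite /nrm; ring.
have d1 : 1 - d != 0.
  rewrite subr_eq0; apply: contraNneq d_nonsq => <-.
  by apply/squaresP; exists 1; rewrite expr1n.
have XY : X = - 3%:R * d * Y.
  have : (1 - d) ^+ 2 * X = X + 6%:R * d ^+ 2 * Y + d ^+ 4 * Z.
    rewrite {1}/X (@sum_nrm_scale (fun z => (z.1 + d * z.2, z.1 + z.2)) (1 - d))//=.
    - under eq_bigr => z _.
        rewrite (_ : _ * _ = nrm z ^- 2 * z.1 ^+ 4 +
           4%:R * d * (nrm z ^- 2 * (z.1 ^+ 3 * z.2)) +
           6%:R * d ^+ 2 * (nrm z ^- 2 * (z.1 ^+ 2 * z.2 ^+ 2)) +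
           4%:R * d ^+ 3 * (nrm z ^- 2 * (z.1 * z.2 ^+ 3)) +
           d ^+ 4 * (nrm z ^- 2 * z.2 ^+ 4)); last by set n := nrm z ^- 2; ring.
        over.
      rewrite !big_split /= -!mulr_sumr O1 O2 -/X -/Y -/Z; field; exact: d1.
    - move=> [x y] [x' y'] [e1 e2].
      have : (1 - d) * (y - y') = 0.
        rewrite (_ : _ * _ = (x + y) - (x + d * y) - ((x' + y') - (x' + d * y'))); last ring.
        by rewrite e1 e2 subrr.
      move/eqP; rewrite mulf_eq0 (negPf d1) subr_eq0 => /eqP ey; subst y'.
      by rewrite (addIr _ e2).
    - by move=> z; rewrite /nrm /=; ring.
  rewrite (_ : d ^+ 4 * Z = d ^+ 2 * X); last by rewrite XZ; ring.
  move=> e; apply: (@mulfI _ (- 2%:R * d)); first by rewrite mulf_neq0// oppr_eq0.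
  have : (1 - d) ^+ 2 * X - (X + 6%:R * d ^+ 2 * Y + d ^+ 2 * X) = 0 by rewrite e subrr.
  move=> e2; rewrite -[LHS]subr0 -e2; ring.
have Y0 : Y != 0.
  apply: contra_eq_neq XYZ => Y0.
  by rewrite -XZ XY Y0 !mulr0 !addr0 subr0 eq_sym oppr_eq0 oner_eq0.
exists X, Y, Z; split=> // x11 x12 x22.
under eq_bigr => z _.
  rewrite (_ : _ * _ =  lcst (nrm z ^- 2 * z.1 ^+ 4) * x11 ^+ 2 +
     lcst (nrm z ^- 2 * (z.1 ^+ 2 * z.2 ^+ 2)) * ((2%:R * x12) ^+ 2 + 2%:R * x11 * x22) +
     lcst (nrm z ^- 2 * (z.1 ^+ 3 * z.2)) * (4%:R * x11 * x12) +
     lcst (nrm z ^- 2 * (z.1 * z.2 ^+ 3)) * (4%:R * x22 * x12) +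
     lcst (nrm z ^- 2 * z.2 ^+ 4) * x22 ^+ 2); last first.
    by set n := nrm z ^- 2; rewrite !(rmorphXn, rmorphM) /=; ring.
  over.
rewrite !big_split /= -!mulr_suml -!rmorph_sum O1 O2 -/X -/Y -/Z rmorph0.
by ring.
Qed.

End Moments.

(** One coordinate of F over its prime field, used as an exponent of a primitive p-th root of unity;
    the vector with that coordinate 1 shows that it is nontrivial. *)
Lemma additive_character : exists psi : F -> algC,
  [/\ psi 0 = 1, {morph psi : x y / x + y >-> x * y} & exists x, psi x != 1].
Proof.
have [p p_pr pcharFp] := finPcharP F.
pose R := pPrimeCharType pcharFp.
have [z prim_z] := C_prim_root_exists (prime_gt0 p_pr).
pose n := dim R.
have n0 : (0 < n)%N.
  rewrite lt0n; apply/negP => /eqP n0; have := oner_neq0 R.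
  rewrite -(inj_eq (can_inj (@v2rK _ R))); case/negP; apply/eqP/rowP => i.
  by exfalso; case: i => i; have := n0; rewrite /n => ->.
pose i := Ordinal n0; pose t (x : R) : 'F_p := v2r x 0 i.
have tD : {morph t : x y / x + y} by move=> x y; rewrite /t linearD mxE.
have t0 : t 0 = 0 by rewrite /t linear0 mxE.
have pP : (Zp_trunc (pdiv p)).+2 = p by apply: Fp_cast.
exists (fun x => z ^+ (t x)); split; first by rewrite t0 expr0.
- move=> x y; rewrite tD /= -exprD -[in RHS](prim_expr_mod prim_z).
  by have e m : (m %% (Zp_trunc (pdiv p)).+2 = m %% p)%N; rewrite ?e ?pP.
- pose x0 := @r2v _ (R : vectType 'F_p) (delta_mx 0 i : 'rV_n); exists (x0 : F); rewrite /t r2vK mxE !eqxx /=.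
  have e : (1 %% (Zp_trunc (pdiv p)).+2 = 1)%N by rewrite pP modn_small ?prime_gt1.
  by rewrite -(prim_order_dvd prim_z) e gtnNdvd// prime_gt1.
Qed.

(** * Binary Gauss sums *)

Section Gauss.
Variable psi : F -> algC.
Hypothesis psi0 : psi 0 = 1.
Hypothesis psiD : {morph psi : x y / x + y >-> x * y}.
Hypothesis psi_nontriv : exists x, psi x != 1.

Lemma psi_sum I (r : seq I) (P : pred I) (f : I -> F) :
  psi (\sum_(i <- r | P i) f i) = \prod_(i <- r | P i) psi (f i).
Proof. exact: (big_morph _ psiD psi0). Qed.

Lemma sum_psi c : \sum_x psi (c * x) = if c == 0 then #|F|%:R else 0.
Proof.
case: eqP => [->|/eqP c0].
  by under eq_bigr do rewrite mul0r psi0; rewrite sumr_const.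
have [t t1] := psi_nontriv; set s := \sum_x _.
suff /eqP : s = psi t * s.
  by rewrite -subr_eq0 -{1}[s]mul1r -mulrBl mulf_eq0 subr_eq0 eq_sym (negPf t1) => /eqP.
rewrite {1}/s (reindex_inj (addrI (t / c))) mulr_sumr; apply: eq_bigr => x _.
by rewrite mulrDr mulrC divfK// psiD.
Qed.

Lemma psi_inj a b : (forall c, psi (c * a) = psi (c * b)) -> a = b.
Proof.
move=> ab; apply/eqP; rewrite -subr_eq0; apply/negPn/negP => d0.
have := sum_psi (a - b); rewrite (negPf d0) => /eqP.
under eq_bigr do rewrite mulrC mulrBr psiD ab -psiD subrr psi0.
by rewrite sumr_const pnatr_eq0 => /eqP e; have := finNzRing_gt1 F; rewrite e.
Qed.

Definition gauss2 a b c w1 w2 : algC := \sum_(z : F * F)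
  psi (a * z.1 ^+ 2 + 2%:R * b * (z.1 * z.2) + c * z.2 ^+ 2
       + 2%:R * (w1 * z.1 + w2 * z.2)).

(** Completing the square: translate by h = G^-1 w, found by Cramer's rule. *)
Lemma gauss2_shift a b c w1 w2 : a * c - b ^+ 2 != 0 ->
  gauss2 a b c w1 w2 = psi (- ((c * w1 ^+ 2 - 2%:R * b * w1 * w2 + a * w2 ^+ 2)
     / (a * c - b ^+ 2))) * gauss2 a b c 0 0.
Proof.
move=> D0; pose h1 := (c * w1 - b * w2) / (a * c - b ^+ 2).
pose h2 := (a * w2 - b * w1) / (a * c - b ^+ 2).
have k1 : h1 * (a * c - b ^+ 2) = c * w1 - b * w2 by rewrite divfK.
have k2 : h2 * (a * c - b ^+ 2) = a * w2 - b * w1 by rewrite divfK.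
have cmb x y : (x * h1 + y * h2) * (a * c - b ^+ 2) =
  x * (c * w1 - b * w2) + y * (a * w2 - b * w1) by rewrite -k1 -k2; ring.
clearbody h1 h2.
have e1 : w1 = a * h1 + b * h2 by apply: (mulIf D0); rewrite cmb; ring.
have e2 : w2 = b * h1 + c * h2 by apply: (mulIf D0); rewrite cmb; ring.
have -> : (c * w1 ^+ 2 - 2%:R * b * w1 * w2 + a * w2 ^+ 2) / (a * c - b ^+ 2) =
    a * h1 ^+ 2 + 2%:R * b * h1 * h2 + c * h2 ^+ 2.
  apply: (mulIf D0); rewrite divfK// e1 e2; ring.
rewrite /gauss2 (reindex_inj (addIr (- h1, - h2))) mulr_sumr.
apply: eq_bigr => -[x y] _; rewrite -psiD /=; congr psi; rewrite e1 e2; ring.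
Qed.

Lemma gauss2_neq0 a b c : a * c - b ^+ 2 != 0 -> gauss2 a b c 0 0 != 0.
Proof.
move=> D0; have two := two_neq0.
(* The second factor is the complex conjugate of the first. Writing the first variable as t + z
   makes the phase linear in z, so the sum over z vanishes unless t = 0. *)
suff : gauss2 a b c 0 0 * gauss2 (- a) (- b) (- c) 0 0 != 0.
  by rewrite mulf_eq0 negb_or => /andP[].
rewrite {1}/gauss2 mulr_suml.
have -> : \sum_(z : F * F) psi (a * z.1 ^+ 2 + 2%:R * b * (z.1 * z.2) +
   c * z.2 ^+ 2 + 2%:R * (0 * z.1 + 0 * z.2)) * gauss2 (- a) (- b) (- c) 0 0 =
  \sum_(z : F * F) \sum_(t : F * F)
    psi (a * t.1 ^+ 2 + 2%:R * b * (t.1 * t.2) + c * t.2 ^+ 2) *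
    (psi (2%:R * (a * t.1 + b * t.2) * z.1) * psi (2%:R * (b * t.1 + c * t.2) * z.2)).
  rewrite /gauss2; under eq_bigr do rewrite mulr_sumr.
  rewrite exchange_big /=; apply: eq_bigr => z _.
  rewrite (reindex_inj (addIr z)) /=; apply: eq_bigr => t _.
  by rewrite -!psiD; congr psi; rewrite /=; ring.
rewrite exchange_big /= (bigD1 (0 : F * F)) //= [X in _ + X]big1 => [|t t0].
  rewrite addr0 !mulr0 !expr0n /= !mulr0 !addr0 psi0.
  under eq_bigr do rewrite !mulr0 !mul0r psi0 !mulr1.
  rewrite sumr_const card_prod pnatr_eq0 muln_eq0 orbb.
  by apply: contraTneq (finNzRing_gt1 F) => ->.
rewrite -mulr_sumr; apply/eqP; rewrite mulf_eq0; apply/orP; right.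
rewrite -(pair_bigA _ (fun x y => psi (2%:R * (a * t.1 + b * t.2) * x) *
   psi (2%:R * (b * t.1 + c * t.2) * y)))/=.
under eq_bigr do rewrite -mulr_sumr.
rewrite -mulr_suml !sum_psi; case: ifPn => [e1|_]; last by rewrite mul0r.
case: ifPn => [e2|_]; last by rewrite mulr0.
move: e1 e2; rewrite !(mulf_eq0 2%:R) (negPf two) => /eqP e1 /eqP e2.
case/eqP: t0; have t1 : t.1 = 0.
  apply: (mulfI D0); rewrite mulr0.
  transitivity (c * (a * t.1 + b * t.2) - b * (b * t.1 + c * t.2)); first ring.
  by rewrite e1 e2; ring.
have t2 : t.2 = 0.
  apply: (mulfI D0); rewrite mulr0.
  transitivity (a * (b * t.1 + c * t.2) - b * (a * t.1 + b * t.2)); first ring.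
  by rewrite e1 e2; ring.
by rewrite [t]surjective_pairing t1 t2.
Qed.

(** Both sums are a phase times the same nonzero Gauss sum without linear term. The phases agree for
    every multiple t of the exponent, so [psi_inj] compares w^T G^-1 w on both sides. *)
Lemma gauss2_inj a b c w1 w2 w1' w2' : a * c - b ^+ 2 != 0 ->
  (forall t, gauss2 (t * a) (t * b) (t * c) (t * w1) (t * w2) =
             gauss2 (t * a) (t * b) (t * c) (t * w1') (t * w2')) ->
  c * w1 ^+ 2 - 2%:R * b * w1 * w2 + a * w2 ^+ 2 =
  c * w1' ^+ 2 - 2%:R * b * w1' * w2' + a * w2' ^+ 2.
Proof.
move=> D0 gg; have D0V : (a * c - b ^+ 2)^-1 != 0 by rewrite invr_eq0.
apply: (mulIf D0V); apply: oppr_inj; apply: psi_inj => t.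
have [->|t0] := eqVneq t 0; first by rewrite !mul0r.
have Dt : (t * a) * (t * c) - (t * b) ^+ 2 != 0.
  by rewrite (_ : _ - _ = t ^+ 2 * (a * c - b ^+ 2)) ?mulf_neq0 ?sqrf_eq0//; ring.
have e u1 u2 : t * - ((c * u1 ^+ 2 - 2%:R * b * u1 * u2 + a * u2 ^+ 2) * (a * c - b ^+ 2)^-1) =
 - ((t * c * (t * u1) ^+ 2 - 2%:R * (t * b) * (t * u1) * (t * u2) +
         t * a * (t * u2) ^+ 2) / (t * a * (t * c) - (t * b) ^+ 2)).
  have -> : t * a * (t * c) - (t * b) ^+ 2 = t ^+ 2 * (a * c - b ^+ 2) by ring.
  rewrite mulrN invfM; set D := _^-1; field; exact: t0.
rewrite !e; apply: (mulIf (gauss2_neq0 Dt)).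
by rewrite -(gauss2_shift (t * w1) (t * w2) Dt) -(gauss2_shift (t * w1') (t * w2') Dt) gg.
Qed.

End Gauss.
End FiniteField.

(** * Simultaneous isometries of binary forms *)

Section LinearAlgebra.
Variable F : finFieldType.
Hypothesis q_odd : odd #|F|.
Local Notation E := (laurent F).
Variable d : F.
Hypothesis d_nonsq : d \notin squares F.

Lemma dual_nrm_eq0 (x y : F) : x ^+ 2 - y ^+ 2 / d = 0 -> x = 0 /\ y = 0.
Proof.
move=> e; have d0 := nonsq_neq0 d_nonsq.
have : nrm d (y, x) == 0.
  rewrite /nrm /= (_ : y ^+ 2 - _ = - d * (x ^+ 2 - y ^+ 2 / d)); last by field.
  by rewrite e mulr0.
by rewrite nrm_eq0// => /eqP[-> ->].
Qed.

Variables (x11 x12 x22 y1 y2 y1' y2' : E).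
Let Q11 v := lres v x11.
Let Q12 v := lres v x12.
Let Q22 v := lres v x22.
Let w1 v := lres v y1.
Let w2 v := lres v y2.
Let w1' v := lres v y1'.
Let w2' v := lres v y2'.
Hypothesis Hdot : forall u v,
  w1 u * w1 v - w2 u * w2 v / d = w1' u * w1' v - w2' u * w2' v / d.
Hypothesis Hadj : forall v,
  Q22 v * w1 v ^+ 2 - 2%:R * Q12 v * w1 v * w2 v + Q11 v * w2 v ^+ 2 =
  Q22 v * w1' v ^+ 2 - 2%:R * Q12 v * w1' v * w2' v + Q11 v * w2' v ^+ 2.

(** In matrix form: h is invertible over F, h y' = y and h X h^T = X, with X the symmetric matrix of
    the x_ij. In the application X is the Gram matrix of the plane, and y, y' list the products of
    its basis with the third vectors of the two lattices. *)
Definition transfer_spec (h11 h12 h21 h22 : F) :=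
  [/\ h11 * h22 - h12 * h21 != 0,
   lcst h11 * y1' + lcst h12 * y2' = y1 /\ lcst h21 * y1' + lcst h22 * y2' = y2 &
   [/\ lcst h11 ^+ 2 * x11 + 2%:R * (lcst h11 * lcst h12) * x12 + lcst h12 ^+ 2 * x22 = x11,
    lcst h11 * lcst h21 * x11 + (lcst h11 * lcst h22 + lcst h12 * lcst h21) * x12 +
       lcst h12 * lcst h22 * x22 = x12 &
    lcst h21 ^+ 2 * x11 + 2%:R * (lcst h21 * lcst h22) * x12 + lcst h22 ^+ 2 * x22 = x22]].

Lemma transfer_specP (h11 h12 h21 h22 : F) : h11 * h22 - h12 * h21 != 0 ->
  (forall v, h11 * w1' v + h12 * w2' v = w1 v) ->
  (forall v, h21 * w1' v + h22 * w2' v = w2 v) ->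
  (forall v, h11 ^+ 2 * Q11 v + 2%:R * (h11 * h12) * Q12 v + h12 ^+ 2 * Q22 v = Q11 v) ->
  (forall v, h11 * h21 * Q11 v + (h11 * h22 + h12 * h21) * Q12 v + h12 * h22 * Q22 v = Q12 v) ->
  (forall v, h21 ^+ 2 * Q11 v + 2%:R * (h21 * h22) * Q12 v + h22 ^+ 2 * Q22 v = Q22 v) ->
  transfer_spec h11 h12 h21 h22.
Proof.
move=> D0 e1 e2 e3 e4 e5; rewrite /transfer_spec -!rmorphXn -!rmorphM -rmorphD.
have n2 : 2%:R = lcst 2%:R :> E by rewrite rmorph_nat.
rewrite n2 -!rmorphM.
by split=> //; [split|split]; apply/eqP; rewrite -subr_eq0; apply/eqP/lres_eq0 => v;
  rewrite lresBr !lresDr !lresZr; apply/eqP; rewrite subr_eq0; apply/eqP;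
  [exact: e1|exact: e2|exact: e3|exact: e4|exact: e5].
Qed.

Let w1D u v c : w1 (u + lcst c * v) = w1 u + c * w1 v.
Proof. by rewrite /w1 lresDl lresZl. Qed.
Let w2D u v c : w2 (u + lcst c * v) = w2 u + c * w2 v.
Proof. by rewrite /w2 lresDl lresZl. Qed.
Let w1D' u v c : w1' (u + lcst c * v) = w1' u + c * w1' v.
Proof. by rewrite /w1' lresDl lresZl. Qed.
Let w2D' u v c : w2' (u + lcst c * v) = w2' u + c * w2' v.
Proof. by rewrite /w2' lresDl lresZl. Qed.
Let Q11D u v c : Q11 (u + lcst c * v) = Q11 u + c * Q11 v.
Proof. by rewrite /Q11 lresDl lresZl. Qed.
Let Q12D u v c : Q12 (u + lcst c * v) = Q12 u + c * Q12 v.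
Proof. by rewrite /Q12 lresDl lresZl. Qed.
Let Q22D u v c : Q22 (u + lcst c * v) = Q22 u + c * Q22 v.
Proof. by rewrite /Q22 lresDl lresZl. Qed.

(** The dual norm form is anisotropic. Consequently w' is a linear function of w, which both rank
    cases below exploit. *)
Lemma zero_transfer v : w1 v = 0 -> w2 v = 0 -> w1' v = 0 /\ w2' v = 0.
Proof.
move=> e1 e2; have := Hdot v v; rewrite e1 e2 !mul0r subr0.
by rewrite -!expr2 => /esym/dual_nrm_eq0.
Qed.

(** Here w(v) = mu(v) e and w'(v) = mu(v) f for fixed e, f. The adjugate form R of each v takes
    equal values at e and f, so the linear involution exchanging e and f preserves it. If e and f
    are proportional, equality of dual norms forces f = e or f = -e, and a scalar suffices. *)
Lemma transfer_rank1 u : (w1 u, w2 u) != (0, 0) ->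
  (forall v, w1 u * w2 v = w2 u * w1 v) ->
  exists h11 h12 h21 h22, transfer_spec h11 h12 h21 h22.
Proof.
move=> u0 par; set e1 := w1 u in u0 par *; set e2 := w2 u in u0 par *.
set f1 := w1' u; set f2 := w2' u.
have [mu muP] : exists mu : E -> F, forall v, w1 v = mu v * e1 /\ w2 v = mu v * e2.
  have [e10|e10] := eqVneq e1 0.
    have e20 : e2 != 0 by apply: contra_neq u0 => ->; rewrite e10.
    exists (fun v => w2 v / e2) => v; rewrite divfK//; split=> //.
    by apply: (mulfI e20); rewrite -par e10; ring.
  exists (fun v => w1 v / e1) => v; rewrite divfK//; split=> //.
  by apply: (mulfI e10); rewrite par; field.
have muP' v : w1' v = mu v * f1 /\ w2' v = mu v * f2.
  have [e3 e4] := muP v; have [] := @zero_transfer (v + lcst (- mu v) * u).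
  - by rewrite w1D e3 -/e1; ring.
  - by rewrite w2D e4 -/e2; ring.
  rewrite w1D' w2D' -/f1 -/f2 => /eqP; rewrite mulNr subr_eq0 => /eqP-> /eqP.
  by rewrite mulNr subr_eq0 => /eqP->.
have mu1 : mu u = 1.
  have [e3 e4] := muP u; have [e10|e10] := eqVneq e1 0.
    have e20 : e2 != 0 by apply: contra_neq u0 => ->; rewrite e10.
    by apply: (mulIf e20); rewrite -e4 mul1r.
  by apply: (mulIf e10); rewrite -e3 mul1r.
pose R v (s t : F) := Q22 v * s ^+ 2 - 2%:R * Q12 v * s * t + Q11 v * t ^+ 2.
have Rmu v : mu v != 0 -> R v e1 e2 = R v f1 f2.
  move=> m0; have m20 : mu v ^+ 2 != 0 by rewrite sqrf_eq0.
  apply: (mulfI m20); rewrite /R; have := Hadj v.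
  have [-> ->] := muP v; have [-> ->] := muP' v => e.
  rewrite [LHS](_ : _ = Q22 v * (mu v * e1) ^+ 2 - 2%:R * Q12 v * (mu v * e1) * (mu v * e2)
    + Q11 v * (mu v * e2) ^+ 2); last ring.
  rewrite e; ring.
(* [Hadj] is void at v when mu(v) = 0; use v + u instead and subtract the identity for u. *)
have Ree v : R v e1 e2 = R v f1 f2.
  have [m0|] := eqVneq (mu v) 0; last exact: Rmu.
  have Ru : R u e1 e2 = R u f1 f2 by apply: Rmu; rewrite mu1 oner_neq0.
  have RD s t : R (v + lcst 1 * u) s t = R v s t + R u s t.
    by rewrite /R Q11D Q12D Q22D; ring.
  have /Rmu : mu (v + lcst 1 * u) != 0.
    apply: contra_neq u0 => m1.
    have := muP (v + lcst 1 * u); rewrite m1 !mul0r w1D w2D.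
    by have [-> ->] := muP v; rewrite m0 !mul0r !add0r !mul1r -/e1 -/e2 => -[-> ->].
  by rewrite !RD Ru => /addIr.
have ef : e1 ^+ 2 - e2 ^+ 2 / d = f1 ^+ 2 - f2 ^+ 2 / d.
  by have := Hdot u u; rewrite -!expr2.
have [De|De] := eqVneq (e1 * f2 - f1 * e2) 0.
  have [s [s2 [f1s f2s]]] : exists s : F, s ^+ 2 = 1 /\ (f1 = s * e1 /\ f2 = s * e2).
    have [e10|e10] := eqVneq e1 0.
      have e20 : e2 != 0 by apply: contra_neq u0 => ->; rewrite e10.
      have f10 : f1 = 0.
        by apply: (mulIf e20); rewrite mul0r; move: De; rewrite e10 mul0r sub0r => /eqP; rewrite oppr_eq0 => /eqP.
      exists (f2 / e2); rewrite divfK// f10 e10 mulr0; split=> //.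
      move: ef; rewrite f10 e10 !expr0n !sub0r => /oppr_inj/mulIf.
      rewrite invr_eq0 (nonsq_neq0 d_nonsq) => /(_ isT) ef.
      by rewrite expr_div_n -ef divff// sqrf_eq0.
    have ff : f2 = f1 / e1 * e2.
      apply: (mulfI e10); move/eqP: De; rewrite subr_eq0 => /eqP->.
      by rewrite mulrA; congr (_ * _); rewrite mulrC divfK.
    exists (f1 / e1); split; last by rewrite divfK.
    have n0 : e1 ^+ 2 - e2 ^+ 2 / d != 0.
      by apply: contra_neq u0 => /dual_nrm_eq0[-> ->].
    by apply: (mulIf n0); rewrite mul1r {2}ef ff; field; rewrite e10 (nonsq_neq0 d_nonsq).
  exists s, 0, 0, s; apply: transfer_specP.
  - by rewrite mul0r subr0 -expr2 s2 oner_neq0.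
  - by move=> v; have [-> ->] := muP' v; have [-> _] := muP v; rewrite f1s -[RHS]mul1r -s2; ring.
  - by move=> v; have [-> ->] := muP' v; have [_ ->] := muP v; rewrite f2s -[RHS]mul1r -s2; ring.
  - by move=> v; rewrite s2; ring.
  - by move=> v; rewrite -expr2 s2; ring.
  - by move=> v; rewrite s2; ring.
(* the linear map exchanging (e1, e2) and (f1, f2) *)
set D := e1 * f2 - f1 * e2 in De.
pose p := f1 * f2 - e1 * e2; pose s := e1 ^+ 2 - f1 ^+ 2; pose r := f2 ^+ 2 - e2 ^+ 2.
have D2 : p ^+ 2 + s * r = D ^+ 2 by rewrite /p /s /r /D; ring.
have rel v : Q22 v * s = Q11 v * r - 2%:R * Q12 v * p.
  have /eqP := Ree v; rewrite -subr_eq0 => /eqP e.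
  apply/eqP; rewrite -subr_eq0; apply/eqP; rewrite -e /R /s /r /p; ring.
have D20 : D ^+ 2 != 0 by rewrite sqrf_eq0.
exists (p / D), (s / D), (r / D), (- p / D); apply: transfer_specP.
- rewrite (_ : _ - _ = - (p ^+ 2 + s * r) / D ^+ 2); last by field.
  by rewrite D2 mulNr divff// oppr_eq0 oner_neq0.
- move=> v; have [-> ->] := muP' v; have [-> _] := muP v.
  apply: (mulIf De); transitivity (mu v * (p * f1 + s * f2)); first by field.
  by rewrite /p /s /D; ring.
- move=> v; have [-> ->] := muP' v; have [_ ->] := muP v.
  apply: (mulIf De); transitivity (mu v * (r * f1 - p * f2)); first by field.
  by rewrite /p /r /D; ring.
- move=> v; apply: (mulIf D20).
  transitivity (p ^+ 2 * Q11 v + 2%:R * p * s * Q12 v + s * (Q22 v * s)); first by field.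
  by rewrite rel -D2; ring.
- move=> v; apply: (mulIf D20).
  transitivity (p * r * Q11 v + (s * r - p ^+ 2) * Q12 v - p * (Q22 v * s)); first by field.
  by rewrite rel -D2; ring.
- move=> v; apply: (mulIf D20).
  transitivity (r * (Q11 v * r - 2%:R * Q12 v * p) + p ^+ 2 * Q22 v); first by field.
  by rewrite -rel -D2; ring.
Qed.

(** The map taking w to w' is orthogonal for the dual norm form, and h must be its inverse. The
    change D_x that it causes in the adjugate form of x is linear in x, traceless, and satisfies
    D_x(w(x)) = 0 by [Hadj]. Polarising this cubic identity forces D = 0. *)
Lemma transfer_rank2 u v : w1 u = 1 -> w2 u = 0 -> w1 v = 0 -> w2 v = 1 ->
  exists h11 h12 h21 h22, transfer_spec h11 h12 h21 h22.
Proof.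
move=> u1 u2 v1 v2; set f1 := w1' u; set f2 := w2' u; set g1 := w1' v; set g2 := w2' v.
have d0 := nonsq_neq0 d_nonsq; have two := two_neq0 q_odd.
have w'E x : w1' x = w1 x * f1 + w2 x * g1 /\ w2' x = w1 x * f2 + w2 x * g2.
  have [] := @zero_transfer (x + lcst (- w1 x) * u + lcst (- w2 x) * v).
  - by rewrite !w1D u1 v1; ring.
  - by rewrite !w2D u2 v2; ring.
  rewrite !w1D' !w2D' -/f1 -/f2 -/g1 -/g2 => e3 e4.
  by split; [rewrite -[LHS]subr0 -e3|rewrite -[LHS]subr0 -e4]; ring.
have ff : f1 ^+ 2 - f2 ^+ 2 / d = 1.
  by have := Hdot u u; rewrite u1 u2 -/f1 -/f2 -!expr2 => <-; ring.
have fg : f1 * g1 - f2 * g2 / d = 0.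
  by have := Hdot u v; rewrite u1 u2 v1 v2 -/f1 -/f2 => <-; ring.
have gg : g1 ^+ 2 - g2 ^+ 2 / d = - d^-1.
  by have := Hdot v v; rewrite v1 v2 -!expr2 => <-; ring.
(* The determinant of the orthogonal map, shown to be 1 or -1 below; it allows writing the inverse
   without division. *)
pose th := f1 * g2 - f2 * g1.
have g2E : g2 = th * f1.
  rewrite -[LHS]mul1r -ff; have -> : th * f1 = g2 * f1 ^+ 2 - f2 * (f1 * g1) by rewrite /th; ring.
  by move/eqP: fg; rewrite subr_eq0 => /eqP->; ring.
have g1E : g1 = th * f2 / d.
  rewrite -[LHS]mul1r -ff.
  have -> : th * f2 / d = f1 * (f2 * g2 / d) - f2 ^+ 2 / d * g1 by rewrite /th; ring.
  by move/eqP: fg; rewrite subr_eq0 => /eqP<-; ring.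
have th2 : th ^+ 2 = 1.
  have : th ^+ 2 * (f1 ^+ 2 - f2 ^+ 2 / d) = - d * (g1 ^+ 2 - g2 ^+ 2 / d).
    by rewrite g1E g2E; field.
  by rewrite ff gg mulr1 => ->; field.
have t11 : f1 ^+ 2 - d * g1 ^+ 2 = 1.
  rewrite -ff [in LHS]g1E (_ : d * _ = th ^+ 2 * (f2 ^+ 2 / d)); last by field.
  by rewrite th2 mul1r.
have t12 : f1 * f2 - d * (g1 * g2) = 0.
  rewrite g1E [g2 in LHS]g2E (_ : d * _ = th ^+ 2 * (f1 * f2)); last by field.
  by rewrite th2 mul1r subrr.
have t22 : f2 ^+ 2 - d * g2 ^+ 2 = - d.
  rewrite [in LHS]g2E exprMn th2 mul1r -[RHS]mulr1 -ff; by field.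
pose R x (s t : F) := Q22 x * s ^+ 2 - 2%:R * Q12 x * s * t + Q11 x * t ^+ 2.
pose al x := Q22 x - R x f1 f2; pose ga x := Q11 x - R x g1 g2.
pose be x := - Q12 x - (Q22 x * (f1 * g1) - Q12 x * (f1 * g2 + f2 * g1) + Q11 x * (f2 * g2)).
(* An orthogonal change of variables preserves the trace of a form relative to the norm form. *)
have traceless x : al x = d * ga x.
  apply/eqP; rewrite -subr_eq0; apply/eqP.
  transitivity (Q22 x * (1 - (f1 ^+ 2 - d * g1 ^+ 2))
     + 2%:R * Q12 x * (f1 * f2 - d * (g1 * g2))
     - Q11 x * (d + (f2 ^+ 2 - d * g2 ^+ 2))); first by rewrite /al /ga /R; ring.
  by rewrite t11 t12 t22; ring.
have alD x y c : al (x + lcst c * y) = al x + c * al y.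
  by rewrite /al /R Q11D Q12D Q22D; ring.
have beD x y c : be (x + lcst c * y) = be x + c * be y.
  by rewrite /be Q11D Q12D Q22D; ring.
have gaD x y c : ga (x + lcst c * y) = ga x + c * ga y.
  by rewrite /ga /R Q11D Q12D Q22D; ring.
pose D x (s t : F) := al x * s ^+ 2 + 2%:R * be x * (s * t) + ga x * t ^+ 2.
have DD x : D x (w1 x) (w2 x) = 0.
  have /eqP := Hadj x; have [-> ->] := w'E x; rewrite -subr_eq0 => /eqP <-.
  by rewrite /D /al /be /ga /R; ring.
(* The part of degree 2 in x and 1 in y. The difference of the values at x + y and x - y isolates it
   using only the inverse of 2, so that q = 3 is no exception. *)
have polar x y : D y (w1 x) (w2 x) + 2%:R * (al x * w1 x * w1 y +
    be x * (w1 x * w2 y + w2 x * w1 y) + ga x * w2 x * w2 y) = 0.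
  have := DD (x + lcst 1 * y); have := DD (x + lcst (-1) * y).
  have := DD x; have := DD y; rewrite /D !w1D !w2D !alD !beD !gaD => e1 e2 e3 e4.
  apply: (mulfI two); rewrite mulr0 -[RHS](subrr 0) -{1}e4 -e3.
  move: e1; set z := (X in X = 0) => e1.
  transitivity (2%:R * (al y * w1 x ^+ 2 + 2%:R * be y * (w1 x * w2 x) + ga y * w2 x ^+ 2 +
   2%:R * (al x * w1 x * w1 y + be x * (w1 x * w2 y + w2 x * w1 y) + ga x * w2 x * w2 y)) + 2%:R * z).
    by rewrite e1; ring.
  by rewrite /z; ring.
have alu : al u = 0 by have := DD u; rewrite /D u1 u2 => <-; ring.
have gau : ga u = 0 by apply: (mulfI d0); rewrite -traceless alu mulr0.
have gav : ga v = 0 by have := DD v; rewrite /D v1 v2 => <-; ring.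
have alv : al v = 0 by rewrite traceless gav mulr0.
have beu : be u = 0.
  apply: (mulfI two); rewrite mulr0 -[RHS](polar u v) /D u1 u2 v1 v2 alu alv gau gav; ring.
have bev : be v = 0.
  apply: (mulfI two); rewrite mulr0 -[RHS](polar v u) /D u1 u2 v1 v2 alu alv gau gav; ring.
have al0 y : al y = 0.
  by rewrite -[RHS](polar u y) /D u1 u2 alu beu gau; ring.
have ga0 y : ga y = 0 by apply: (mulfI d0); rewrite -traceless al0 mulr0.
have be0 y : be y = 0.
  apply: (mulfI two); rewrite mulr0 -[RHS](polar (u + lcst 1 * v) y).
  by rewrite /D w1D w2D u1 u2 v1 v2 !al0 !ga0 beD beu bev; ring.
have Rf y : R y f1 f2 = Q22 y by apply/esym/eqP; rewrite -subr_eq0; apply/eqP/al0.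
have Rg y : R y g1 g2 = Q11 y by apply/esym/eqP; rewrite -subr_eq0; apply/eqP/ga0.
have Rfg y : Q22 y * (f1 * g1) - Q12 y * (f1 * g2 + f2 * g1) + Q11 y * (f2 * g2) = - Q12 y.
  by apply/esym/eqP; rewrite -subr_eq0; apply/eqP/be0.
exists (th * g2), (- th * g1), (- th * f2), (th * f1); apply: transfer_specP.
- rewrite (_ : _ - _ = th ^+ 2 * th); last by rewrite /th; ring.
  rewrite th2 mul1r; apply: contra_eq_neq th2 => ->.
  by rewrite expr0n eq_sym oner_eq0.
- move=> x; have [-> ->] := w'E x.
  by transitivity (th ^+ 2 * w1 x); [rewrite /th; ring|rewrite th2 mul1r].
- move=> x; have [-> ->] := w'E x.
  by transitivity (th ^+ 2 * w2 x); [rewrite /th; ring|rewrite th2 mul1r].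
- move=> x; transitivity (th ^+ 2 * R x g1 g2); first by rewrite /R; ring.
  by rewrite th2 mul1r Rg.
- move=> x; transitivity (- th ^+ 2 * (Q22 x * (f1 * g1) - Q12 x * (f1 * g2 + f2 * g1) + Q11 x * (f2 * g2))); first by ring.
  by rewrite th2 Rfg; ring.
- move=> x; transitivity (th ^+ 2 * R x f1 f2); first by rewrite /R; ring.
  by rewrite th2 mul1r Rf.
Qed.

Lemma transfer_exists : exists h11 h12 h21 h22, transfer_spec h11 h12 h21 h22.
Proof.
have [[u u0]|/forallNP all0] := EM (exists u, (w1 u, w2 u) != (0, 0)); last first.
  have z v : w1 v = 0 /\ w2 v = 0.
    by have /negP := all0 v; rewrite negbK => /eqP[-> ->].
  exists 1, 0, 0, 1; apply: transfer_specP; rewrite ?mul0r ?mul1r ?subr0 ?oner_neq0//.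
  - by move=> v; have [e1 e2] := z v; have [-> ->] := zero_transfer e1 e2; rewrite e1; ring.
  - by move=> v; have [e1 e2] := z v; have [-> ->] := zero_transfer e1 e2; rewrite e2; ring.
  - by move=> v; ring.
  - by move=> v; ring.
  - by move=> v; ring.
have [par|] := EM (forall v, w1 u * w2 v = w2 u * w1 v); first exact: transfer_rank1 u0 par.
move=> /existsNP[v /eqP]; rewrite -subr_eq0; set D := _ - _ => D0.
(* Cramer's rule: w(u') = (1, 0) and w(v') = (0, 1). The summand 0 matches the shape of [w1D] and
   [w2D]. *)
pose u' := 0 + lcst (w2 v / D) * u + lcst (- w2 u / D) * v.
pose v' := 0 + lcst (- w1 v / D) * u + lcst (w1 u / D) * v.
have w10 : w1 0 = 0 by apply: lres0l.
have w20 : w2 0 = 0 by apply: lres0l.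
have cmb a b x y : 0 + a / D * x + b / D * y = (a * x + b * y) / D by ring.
apply: (@transfer_rank2 u' v'); rewrite ?w1D ?w2D ?w10 ?w20 cmb.
- by apply: (mulIf D0); rewrite divfK// mul1r /D; ring.
- by apply: (mulIf D0); rewrite divfK// mul0r; ring.
- by apply: (mulIf D0); rewrite divfK// mul0r; ring.
- by apply: (mulIf D0); rewrite divfK// mul1r /D; ring.
Qed.

End LinearAlgebra.

Local Arguments lcoef : simpl never.

(** * Minima (0, 0, 2k+1) *)

Section Lattice.
Variable F : fieldType.
Local Notation A := {poly F}.
Local Notation E := (laurent F).
Local Notation lp := (@laurent_of_poly F).

Section Bilinear.
Variable L : lmodType A.
Implicit Types (B : L -> L -> E) (v w x y : L) (a b c : A).

Definition bilinear_form B :=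
  (forall x y, B x y = B y x) /\
  (forall a x y z, B (a *: x + y) z = lp a * B x z + B y z).

Section BilinearTheory.
Variable B : L -> L -> E.
Hypothesis Bbil : bilinear_form B.

Lemma bilC x y : B x y = B y x. Proof. exact: Bbil.1. Qed.
Lemma bilDl x y z : B (x + y) z = B x z + B y z.
Proof. by rewrite -[x]scale1r Bbil.2 rmorph1 mul1r scale1r. Qed.
Lemma bil0l z : B 0 z = 0.
Proof. by apply: (addrI (B 0 z)); rewrite -bilDl !addr0. Qed.
Lemma bilZl a x z : B (a *: x) z = lp a * B x z.
Proof. by rewrite -[a *: x]addr0 Bbil.2 bil0l addr0. Qed.
Lemma bilDr x y z : B z (x + y) = B z x + B z y.
Proof. by rewrite bilC bilDl !(bilC z). Qed.
Lemma bilZr a x z : B z (a *: x) = lp a * B z x.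
Proof. by rewrite bilC bilZl (bilC z). Qed.
Lemma bilNl x z : B (- x) z = - B x z.
Proof. by rewrite -scaleN1r bilZl rmorphN rmorph1 mulN1r. Qed.
Lemma bilNr x z : B z (- x) = - B z x.
Proof. by rewrite bilC bilNl bilC. Qed.
Definition bilE := (bilDl, bilDr, bilZl, bilZr, bilNl, bilNr).

Lemma bil_sqD x y : B (x + y) (x + y) = B x x + 2%:R * B x y + B y y.
Proof. by rewrite !bilE (bilC y); ring. Qed.
Lemma bil_sqN x : B (- x) (- x) = B x x.
Proof. by rewrite !bilE opprK. Qed.

End BilinearTheory.

Definition comb3 v1 v2 v3 (p : A * A * A) := p.1.1 *: v1 + p.1.2 *: v2 + p.2 *: v3.
Definition basis3 v1 v2 v3 := bijective (comb3 v1 v2 v3).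

Lemma basis3P v1 v2 v3 :
  basis3 v1 v2 v3 <-> injective (comb3 v1 v2 v3) /\ (forall x, exists p, comb3 v1 v2 v3 p = x).
Proof.
split=> [bv|[vi vs]].
  by split=> [|x]; [exact: bij_inj|case: bv => g _ gK; exists (g x)].
exists (fun x => sval (cid (vs x))) => [p|x]; last by case: cid.
by case: cid => q /= /vi.
Qed.

Lemma basis3_change v1 v2 v3 (h : A * A * A -> A * A * A) w1 w2 w3 :
  basis3 v1 v2 v3 -> bijective h ->
  (forall p, comb3 w1 w2 w3 p = comb3 v1 v2 v3 (h p)) -> basis3 w1 w2 w3.
Proof.
by move=> bv bh e; apply: (eq_bij (bij_comp bv bh)) => p /=; rewrite e.
Qed.

Lemma basis3_block v1 v2 v3 (h11 h12 h21 h22 c : F) :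
  basis3 v1 v2 v3 -> h11 * h22 - h12 * h21 != 0 -> c != 0 ->
  basis3 (h11%:P *: v1 + h12%:P *: v2) (h21%:P *: v1 + h22%:P *: v2) (c%:P *: v3).
Proof.
set D := _ - _ => bv D0 c0.
pose h (p : A * A * A) := (p.1.1 * h11%:P + p.1.2 * h21%:P,
   p.1.1 * h12%:P + p.1.2 * h22%:P, p.2 * c%:P).
apply: (@basis3_change _ _ _ h _ _ _ bv); last first.
  move=> [[a b] e]; rewrite /comb3 /= !scalerDr !scalerDl !scalerA -!addrA.
  by congr (_ + _); rewrite addrCA.
pose i := D^-1%:P; have iD : i * (h11%:P * h22%:P - h12%:P * h21%:P) = 1.
  by rewrite /i -!polyCM -polyCB -polyCM mulVf.
have ic : c^-1%:P * c%:P = 1 by rewrite -polyCM mulVf.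
exists (fun p => (i * (p.1.1 * h22%:P - p.1.2 * h21%:P),
   i * (p.1.2 * h11%:P - p.1.1 * h12%:P), p.2 * c^-1%:P)) => -[[a b] e];
  rewrite /h /=; congr (_, _, _).
- by rewrite -[RHS]mul1r -iD; ring.
- by rewrite -[RHS]mul1r -iD; ring.
- by rewrite -mulrA [X in _ * X]mulrC ic mulr1.
- by rewrite -[RHS]mul1r -iD; ring.
- by rewrite -[RHS]mul1r -iD; ring.
- by rewrite -mulrA ic mulr1.
Qed.

End Bilinear.

Section Transport.
Variables (X X' : Type) (n : int) (Q : X -> E) (Q' : X' -> E).

(* Partial inverse bijections rather than equal numbers of vectors, so that the
   finiteness of the fibres is not needed. *)
Definition iso_upto :=
  exists (pi : X -> X') (pi' : X' -> X),
    (forall x, lbound (Q x) n -> Q' (pi x) = Q x /\ pi' (pi x) = x) /\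
    (forall x, lbound (Q' x) n -> Q (pi' x) = Q' x /\ pi (pi' x) = x).
End Transport.

Lemma iso_upto_sym X X' n (Q : X -> E) (Q' : X' -> E) :
  iso_upto n Q Q' -> iso_upto n Q' Q.
Proof. by case=> p [p' [H H']]; exists p', p. Qed.

(** As P is a condition on values, pi sends the vectors enumerated by e into those enumerated by e',
    and pi' inverts it there. *)
Lemma transport_inj (X X' : Type) n (Q : X -> E) (Q' : X' -> E) (P : E -> Prop)
    (I I' : finType) (e : I -> X) (e' : I' -> X') :
  iso_upto n Q Q' -> (forall a, P a -> lbound a n) ->
  injective e -> (forall i, P (Q (e i))) ->
  (forall x, P (Q' x) -> exists i, e' i = x) ->
  exists2 t : I -> I', injective t & forall i, Q' (e' (t i)) = Q (e i).
Proof.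
case=> pi [pi' [H H']] Pn ei Pe Pe'.
have Hp i : exists j, e' j = pi (e i).
  by apply: Pe'; have [-> _] := H _ (Pn _ (Pe i)); exact: Pe.
have tP i := projT2 (cid (Hp i)).
exists (fun i => projT1 (cid (Hp i))).
  move=> i j ij; apply: ei; have [_ ei2] := H _ (Pn _ (Pe i)).
  have [_ ej2] := H _ (Pn _ (Pe j)).
  by apply: etrans (esym ei2) _; apply: etrans _ ej2; congr pi'; rewrite -[LHS]tP -[RHS]tP ij.
by move=> i; rewrite tP; have [] := H _ (Pn _ (Pe i)).
Qed.

Lemma transport_sum (X X' : Type) n (Q : X -> E) (Q' : X' -> E) (P : E -> Prop)
    (I I' : finType) (e : I -> X) (e' : I' -> X') (R : nmodType) (f : E -> R) :
  iso_upto n Q Q' -> (forall a, P a -> lbound a n) ->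
  injective e -> injective e' ->
  (forall i, P (Q (e i))) -> (forall i, P (Q' (e' i))) ->
  (forall x, P (Q x) -> exists i, e i = x) ->
  (forall x, P (Q' x) -> exists i, e' i = x) ->
  \sum_i f (Q (e i)) = \sum_i f (Q' (e' i)).
Proof.
move=> iso Pn ei ei' Pe Pe' se se'.
have [t ti tQ] := transport_inj iso Pn ei Pe se'.
have [t' ti' _] := transport_inj (iso_upto_sym iso) Pn ei' Pe' se.
have cII : (#|I'| <= #|I|)%N := leq_card t' ti'.
rewrite [RHS](reindex t); last exact/onW_bij/(inj_card_bij ti cII).
by apply: eq_bigr => i _; rewrite tQ.
Qed.

End Lattice.

Section ReducedFlat.
Variable F : finFieldType.
Local Notation A := {poly F}.
Local Notation E := (laurent F).
Local Notation lp := (@laurent_of_poly F).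

(* Gram coefficients of a reduced basis with successive minima (0, 0, 2k+1) *)
Definition reduced_flat (L : lmodType A) (B : L -> L -> E) (v1 v2 v3 : L)
    (k : nat) (a1 a2 a3 : F) :=
  [/\ lbound (B v1 v1) 0 /\ B v1 v1 0 = a1,
      lbound (B v2 v2) 0 /\ B v2 v2 0 = a2,
      lbound (B v3 v3) (2 * k + 1)%N%:Z /\ B v3 v3 (2 * k + 1)%N%:Z = a3,
      [/\ lbound (B v1 v2) (-1), lbound (B v1 v3) (-1) & lbound (B v2 v3) (-1)] &
      [/\ a1 != 0, a3 != 0 & - a2 / a1 \notin squares F]].

Section OneLattice.
Variables (L : lmodType A) (B : L -> L -> E).
Hypothesis Bbil : bilinear_form B.
Variables (v1 v2 v3 : L) (k : nat) (a1 a2 a3 : F).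
Hypothesis vred : reduced_flat B v1 v2 v3 k a1 a2 a3.

Lemma lead_form_neq0 (c1 c2 : F) : (c1, c2) != (0, 0) ->
  a1 * c1 ^+ 2 + a2 * c2 ^+ 2 != 0.
Proof.
move=> c0; have [_ _ _ _ [a10 _ dn]] := vred.
rewrite (_ : _ + _ = a1 * nrm (- a2 / a1) (c1, c2)).
  by rewrite mulf_neq0// nrm_eq0.
by rewrite /nrm /=; field.
Qed.

Lemma plane_top (p1 p2 : A) (J : nat) (x := p1 *: v1 + p2 *: v2) :
  (size p1 <= J.+1)%N -> (size p2 <= J.+1)%N ->
  lbound (B x x) (2 * J)%N%:Z /\
  B x x (2 * J)%N%:Z = a1 * p1`_J ^+ 2 + a2 * p2`_J ^+ 2.
Proof.
move=> s1 s2; have [[b11 e11] [b22 e22] _ [b12 _ _] _] := vred.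
have l1 : lbound (lp p1) J%:Z by apply: lbound_le (proj1 (lbound_poly _ _) s1) _; lia.
have l2 : lbound (lp p2) J%:Z by apply: lbound_le (proj1 (lbound_poly _ _) s2) _; lia.
have -> : B x x = lp p1 * lp p1 * B v1 v1 + lp p2 * lp p2 * B v2 v2
   + (lp p1 * (lp p2 * B v1 v2) + lp p1 * (lp p2 * B v1 v2)).
  by rewrite /x !(bilE Bbil) (bilC Bbil v2); ring.
have -> : (2 * J)%N%:Z = J%:Z + J%:Z + 0 by lia.
have b3 : lbound (lp p1 * (lp p2 * B v1 v2)) (J%:Z + J%:Z + 0 - 1).
  by apply: (lboundMle l1 (lboundM l2 b12)); lia.
have b1 := lboundM (lboundM l1 l1) b11; have b2 := lboundM (lboundM l2 l2) b22.
have t1 := lcoefM_top (lboundM l1 l1) b11; have t2 := lcoefM_top (lboundM l2 l2) b22.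
rewrite (lcoefM_top l1 l1) in t1; rewrite (lcoefM_top l2 l2) in t2.
have b3' := lbound_le b3; split.
  by apply: lboundD; apply: lboundD => //; apply: b3'; lia.
have z3 : (lp p1 * (lp p2 * B v1 v2)) (J%:Z + J%:Z + 0) = 0 by apply: b3; lia.
rewrite !lcoefD z3 t1 t2 e11 e22 !lcoef_poly; ring.
Qed.

Lemma comb3_value (p : A * A * A) (x := p.1.1 *: v1 + p.1.2 *: v2) :
  B (comb3 v1 v2 v3 p) (comb3 v1 v2 v3 p) =
  B x x + 2%:R * (lp p.2 * B x v3) + lp p.2 ^+ 2 * B v3 v3.
Proof. by rewrite /comb3 -/x (bil_sqD Bbil) !(bilE Bbil); ring. Qed.

Lemma plane_cross (p1 p2 : A) (J : nat) :
  (size p1 <= J.+1)%N -> (size p2 <= J.+1)%N ->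
  lbound (B (p1 *: v1 + p2 *: v2) v3) (J%:Z - 1).
Proof.
move=> s1 s2; have [_ _ _ [_ b13 b23] _] := vred.
have l1 : lbound (lp p1) J%:Z by apply: lbound_le (proj1 (lbound_poly _ _) s1) _; lia.
have l2 : lbound (lp p2) J%:Z by apply: lbound_le (proj1 (lbound_poly _ _) s2) _; lia.
by rewrite !(bilE Bbil); apply: lboundD; apply: lboundM.
Qed.

(** Parity of degrees: a nonzero plane component contributes an even degree 2J with nonzero leading
    coefficient, p.2 contributes an odd degree, and the cross term is smaller. Nothing cancels, so
    each contribution above degree n must be absent. *)
Lemma flat_values (e : F) (n : int) (j : nat) (p : A * A * A) :
  lbound (B (comb3 v1 v2 v3 p) (comb3 v1 v2 v3 p) - lcst e * B v3 v3) n ->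
  n <= (2 * k + 1)%N%:Z -> n < (2 * j)%N%:Z ->
  exists c : F, [/\ p.2 = c%:P, (size p.1.1 <= j)%N, (size p.1.2 <= j)%N &
    n < (2 * k + 1)%N%:Z -> c ^+ 2 = e].
Proof.
rewrite comb3_value; case: p => [[p1 p2] p3] /=; set x := p1 *: v1 + p2 *: v2.
move=> bn nk nj; have [_ _ [b33 e33] _ [_ a30 _]] := vred.
pose J := (maxn (size p1) (size p2)).-1.
have s1 : (size p1 <= J.+1)%N by rewrite /J; lia.
have s2 : (size p2 <= J.+1)%N by rewrite /J; lia.
have [bx ex] := plane_top s1 s2; rewrite -/x in bx ex.
have bc := plane_cross s1 s2; rewrite -/x in bc.
set q := a1 * _ + _ in ex.
have q0 : (0 < maxn (size p1) (size p2))%N -> q != 0.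
  move=> m0; apply: lead_form_neq0.
  have [le|lt] := leqP (size p1) (size p2).
    have e2 : size p2 = J.+1 by rewrite /J; lia.
    have -> : p2`_J = lead_coef p2 by rewrite lead_coefE e2.
    have : lead_coef p2 != 0 by rewrite lead_coef_eq0 -size_poly_eq0 e2.
    by apply: contra_neq => -[_ ->].
  have e1 : size p1 = J.+1 by rewrite /J; lia.
  have -> : p1`_J = lead_coef p1 by rewrite lead_coefE e1.
  have : lead_coef p1 != 0 by rewrite lead_coef_eq0 -size_poly_eq0 e1.
  by apply: contra_neq => -[->].
have [m2|m1] := leqP 2 (size p3).
  exfalso; case em : (size p3) m2 => [//|m] m2.
  have l3 : lbound (lp p3) m%:Z.
    by apply: lbound_le (proj1 (lbound_poly p3 m.+1) _) _; [rewrite em|lia].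
  have c3 : lp p3 m%:Z != 0.
    by rewrite lcoef_poly (_ : p3`_m = lead_coef p3) ?lead_coef_eq0 -?size_poly_eq0 ?em// lead_coefE em.
  have l33 : lbound (lp p3 ^+ 2 * B v3 v3) (m%:Z + m%:Z + (2 * k + 1)%N%:Z).
    by apply: lboundM => //; apply: lboundM.
  have c33 : (lp p3 ^+ 2 * B v3 v3) (m%:Z + m%:Z + (2 * k + 1)%N%:Z) != 0.
    by rewrite (lcoefM_top (lboundM l3 l3) b33) (lcoefM_top l3 l3) e33 !mulf_neq0.
  have lc := lbound_twice (lboundM l3 bc).
  have le := lbound_cstM e b33.
  have [lt|gt] := ltP (2 * J)%N%:Z (m%:Z + m%:Z + (2 * k + 1)%N%:Z).
    have := bn (m%:Z + m%:Z + (2 * k + 1)%N%:Z); rewrite lcoefB !lcoefD.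
    rewrite (lcoef_top0 bx lt) (lcoef_top0 lc) ?(lcoef_top0 le) ?add0r ?subr0; try lia.
    by move=> z; rewrite z ?eqxx in c33 => //; lia.
  have := bn (2 * J)%N%:Z; rewrite lcoefB !lcoefD ex.
  rewrite (lcoef_top0 lc) ?(lcoef_top0 le) ?(lcoef_top0 l33) ?addr0 ?subr0; try lia.
  by move=> z; move: q0; rewrite z ?eqxx; [move/(_ _)/negP; apply => //; rewrite /J in gt *; lia|lia].
have [c ec] : exists c, p3 = c%:P by exists p3`_0; apply: size1_polyC.
exists c; move: bn; rewrite ec -/(lcst c) => bn.
have rw : B x x + 2%:R * (lcst c * B x v3) + lcst c ^+ 2 * B v3 v3 - lcst e * B v3 v3 =
   B x x + 2%:R * (lcst c * B x v3) + lcst (c ^+ 2 - e) * B v3 v3.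
  by rewrite rmorphB rmorphXn /=; ring.
rewrite rw in bn.
have lc := lbound_twice (lbound_cstM c bc).
have le := lbound_cstM (c ^+ 2 - e) b33.
have Jq : (0 < J)%N -> q != 0 by move=> J0; apply: q0; rewrite /J in J0 *; lia.
have Jk : (2 * J < 2 * k + 1)%N.
  rewrite ltnNge; apply/negP => kJ; have := bn (2 * J)%N%:Z; rewrite !lcoefD ex.
  rewrite (lcoef_top0 lc) ?(lcoef_top0 le) ?addr0; try lia.
  by move=> z; have : q != 0; [apply: Jq; lia|rewrite z ?eqxx//; lia].
have ce : n < (2 * k + 1)%N%:Z -> c ^+ 2 = e.
  move=> nk'; have := bn (2 * k + 1)%N%:Z nk'; rewrite !lcoefD (lcoef_top0 bx); last lia.
  rewrite (lcoef_top0 lc) ?add0r; last lia.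
  by rewrite lcoef_cstM e33 => /eqP; rewrite mulf_eq0 (negPf a30) orbF subr_eq0 => /eqP.
suff : (maxn (size p1) (size p2) <= j)%N by rewrite geq_max => /andP[? ?]; split.
rewrite leqNgt; apply/negP => jm.
have nk' : n < (2 * k + 1)%N%:Z.
  by rewrite /J in Jk; lia.
have := bn (2 * J)%N%:Z; rewrite (ce nk') subrr rmorph0 mul0r addr0 lcoefD ex.
rewrite (lcoef_top0 lc) ?addr0; last lia.
by move=> z; have : q != 0; [apply: q0; lia|rewrite z ?eqxx//; rewrite /J; lia].
Qed.

Lemma flat_values_near (c e : F) (j : nat) (p1 p2 : A) (x := comb3 v1 v2 v3 (p1, p2, c%:P)) :
  c ^+ 2 = e -> (size p1 <= j.+1)%N -> (size p2 <= j.+1)%N ->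
  lbound (B x x - lcst e * B v3 v3) (2 * j)%N%:Z.
Proof.
move=> <- s1 s2; rewrite /x comb3_value /= -/(lcst c) rmorphXn /= addrK.
apply: lboundD; first by have [] := plane_top s1 s2.
by apply: lbound_twice; apply: lbound_le (lbound_cstM _ (plane_cross s1 s2)) _; lia.
Qed.

End OneLattice.
End ReducedFlat.

Section FlatLattices.
Variable F : finFieldType.
Hypothesis q_odd : odd #|F|.
Local Notation A := {poly F}.
Local Notation E := (laurent F).
Local Notation lp := (@laurent_of_poly F).

Section One.
Variables (L : lmodType A) (B : L -> L -> E).
Hypothesis Bbil : bilinear_form B.
Variables (v1 v2 v3 : L) (k : nat) (a1 a2 a3 : F).
Hypothesis vbas : basis3 v1 v2 v3.
Hypothesis vred : reduced_flat B v1 v2 v3 k a1 a2 a3.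

Definition plane_vec (z : F * F) := comb3 v1 v2 v3 (z.1%:P, z.2%:P, 0).
Definition sgn (b : bool) : F := if b then 1 else - 1.
Definition affine_vec (i : bool * (F * F)) :=
  comb3 v1 v2 v3 (i.2.1%:P, i.2.2%:P, (sgn i.1)%:P).

Lemma sgn2 b : sgn b ^+ 2 = 1.
Proof. by case: b; rewrite /sgn ?sqrrN expr1n. Qed.

Lemma sgn_inj : injective sgn.
Proof.
have o : (-1 : F) != 1 by apply: (oppr_neq q_odd); rewrite oner_neq0.
by move=> [] [] // /eqP; rewrite /sgn ?(negPf o)// eq_sym (negPf o).
Qed.

Lemma lead_a2_neq0 : a2 != 0.
Proof.
have [_ _ _ _ [a10 _ dn]] := vred.
by have := nonsq_neq0 dn; apply: contra_neq => ->; rewrite oppr0 mul0r.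
Qed.

Lemma plane_vec_inj : injective plane_vec.
Proof.
by move=> [x y] [x' y'] /((basis3P _ _ _).1 vbas).1[/polyC_inj-> /polyC_inj->].
Qed.

Lemma affine_vec_inj : injective affine_vec.
Proof.
move=> [b [x y]] [b' [x' y']] /((basis3P _ _ _).1 vbas).1[].
by move=> /polyC_inj-> /polyC_inj-> /polyC_inj/sgn_inj->.
Qed.

Lemma plane_vec_value z : B (plane_vec z) (plane_vec z) =
  lcst (z.1 ^+ 2) * B v1 v1 + 2%:R * (lcst (z.1 * z.2) * B v1 v2) +
  lcst (z.2 ^+ 2) * B v2 v2.
Proof.
rewrite /plane_vec /comb3 scale0r addr0 (bil_sqD Bbil) !(bilE Bbil).
by rewrite !(rmorphXn, rmorphM) /= -!/(lcst _); ring.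
Qed.

Lemma affine_vec_value z : B (affine_vec (true, z)) (affine_vec (true, z)) =
  B (plane_vec z) (plane_vec z) + 2%:R * (lcst z.1 * B v1 v3 + lcst z.2 * B v2 v3)
  + B v3 v3.
Proof.
rewrite /affine_vec /plane_vec !comb3_value//= rmorph0 rmorph1 !(bilE Bbil).
by rewrite -!/(lcst _); ring.
Qed.

Lemma affine_vecN z : affine_vec (false, z) = - affine_vec (true, - z).
Proof. by rewrite /affine_vec /comb3 /= !polyCN !scaleNr !opprD !opprK. Qed.

Lemma plane_vec_flat z : lbound (B (plane_vec z) (plane_vec z)) 0.
Proof.
have z2 : 0 ^+ 2 = 0 :> F by rewrite expr0n.
have := flat_values_near Bbil vred (j := 0) z2 (size_polyC_leq1 z.1) (size_polyC_leq1 z.2).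
by rewrite polyC0 (rmorph0 (@lcst F)) mul0r subr0.
Qed.

Lemma plane_vec_lead z : B (plane_vec z) (plane_vec z) 0 = a1 * nrm (- a2 / a1) z.
Proof.
have [_ _ _ _ [a10 _ _]] := vred.
have [_] := plane_top Bbil vred (size_polyC_leq1 z.1) (size_polyC_leq1 z.2).
rewrite /plane_vec /comb3 scale0r addr0 muln0 => ->.
by rewrite !coefC /nrm /=; field.
Qed.

Lemma plane_vec_surj x : lbound (B x x) 0 -> exists z, plane_vec z = x.
Proof.
have [p <-] := ((basis3P _ _ _).1 vbas).2 x => b.
have [|||c [pc s1 s2 /(_ _)c0]] := flat_values Bbil vred (e := 0) (n := 0) (j := 1) (p := p).
- by rewrite (rmorph0 (@lcst F)) mul0r subr0.
- by [].
- by [].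
- have {}c0 : c = 0 by apply/eqP; rewrite -sqrf_eq0 c0//; lia.
  exists (p.1.1`_0, p.1.2`_0); rewrite /plane_vec /= -!size1_polyC//.
  by congr comb3; rewrite [RHS]surjective_pairing [p.1]surjective_pairing pc c0.
Qed.

Lemma affine_vec_near i :
  lbound (B (affine_vec i) (affine_vec i) - B v3 v3) 0.
Proof.
have := flat_values_near Bbil vred (j := 0) (sgn2 i.1) (size_polyC_leq1 i.2.1) (size_polyC_leq1 i.2.2).
by rewrite (rmorph1 (@lcst F)) mul1r.
Qed.

Lemma affine_vec_surj x : lbound (B x x - B v3 v3) 0 -> exists i, affine_vec i = x.
Proof.
have [p <-] := ((basis3P _ _ _).1 vbas).2 x => b.
have [|||c [pc s1 s2 /(_ _)c0]] := flat_values Bbil vred (e := 1) (n := 0) (j := 1) (p := p).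
- by rewrite (rmorph1 (@lcst F)) mul1r.
- by [].
- by [].
- have {}c0 : c ^+ 2 = 1 by rewrite c0//; lia.
  have [b' eb] : exists b', c = sgn b'.
    move/eqP: c0; rewrite sqrf_eq1 => /orP[] /eqP->; [by exists true|by exists false].
  exists (b', (p.1.1`_0, p.1.2`_0)); rewrite /affine_vec /= -!size1_polyC//.
  by congr comb3; rewrite [RHS]surjective_pairing [p.1]surjective_pairing pc eb.
Qed.

End One.

Section Two.
Variables (L L' : lmodType A) (B : L -> L -> E) (B' : L' -> L' -> E).
Hypotheses (Bbil : bilinear_form B) (Bbil' : bilinear_form B').
Variables (v1 v2 v3 : L) (k : nat) (a1 a2 a3 : F).
Hypothesis vbas : basis3 v1 v2 v3.
Hypothesis vred : reduced_flat B v1 v2 v3 k a1 a2 a3.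
Hypothesis iso : iso_upto (2 * k + 1)%N%:Z (fun x => B x x) (fun x => B' x x).

Lemma plane_sum (R : nmodType) (f : E -> R) w1 w2 w3 b1 b2 b3 :
  basis3 w1 w2 w3 -> reduced_flat B' w1 w2 w3 k b1 b2 b3 ->
  \sum_z f (B (plane_vec v1 v2 v3 z) (plane_vec v1 v2 v3 z)) =
  \sum_z f (B' (plane_vec w1 w2 w3 z) (plane_vec w1 w2 w3 z)).
Proof.
move=> wbas wred.
apply: (transport_sum (P := fun a => lbound a 0) (Q := fun x => B x x)
  (Q' := fun x => B' x x) f iso).
- by move=> a a0; apply: lbound_le a0 _; lia.
- exact: plane_vec_inj vbas.
- exact: plane_vec_inj wbas.
- exact: plane_vec_flat vred.
- exact: plane_vec_flat wred.
- exact: plane_vec_surj vred.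
- exact: plane_vec_surj wred.
Qed.

(** u1 is the vector carrying the value of v1, and u2 is orthogonal to it for the leading form of
    the plane, scaled by s so that its leading coefficient is a2. *)
Lemma match_first w1 w2 w3 b1 b2 b3 :
  basis3 w1 w2 w3 -> reduced_flat B' w1 w2 w3 k b1 b2 b3 ->
  exists u1 u2 u3, [/\ basis3 u1 u2 u3, reduced_flat B' u1 u2 u3 k a1 a2 b3 &
    B' u1 u1 = B v1 v1].
Proof.
move=> wbas wred; have [_ _ _ _ [a10 a30 dn]] := vred.
have [[c11 e11] [c22 e22] c33 [c12 c13 c23] [b10 b30 dn']] := wred.
have a20 := lead_a2_neq0 vred; have b20 := lead_a2_neq0 wred.
have [t _ tP] := transport_inj (P := fun a => lbound a 0) (Q := fun x => B x x)
  (Q' := fun x => B' x x) iso (fun a a0 => lbound_le a0 (isT : 0 <= (2 * k + 1)%N%:Z))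
  (plane_vec_inj vbas) (plane_vec_flat Bbil vred) (plane_vec_surj Bbil' wbas wred).
have := tP (1, 0); set c := t _.
have -> : plane_vec v1 v2 v3 (1, 0) = v1.
  by rewrite /plane_vec /comb3 polyC1 polyC0 scale1r !scale0r !addr0.
move=> ec.
have : B' (plane_vec w1 w2 w3 c) (plane_vec w1 w2 w3 c) 0 = a1.
  by rewrite ec; have [[]] := vred.
rewrite (plane_vec_lead Bbil' wred) => lc.
have lc' : b1 * c.1 ^+ 2 + b2 * c.2 ^+ 2 = a1 by rewrite -lc /nrm; field.
(* Both -a2/a1 and -b2/b1 are nonsquares, so their product is a square: the leading forms have the
   same discriminant up to squares. *)
have [s s2] : exists s, s ^+ 2 = a2 / (a1 * b1 * b2).
  have /squaresP[r er] := nonsquareM q_odd dn dn'; exists (r / b2).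
  by rewrite expr_div_n -er; field; rewrite a10 b10 b20.
have s0 : s != 0.
  by rewrite -sqrf_eq0 s2 !mulf_neq0// invr_eq0 !mulf_neq0.
have D0 : c.1 * (s * b1 * c.1) - c.2 * (- (s * b2 * c.2)) != 0.
  rewrite (_ : _ - _ = s * (b1 * c.1 ^+ 2 + b2 * c.2 ^+ 2)); last ring.
  by rewrite lc' mulf_neq0.
have ubas := basis3_block wbas D0 (oner_neq0 F).
exists (c.1%:P *: w1 + c.2%:P *: w2),
  ((- (s * b2 * c.2))%:P *: w1 + (s * b1 * c.1)%:P *: w2), w3.
have w1v : B' (c.1%:P *: w1 + c.2%:P *: w2) (c.1%:P *: w1 + c.2%:P *: w2) = B v1 v1.
  by rewrite -ec /plane_vec /comb3 scale0r addr0.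
have sz := size_polyC_leq1.
split=> //; first by rewrite polyC1 scale1r in ubas.
split=> //.
- by rewrite w1v; have [[]] := vred.
- have [b e] := plane_top Bbil' wred (sz _ (- (s * b2 * c.2))) (sz _ (s * b1 * c.1)).
  split=> //; rewrite e !coefC /=.
  transitivity (s ^+ 2 * (b1 * b2) * (b1 * c.1 ^+ 2 + b2 * c.2 ^+ 2)); first by ring.
  by rewrite lc' s2; field; rewrite a10 b10 b20.
- split; last exact: (plane_cross (J := 0) Bbil' wred (sz _ _) (sz _ _)).
    have -> : B' (c.1%:P *: w1 + c.2%:P *: w2)
       ((- (s * b2 * c.2))%:P *: w1 + (s * b1 * c.1)%:P *: w2) =
      lcst (- (s * b2 * c.1 * c.2)) * B' w1 w1 + lcst (s * b1 * c.1 * c.2) * B' w2 w2 +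
      lcst (s * b1 * c.1 ^+ 2 - s * b2 * c.2 ^+ 2) * B' w1 w2.
      by rewrite !(bilE Bbil') (bilC Bbil' w2) -!/(lcst _) rmorphB !(rmorphN, rmorphXn, rmorphM) /=; ring.
    apply: lboundD; last exact: lbound_cstM.
    rewrite -[-1]/(0 - 1 : int); apply: lbound_pred.
      by apply: lboundD; apply: lbound_cstM.
    by rewrite lcoefD !lcoef_cstM e11 e22; ring.
  exact: (plane_cross (J := 0) Bbil' wred (sz _ _) (sz _ _)).
Qed.

Lemma match_plane_forms w1 w2 w3 b3 :
  basis3 w1 w2 w3 -> reduced_flat B' w1 w2 w3 k a1 a2 b3 -> B' w1 w1 = B v1 v1 ->
  B' w2 w2 = B v2 v2 /\ (B' w1 w2 = B v1 v2 \/ B' w1 w2 = - B v1 v2).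
Proof.
move=> wbas wred e1; have [_ _ _ _ [a10 a30 dn]] := vred.
have d0 := nonsq_neq0 dn.
have e2 : B' w2 w2 = B v2 v2.
  apply/eqP; rewrite -subr_eq0; apply/eqP/lres_eq0 => v; rewrite lresBr.
  (* By [plane_vec_lead] the quantity a 0 / a1 is the norm of z, so the weight is a function of the
     value a. As the (1,1) entries agree, the contraction given by [moment2] determines the (2,2)
     entry. *)
  have := plane_sum (fun a : E => (a 0 / a1) ^- 1 * lres v a) wbas wred.
  have [s s0 sE] := moment2 q_odd dn.
  have val (M : lmodType A) (C : M -> M -> E) u1 u2 u3 c3 : bilinear_form C ->
    reduced_flat C u1 u2 u3 k a1 a2 c3 ->
    \sum_z (C (plane_vec u1 u2 u3 z) (plane_vec u1 u2 u3 z) 0 / a1) ^- 1 *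
      lres v (C (plane_vec u1 u2 u3 z) (plane_vec u1 u2 u3 z)) =
    s * (lres v (C u1 u1) - lres v (C u2 u2) / (- a2 / a1)).
    move=> Cbil ured; rewrite -(sE _ (2%:R * lres v (C u1 u2))).
    apply: eq_bigr => z _; rewrite (plane_vec_lead Cbil ured) [a1 * _]mulrC mulfK//.
    congr (_ * _); rewrite plane_vec_value// mulr_natl mulr2n !lresDr !lresZr; ring.
  rewrite (val _ _ _ _ _ _ Bbil vred) (val _ _ _ _ _ _ Bbil' wred) e1.
  by move/(mulfI s0)/addrI/oppr_inj/(mulIf _) => ->; rewrite ?subrr// invr_eq0.
split=> //.
have := plane_sum (fun a : E => lcst ((a 0 / a1) ^- 2) * a ^+ 2) wbas wred.
have [s3 [s1 [s2 [s10 sE]]]] := moment4 q_odd dn.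
have val (M : lmodType A) (C : M -> M -> E) u1 u2 u3 c3 : bilinear_form C ->
  reduced_flat C u1 u2 u3 k a1 a2 c3 ->
  \sum_z lcst ((C (plane_vec u1 u2 u3 z) (plane_vec u1 u2 u3 z) 0 / a1) ^- 2) *
    C (plane_vec u1 u2 u3 z) (plane_vec u1 u2 u3 z) ^+ 2 =
  lcst s3 * C u1 u1 ^+ 2 + lcst s1 * (2%:R * C u1 u2) ^+ 2 + 2%:R * lcst s1 * C u1 u1 * C u2 u2
    + lcst s2 * C u2 u2 ^+ 2.
  move=> Cbil ured; rewrite -sE; apply: eq_bigr => z _.
  by rewrite (plane_vec_lead Cbil ured) [a1 * _]mulrC mulfK// plane_vec_value.
rewrite (val _ _ _ _ _ _ Bbil vred) (val _ _ _ _ _ _ Bbil' wred) e1 e2.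
move=> /addIr/addIr/addrI/mulfI; rewrite lcst_eq0 => /(_ s10)/eqP.
have two : 2%:R != 0 :> E by rewrite -(rmorph_nat (@lcst F)) lcst_eq0 two_neq0.
rewrite eqf_sqr -mulrN => /orP[] /eqP/(mulfI two) e; [left|right]=> //.
by rewrite e opprK.
Qed.

Lemma match_plane w1 w2 w3 b1 b2 b3 :
  basis3 w1 w2 w3 -> reduced_flat B' w1 w2 w3 k b1 b2 b3 ->
  exists u1 u2 u3, [/\ basis3 u1 u2 u3, reduced_flat B' u1 u2 u3 k a1 a2 b3 &
    [/\ B' u1 u1 = B v1 v1, B' u1 u2 = B v1 v2 & B' u2 u2 = B v2 v2]].
Proof.
move=> wbas wred; have [u1 [u2 [u3 [ubas ured e1]]]] := match_first wbas wred.
have [e2 [e12|e12]] := match_plane_forms ubas ured e1.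
  by exists u1, u2, u3; split.
have n0 : (1 : F) * -1 - 0 * 0 != 0 by rewrite mul0r subr0 mul1r oppr_eq0 oner_neq0.
have := basis3_block ubas n0 (oner_neq0 F).
rewrite polyCN polyC1 polyC0 !scale1r !scale0r addr0 add0r scaleNr scale1r => tbas.
exists u1, (- u2), u3; rewrite !(bilE Bbil') !opprK; split=> //; last first.
  by split=> //; rewrite e12 opprK.
have [r1 r2 r3 [r12 r13 r23] r0] := ured.
split=> //; rewrite ?(bilNl Bbil') ?(bilNr Bbil') ?opprK//.
by split=> //; apply: lboundN.
Qed.

End Two.
End FlatLattices.

Section FlatIsometry.
Variable F : finFieldType.
Hypothesis q_odd : odd #|F|.
Local Notation A := {poly F}.
Local Notation E := (laurent F).
Local Notation lp := (@laurent_of_poly F).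

Lemma flat_values_lead (L : lmodType A) (B : L -> L -> E) v1 v2 v3 k (a1 a2 a3 c e : F)
    (j : nat) (p1 p2 : A) (x := comb3 v1 v2 v3 (p1, p2, c%:P)) :
  bilinear_form B -> reduced_flat B v1 v2 v3 k a1 a2 a3 ->
  c ^+ 2 = e -> (size p1 <= j.+1)%N -> (size p2 <= j.+1)%N ->
  (B x x - lcst e * B v3 v3) (2 * j)%N%:Z = a1 * p1`_j ^+ 2 + a2 * p2`_j ^+ 2.
Proof.
move=> Bbil vred <- s1 s2; rewrite /x comb3_value//= -/(lcst c) rmorphXn /= addrK.
have [_ <-] := plane_top Bbil vred s1 s2.
rewrite lcoefD (lcoef_top0 (lbound_twice (lbound_cstM c (plane_cross Bbil vred s1 s2)))) ?addr0//.
lia.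
Qed.

Section Two.
Variables (L L' : lmodType A) (B : L -> L -> E) (B' : L' -> L' -> E).
Hypotheses (Bbil : bilinear_form B) (Bbil' : bilinear_form B').
Variables (v1 v2 v3 : L) (k : nat) (a1 a2 a3 : F).
Hypothesis vbas : basis3 v1 v2 v3.
Hypothesis vred : reduced_flat B v1 v2 v3 k a1 a2 a3.
Hypothesis iso : iso_upto (2 * k + 1)%N%:Z (fun x => B x x) (fun x => B' x x).
Variables (w1 w2 w3 : L') (b3 : F).
Hypothesis wbas : basis3 w1 w2 w3.
Hypothesis wred : reduced_flat B' w1 w2 w3 k a1 a2 b3.

Section Count.
Variables (j : nat) (p1 p2 : A) (c : F).
Let y := comb3 w1 w2 w3 (p1, p2, c%:P).
Hypotheses (jk : (j <= k)%N) (s1 : (size p1 <= j.+1)%N) (s2 : (size p2 <= j.+1)%N).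
Hypotheses (c0 : c != 0) (p0 : (p1`_j, p2`_j) != (0, 0)) (yv : B' y y = B v3 v3).

Let Y := ('rV[F]_j * 'rV[F]_j)%type.
Let src (i : bool * Y) := comb3 v1 v2 v3 (rVpoly i.2.1, rVpoly i.2.2, (sgn F i.1)%:P).
Let tgt (i : bool * (bool * Y)) := comb3 w1 w2 w3
  ((sgn F i.1 * p1`_j) *: 'X^j + rVpoly i.2.2.1,
   (sgn F i.1 * p2`_j) *: 'X^j + rVpoly i.2.2.2, (sgn F i.2.1 * c)%:P).

Let size_rVpoly (z : 'rV[F]_j) : (size (rVpoly z) <= j)%N.
Proof. exact: size_poly. Qed.

Let size_tgt (a : F) (z : 'rV[F]_j) : (size (a *: 'X^j + rVpoly z)%R <= j.+1)%N.
Proof.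
apply/leq_sizeP => i ji; rewrite coefD coefZ coefXn gtn_eqF// mulr0 add0r.
by rewrite nth_default// (leq_trans (size_rVpoly z))// ltnW.
Qed.

Let coef_tgt (a : F) (z : 'rV[F]_j) : (a *: 'X^j + rVpoly z)`_j = a.
Proof. by rewrite coefD coefZ coefXn eqxx mulr1 [X in _ + X]nth_default ?addr0. Qed.

Let tgt_inj : injective tgt.
Proof.
move=> [n [e [y1 y2]]] [n' [e' [y1' y2']]] /((basis3P _ _ _).1 wbas).1[] /=.
move=> e1 e2 /polyC_inj/(mulIf c0)/(sgn_inj q_odd) ->.
have nn : n = n'.
  have := congr1 (fun p : A => p`_j) e1; have := congr1 (fun p : A => p`_j) e2.
  rewrite !coef_tgt; move: p0; have [->|q0 _ _ /(mulIf q0)/(sgn_inj q_odd)//] := eqVneq p1`_j 0.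
  have [->|q0 _ /(mulIf q0)/(sgn_inj q_odd)//] := eqVneq p2`_j 0.
  by rewrite eqxx.
move: e1 e2; rewrite nn => /addrI/(can_inj rVpolyK)-> /addrI/(can_inj rVpolyK)->.
by [].
Qed.

Let tgt_near i : lbound (B' (tgt i) (tgt i) - B v3 v3) ((2 * j)%N%:Z - 1).
Proof.
case: i => n [e [y1 y2]]; rewrite /tgt /=.
set q1 := _ + rVpoly y1; set q2 := _ + rVpoly y2; set x := comb3 _ _ _ _.
have t1 : (size q1 <= j.+1)%N by apply: size_tgt.
have t2 : (size q2 <= j.+1)%N by apply: size_tgt.
have e2 : (sgn F e * c) ^+ 2 = c ^+ 2 by rewrite exprMn sgn2 mul1r.
rewrite -yv (_ : _ - _ = (B' x x - lcst (c ^+ 2) * B' w3 w3) -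
  (B' y y - lcst (c ^+ 2) * B' w3 w3)); last by ring.
apply: lbound_pred.
  apply: lboundB; first exact: (flat_values_near Bbil' wred e2 t1 t2).
  exact: (flat_values_near Bbil' wred erefl s1 s2).
rewrite lcoefB (flat_values_lead Bbil' wred e2 t1 t2) (flat_values_lead Bbil' wred erefl s1 s2).
by rewrite !coef_tgt !exprMn sgn2 !mul1r subrr.
Qed.

Let src_surj x : lbound (B x x - B v3 v3) ((2 * j)%N%:Z - 1) -> exists i, src i = x.
Proof.
have [p <-] := ((basis3P _ _ _).1 vbas).2 x => b.
have [|||d [pd t1 t2 d2]] := flat_values Bbil vred (e := 1)
  (n := (2 * j)%N%:Z - 1) (j := j) (p := p).
- by rewrite (rmorph1 (@lcst F)) mul1r.
- by lia.
- by lia.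
have {}d2 : d ^+ 2 = 1 by apply: d2; lia.
have [b' eb] : exists b', d = sgn F b'.
  move/eqP: d2; rewrite sqrf_eq1 => /orP[] /eqP->; [by exists true|by exists false].
exists (b', (poly_rV p.1.1, poly_rV p.1.2)); rewrite /src /= !poly_rV_K//.
by congr comb3; rewrite [RHS]surjective_pairing [p.1]surjective_pairing pd eb.
Qed.

(** The cross terms stay below degree 2j, so the signs of the top plane coefficients and of c can be
    chosen independently and the lower coefficients freely. This gives 4 q^(2j) vectors of L', but
    by [flat_values] only 2 q^(2j) vectors of L can have such values. *)
Lemma too_many_near : False.
Proof.
have [|t ti _] := transport_inj (P := fun a => lbound (a - B v3 v3) ((2 * j)%N%:Z - 1))
  (iso_upto_sym iso) _ tgt_inj tgt_near src_surj.
  move=> a ab; rewrite -[a](subrK (B v3 v3)); apply: lboundD.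
    by apply: lbound_le ab _; lia.
  by have [_ _ []] := vred.
have := leq_card t ti; rewrite !card_prod card_bool.
have : (0 < #|{: 'rV[F]_j}|)%N by apply/card_gt0P; exists 0.
by move: #|_| => m; nia.
Qed.

End Count.

(* Were the component in the plane of the vector matching v3 nonzero, of degree j,
   then L' would have too many vectors with value within degree 2j - 1 of B v3 v3. *)
Lemma match_third : exists2 c : F, c != 0 & lcst c ^+ 2 * B' w3 w3 = B v3 v3.
Proof.
have [pi [pi' [iso1 _]]] := iso; have [_ _ [b33 e33] _ [a10 a30 dn]] := vred.
have [ypi _] := iso1 v3 b33; move: ypi; set y := pi v3 => yv.
have [p ep] := ((basis3P _ _ _).1 wbas).2 y.
(* With e = 0 and n = 2k+1 this only says that p.2 is constant and that the plane component has
   degree at most k. *)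
have [|||c [pc s1 s2 _]] := flat_values Bbil' wred (e := 0)
  (n := (2 * k + 1)%N%:Z) (j := k.+1) (p := p).
- by rewrite (rmorph0 (@lcst F)) mul0r subr0 ep yv.
- by [].
- by lia.
have c0 : c != 0.
  apply: contraNneq a30 => c0; rewrite -e33 -yv -ep.
  have := plane_top Bbil' wred s1 s2; rewrite /comb3 pc c0 polyC0 scale0r addr0.
  by move=> [b _]; rewrite b//; lia.
exists c => //; have epp : p = (p.1.1, p.1.2, c%:P).
  by rewrite -pc [LHS]surjective_pairing [p.1 in LHS]surjective_pairing.
have [m0|m0] := posnP (maxn (size p.1.1) (size p.1.2)).
  have p10 : p.1.1 = 0 by apply/eqP; rewrite -size_poly_eq0 -leqn0 -m0 leq_maxl.
  have p20 : p.1.2 = 0 by apply/eqP; rewrite -size_poly_eq0 -leqn0 -m0 leq_maxr.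
  rewrite -yv -ep epp p10 p20 /comb3 !scale0r !add0r !(bilE Bbil') mulrA.
  by [].
exfalso; pose j := (maxn (size p.1.1) (size p.1.2)).-1.
have ej : maxn (size p.1.1) (size p.1.2) = j.+1 by rewrite /j prednK.
have jk : (j <= k)%N by rewrite -ltnS -ej geq_max s1 s2.
apply: (@too_many_near j p.1.1 p.1.2 c) => //.
- by rewrite -ej leq_maxl.
- by rewrite -ej leq_maxr.
- have [le|lt] := leqP (size p.1.1) (size p.1.2).
    have e2 : size p.1.2 = j.+1 by rewrite -ej; apply/esym/maxn_idPr.
    have -> : p.1.2`_j = lead_coef p.1.2 by rewrite lead_coefE e2.
    have : lead_coef p.1.2 != 0 by rewrite lead_coef_eq0 -size_poly_eq0 e2.
    by apply: contra_neq => -[_ ->].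
  have e1 : size p.1.1 = j.+1 by rewrite -ej; apply/esym/maxn_idPl/ltnW.
  have -> : p.1.1`_j = lead_coef p.1.1 by rewrite lead_coefE e1.
  have : lead_coef p.1.1 != 0 by rewrite lead_coef_eq0 -size_poly_eq0 e1.
  by apply: contra_neq => -[->].
- by rewrite -epp ep.
Qed.

Hypotheses (e11 : B' w1 w1 = B v1 v1) (e12 : B' w1 w2 = B v1 v2) (e22 : B' w2 w2 = B v2 v2).
Hypothesis e33 : B' w3 w3 = B v3 v3.

(** The value condition cannot separate v3 + x from its opposite -v3 - x, so the bijection gives the
    equality only for the sums over both signs, that is, after doubling. *)
Lemma affine_sum (R : zmodType) (f : E -> R) :
  (\sum_z f (B (affine_vec v1 v2 v3 (true, z)) (affine_vec v1 v2 v3 (true, z)))) *+ 2 =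
  (\sum_z f (B' (affine_vec w1 w2 w3 (true, z)) (affine_vec w1 w2 w3 (true, z)))) *+ 2.
Proof.
have dbl (M : lmodType A) (C : M -> M -> E) u1 u2 u3 : bilinear_form C ->
  (\sum_z f (C (affine_vec u1 u2 u3 (true, z)) (affine_vec u1 u2 u3 (true, z)))) *+ 2 =
  \sum_i f (C (affine_vec u1 u2 u3 i) (affine_vec u1 u2 u3 i)).
  move=> Cbil; rewrite -(pair_bigA _ (fun b z => f (C (affine_vec u1 u2 u3 (b, z))
    (affine_vec u1 u2 u3 (b, z))))) big_bool mulr2n /=; congr (_ + _).
  rewrite [LHS](reindex_inj (@oppr_inj (F * F)%type)); apply: eq_bigr => z _.
  by rewrite affine_vecN (bil_sqN Cbil).
rewrite !dbl//.
apply: (transport_sum (P := fun a => lbound (a - B v3 v3) 0) (Q := fun x => B x x)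
  (Q' := fun x => B' x x) f iso).
- move=> a ab; rewrite -[a](subrK (B v3 v3)); apply: lboundD.
    by apply: lbound_le ab _; lia.
  by have [_ _ []] := vred.
- exact: affine_vec_inj vbas.
- exact: affine_vec_inj wbas.
- exact: affine_vec_near vred.
- by move=> i; rewrite -e33; apply: affine_vec_near wred i.
- exact: affine_vec_surj vred.
- by move=> x; rewrite -e33; apply: affine_vec_surj wred x.
Qed.

Let d := - a2 / a1.
Let q (v : E) (z : F * F) := lres v (B v1 v1) * z.1 ^+ 2 +
  2%:R * lres v (B v1 v2) * (z.1 * z.2) + lres v (B v2 v2) * z.2 ^+ 2.
Let ell (y1 y2 v : E) (z : F * F) := lres v y1 * z.1 + lres v y2 * z.2.

Let qE v z : lres v (B (plane_vec v1 v2 v3 z) (plane_vec v1 v2 v3 z)) = q v z.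
Proof.
by rewrite plane_vec_value// mulr_natl mulr2n !lresDr !lresZr /q; ring.
Qed.

Let planeE z : B' (plane_vec w1 w2 w3 z) (plane_vec w1 w2 w3 z) =
  B (plane_vec v1 v2 v3 z) (plane_vec v1 v2 v3 z).
Proof. by rewrite !plane_vec_value// e11 e12 e22. Qed.

Let shift_value (y1 y2 v : E) z (a : E) :
  a - B v3 v3 = B (plane_vec v1 v2 v3 z) (plane_vec v1 v2 v3 z) +
     2%:R * (lcst z.1 * y1 + lcst z.2 * y2) ->
  lres v (a - B v3 v3) = q v z + 2%:R * ell y1 y2 v z.
Proof.
by move=> ->; rewrite lresDr qE [2%:R * _]mulr_natl mulr2n !lresDr !lresZr /ell; ring.
Qed.

Let v_affine z : B (affine_vec v1 v2 v3 (true, z)) (affine_vec v1 v2 v3 (true, z)) - B v3 v3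
  = B (plane_vec v1 v2 v3 z) (plane_vec v1 v2 v3 z) +
     2%:R * (lcst z.1 * B v1 v3 + lcst z.2 * B v2 v3).
Proof. by rewrite affine_vec_value// addrK. Qed.

Let w_affine z : B' (affine_vec w1 w2 w3 (true, z)) (affine_vec w1 w2 w3 (true, z)) - B v3 v3
  = B (plane_vec v1 v2 v3 z) (plane_vec v1 v2 v3 z) +
     2%:R * (lcst z.1 * B' w1 w3 + lcst z.2 * B' w2 w3).
Proof. by rewrite affine_vec_value// planeE e33 addrK. Qed.

Let lead_affine y1 y2 z : lbound y1 (-1) -> lbound y2 (-1) ->
  (B (plane_vec v1 v2 v3 z) (plane_vec v1 v2 v3 z) +
     2%:R * (lcst z.1 * y1 + lcst z.2 * y2)) 0 = a1 * nrm d z.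
Proof.
move=> l1 l2; rewrite lcoefD (plane_vec_lead Bbil vred).
rewrite (lcoef_top0 (lbound_twice (lboundD (lbound_cstM _ l1) (lbound_cstM _ l2)))) ?addr0//.
Qed.

Let dn : d \notin squares F. Proof. by have [_ _ _ _ []] := vred. Qed.

Let sum_parity (r r' l l' : F * F -> F) :
  (forall z, r (- z) = r z) -> (forall z, r' (- z) = r' z) ->
  (forall z, l (- z) = - l z) -> (forall z, l' (- z) = - l' z) ->
  \sum_z nrm d z ^- 1 * ((r z + 2%:R * l z) * (r' z + 2%:R * l' z)) =
  \sum_z nrm d z ^- 1 * (r z * r' z) + 4%:R * \sum_z nrm d z ^- 1 * (l z * l' z).
Proof.
move=> re re' lo lo'.
have odd0 (f : F * F -> F) : (forall z, f (- z) = - f z) -> \sum_z nrm d z ^- 1 * f z = 0.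
  move=> fo; set s := \sum_z _; apply/eqP; apply: contraTT isT => /(oppr_neq q_odd)/eqP[].
  rewrite {2}/s (@sum_nrm_scale _ d -%R 1 1 f)//.
  - rewrite expr1n invr1 mul1r /s -sumrN; apply: eq_bigr => z _.
    by rewrite fo mulrN.
  - exact: oppr_inj.
  - by move=> z; rewrite /nrm !sqrrN mul1r.
  - exact: oner_neq0.
rewrite mulr_sumr -big_split /=; apply/eqP; rewrite -subr_eq0 -sumrB; apply/eqP.
rewrite -[RHS](odd0 (fun z => 2%:R * (r z * l' z + l z * r' z))).
  by apply: eq_bigr => z _; ring.
by move=> z; rewrite re re' lo lo'; ring.
Qed.

Let qN v z : q v (- z) = q v z. Proof. by rewrite /q /=; ring. Qed.
Let ellN y1 y2 v z : ell y1 y2 v (- z) = - ell y1 y2 v z. Proof. by rewrite /ell /=; ring. Qed.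

Let mul2_inj (x y : F) : x *+ 2 = y *+ 2 -> x = y.
Proof. by rewrite -[x *+ 2]mulr_natl -[y *+ 2]mulr_natl => /(mulfI (two_neq0 q_odd)). Qed.

(** A weighted sum of products of two residues. The mixed terms are odd in z and cancel, the
    quadratic parts agree because the planes do, and [moment2] evaluates the product of the two
    linear parts. *)
Lemma cross_dot u v :
  lres u (B v1 v3) * lres v (B v1 v3) - lres u (B v2 v3) * lres v (B v2 v3) / d =
  lres u (B' w1 w3) * lres v (B' w1 w3) - lres u (B' w2 w3) * lres v (B' w2 w3) / d.
Proof.
have [_ _ _ [_ b13 b23] [a10 _ _]] := vred; have [_ _ _ [_ c13 c23] _] := wred.
have := affine_sum (fun a => ((a - B v3 v3) 0 / a1) ^- 1 *
  (lres u (a - B v3 v3) * lres v (a - B v3 v3))).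
have val y1 y2 (g : F * F -> E) : lbound y1 (-1) -> lbound y2 (-1) ->
  (forall z, g z - B v3 v3 = B (plane_vec v1 v2 v3 z) (plane_vec v1 v2 v3 z) +
     2%:R * (lcst z.1 * y1 + lcst z.2 * y2)) ->
  \sum_z ((g z - B v3 v3) 0 / a1) ^- 1 * (lres u (g z - B v3 v3) * lres v (g z - B v3 v3)) =
  \sum_z nrm d z ^- 1 * (q u z * q v z) +
   4%:R * \sum_z nrm d z ^- 1 * (ell y1 y2 u z * ell y1 y2 v z).
  move=> l1 l2 gE; rewrite -sum_parity//; apply: eq_bigr => z _.
  by rewrite -!(@shift_value _ _ _ _ _ (gE z)) gE lead_affine// [a1 * _]mulrC mulfK.
rewrite (val _ _ _ b13 b23 v_affine) (val _ _ _ c13 c23 w_affine).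
move=> /mul2_inj/addrI/mulfI.
have -> : 4%:R = 2%:R * 2%:R :> F by rewrite -natrM.
move=> /(_ (mulf_neq0 (two_neq0 q_odd) (two_neq0 q_odd))).
have [s s0 sE] := moment2 q_odd dn.
have val2 y1 y2 : \sum_z nrm d z ^- 1 * (ell y1 y2 u z * ell y1 y2 v z) =
  s * (lres u y1 * lres v y1 - lres u y2 * lres v y2 / d).
  rewrite -(sE _ (lres u y1 * lres v y2 + lres u y2 * lres v y1)).
  by apply: eq_bigr => z _; rewrite /ell; congr (_ * _); ring.
by rewrite !val2 => /(mulfI s0).
Qed.

(** Summing psi of the residues of the values near B v3 v3 produces Gauss sums of the same binary
    form with different linear terms, which [gauss2_inj] compares. *)
Let cross_adj_nondeg v :
  lres v (B v1 v1) * lres v (B v2 v2) - lres v (B v1 v2) ^+ 2 != 0 ->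
  lres v (B v2 v2) * lres v (B v1 v3) ^+ 2 -
    2%:R * lres v (B v1 v2) * lres v (B v1 v3) * lres v (B v2 v3) +
    lres v (B v1 v1) * lres v (B v2 v3) ^+ 2 =
  lres v (B v2 v2) * lres v (B' w1 w3) ^+ 2 -
    2%:R * lres v (B v1 v2) * lres v (B' w1 w3) * lres v (B' w2 w3) +
    lres v (B v1 v1) * lres v (B' w2 w3) ^+ 2.
Proof.
have [psi [psi0 psiD psi_nt]] := additive_character F.
move=> D0; apply: (gauss2_inj q_odd psi0 psiD psi_nt D0) => t.
have := affine_sum (fun a => psi (t * lres v (a - B v3 v3))).
have val y1 y2 (g : F * F -> E) :
  (forall z, g z - B v3 v3 = B (plane_vec v1 v2 v3 z) (plane_vec v1 v2 v3 z) +
     2%:R * (lcst z.1 * y1 + lcst z.2 * y2)) ->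
  \sum_z psi (t * lres v (g z - B v3 v3)) =
  gauss2 psi (t * lres v (B v1 v1)) (t * lres v (B v1 v2)) (t * lres v (B v2 v2))
     (t * lres v y1) (t * lres v y2).
  move=> gE; apply: eq_bigr => z _; rewrite (@shift_value _ _ _ _ _ (gE z)).
  by congr psi; rewrite /q /ell; ring.
rewrite (val _ _ _ v_affine) (val _ _ _ w_affine) => e.
by apply: (pmulrnI (n := 2)) e.
Qed.

(* For degenerate v, use v + s t^-1, which is nondegenerate for suitable s. *)
Lemma cross_adj v :
  lres v (B v2 v2) * lres v (B v1 v3) ^+ 2 -
    2%:R * lres v (B v1 v2) * lres v (B v1 v3) * lres v (B v2 v3) +
    lres v (B v1 v1) * lres v (B v2 v3) ^+ 2 =
  lres v (B v2 v2) * lres v (B' w1 w3) ^+ 2 -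
    2%:R * lres v (B v1 v2) * lres v (B' w1 w3) * lres v (B' w2 w3) +
    lres v (B v1 v1) * lres v (B' w2 w3) ^+ 2.
Proof.
have [[b11 f11] [b22 f22] _ [b12 b13 b23] [a10 _ _]] := vred; have [_ _ _ [_ c13 c23] _] := wred.
have a20 := lead_a2_neq0 vred; have two := two_neq0 q_odd.
pose u (s : F) := v + lmonom s (-1).
have uE s (f : E) (a : F) : lbound f 0 -> f 0 = a -> lres (u s) f = lres v f + s * a.
  by move=> _ <-; rewrite lresDl lres_monom subrr.
have uE' s (f : E) : lbound f (-1) -> lres (u s) f = lres v f.
  by move=> f1; rewrite lresDl lres_monom subrr f1// mulr0 addr0.
pose D s := (lres v (B v1 v1) + s * a1) * (lres v (B v2 v2) + s * a2) - lres v (B v1 v2) ^+ 2.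
have [s Ds] : exists s, D s != 0.
  apply: contrapT => /forallNP D0; have {}D0 s : D s = 0.
    by apply/eqP/negPn/negP; apply: D0.
  (* D is quadratic in s with leading coefficient a1 a2, so its second difference cannot vanish. *)
  have : 2%:R * (a1 * a2) = D 1 + D (-1) - 2%:R * D 0 by rewrite /D; ring.
  by rewrite !D0 mulr0 subr0 addr0 => /eqP; apply/negP; rewrite !mulf_neq0.
have := @cross_adj_nondeg (u s).
rewrite (uE _ _ _ b11 f11) (uE _ _ _ b22 f22) !uE'// => /(_ Ds) e.
(* Passing from v to [u s] adds s (a2 w1^2 + a1 w2^2) to the adjugate value. This is a multiple of
   the dual norm, the same for both lattices by [cross_dot], and can be subtracted. *)
have dot := cross_dot v v.
have dE (x y : F) : a2 * (x ^+ 2 - y ^+ 2 / d) = a2 * x ^+ 2 + a1 * y ^+ 2.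
  by rewrite /d; field; rewrite oppr_eq0 a10 a20.
rewrite -!expr2 in dot; have := congr1 (fun x => s * (a2 * x)) dot; rewrite !dE => dot2.
have := congr2 (fun x y => x - y) e dot2; rewrite /= => e2.
transitivity ((lres v (B v2 v2) + s * a2) * lres v (B v1 v3) ^+ 2 -
  2%:R * lres v (B v1 v2) * lres v (B v1 v3) * lres v (B v2 v3) +
  (lres v (B v1 v1) + s * a1) * lres v (B v2 v3) ^+ 2 -
  s * (a2 * lres v (B v1 v3) ^+ 2 + a1 * lres v (B v2 v3) ^+ 2)); first by ring.
by rewrite e2; ring.
Qed.

Lemma match_cross : exists u1 u2, [/\ basis3 u1 u2 w3,
  [/\ B' u1 u1 = B v1 v1, B' u1 u2 = B v1 v2 & B' u2 u2 = B v2 v2] &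
  B' u1 w3 = B v1 v3 /\ B' u2 w3 = B v2 v3].
Proof.
have [h11 [h12 [h21 [h22 [D0 [x1 x2] [y11 y12 y22]]]]]] :=
  transfer_exists q_odd dn cross_dot cross_adj.
have := basis3_block wbas D0 (oner_neq0 F); rewrite polyC1 scale1r => ubas.
exists (h11%:P *: w1 + h12%:P *: w2), (h21%:P *: w1 + h22%:P *: w2); split=> //; split.
- by rewrite -[RHS]y11 !(bilE Bbil') (bilC Bbil' w2) -!/(lcst _) e11 e12 e22; ring.
- by rewrite -[RHS]y12 !(bilE Bbil') (bilC Bbil' w2) -!/(lcst _) e11 e12 e22; ring.
- by rewrite -[RHS]y22 !(bilE Bbil') (bilC Bbil' w2) -!/(lcst _) e11 e12 e22; ring.
- by rewrite -[RHS]x1 !(bilE Bbil').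
- by rewrite -[RHS]x2 !(bilE Bbil').
Qed.

End Two.

Definition same_gram (L L' : lmodType A) (B : L -> L -> E) (B' : L' -> L' -> E)
   (v1 v2 v3 : L) (u1 u2 u3 : L') :=
  [/\ B' u1 u1 = B v1 v1, B' u1 u2 = B v1 v2 & B' u2 u2 = B v2 v2] /\
  [/\ B' u1 u3 = B v1 v3, B' u2 u3 = B v2 v3 & B' u3 u3 = B v3 v3].

Lemma flat_isometry (L L' : lmodType A) (B : L -> L -> E) (B' : L' -> L' -> E)
   v1 v2 v3 w1 w2 w3 k a1 a2 a3 b1 b2 b3 :
  bilinear_form B -> bilinear_form B' ->
  basis3 v1 v2 v3 -> reduced_flat B v1 v2 v3 k a1 a2 a3 ->
  basis3 w1 w2 w3 -> reduced_flat B' w1 w2 w3 k b1 b2 b3 ->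
  iso_upto (2 * k + 1)%N%:Z (fun x => B x x) (fun x => B' x x) ->
  exists u1 u2 u3, basis3 u1 u2 u3 /\ same_gram B B' v1 v2 v3 u1 u2 u3.
Proof.
move=> Bbil Bbil' vbas vred wbas wred iso.
have [t1 [t2 [t3 [tbas tred [t11 t12 t22]]]]] := match_plane q_odd Bbil Bbil' vbas vred iso wbas wred.
have [c c0 e33] := match_third Bbil Bbil' vbas vred iso tbas tred.
have n0 : (1 : F) * 1 - 0 * 0 != 0 by rewrite mul0r subr0 mul1r oner_neq0.
have := basis3_block tbas n0 c0.
rewrite polyC1 polyC0 !scale1r !scale0r addr0 add0r => sbas.
have s33 : B' (c%:P *: t3) (c%:P *: t3) = B v3 v3.
  by rewrite -e33 !(bilE Bbil') -/(lcst c); ring.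
have sred : reduced_flat B' t1 t2 (c%:P *: t3) k a1 a2 a3.
  have [r1 r2 _ [r12 r13 r23] _] := tred; have [_ _ v33 _ r0] := vred.
  split=> //; first by rewrite s33.
  by rewrite !(bilE Bbil'); split=> //; apply: lbound_cstM.
have [u1 [u2 [ubas [u11 u12 u22] [u13 u23]]]] :=
  match_cross Bbil Bbil' vbas vred iso sbas sred t11 t12 t22 s33.
by exists u1, u2, (c%:P *: t3).
Qed.

End FlatIsometry.

(** * Reduction of definite lattices *)

Section Definite.
Variable F : fieldType.
Hypothesis two : 2%:R != 0 :> F.
Local Notation A := {poly F}.
Local Notation E := (laurent F).
Local Notation lp := (@laurent_of_poly F).
Variables (L : lmodType A) (B : L -> L -> E).
Hypothesis Bbil : bilinear_form B.
Implicit Types (u v w x y : L).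

Lemma laurent_two : 2%:R != 0 :> E.
Proof. by rewrite -(rmorph_nat (@lcst F)) lcst_eq0. Qed.

Definition anisotropic e1 e2 e3 := forall x1 x2 x3 : E,
  x1 ^+ 2 * B e1 e1 + x2 ^+ 2 * B e2 e2 + x3 ^+ 2 * B e3 e3 +
  2%:R * (x1 * x2 * B e1 e2 + x1 * x3 * B e1 e3 + x2 * x3 * B e2 e3) = 0 ->
  [/\ x1 = 0, x2 = 0 & x3 = 0].

Section Anisotropic.
Variables e1 e2 e3 : L.
Hypothesis ebas : basis3 e1 e2 e3.
Hypothesis eani : anisotropic e1 e2 e3.

(** A root a says that a x + y is isotropic, hence zero, over K_oo; two distinct roots would give x
    = 0. Speaking of roots avoids forming the tensor product of L with K_oo. *)
Lemma anisotropic_span (x y : L) (a : E) : x != 0 ->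
  a ^+ 2 * B x x + 2%:R * a * B x y + B y y = 0 ->
  forall b, b ^+ 2 * B x x + 2%:R * b * B x y + B y y = 0 -> a = b.
Proof.
have [p <-] := ((basis3P _ _ _).1 ebas).2 x; have [r <-] := ((basis3P _ _ _).1 ebas).2 y.
move: p r => [[p1 p2] p3] [[r1 r2] r3] p0.
have ex c : c ^+ 2 * B (comb3 e1 e2 e3 (p1, p2, p3)) (comb3 e1 e2 e3 (p1, p2, p3)) +
  2%:R * c * B (comb3 e1 e2 e3 (p1, p2, p3)) (comb3 e1 e2 e3 (r1, r2, r3)) +
  B (comb3 e1 e2 e3 (r1, r2, r3)) (comb3 e1 e2 e3 (r1, r2, r3)) = 0 ->
  [/\ c * lp p1 + lp r1 = 0, c * lp p2 + lp r2 = 0 & c * lp p3 + lp r3 = 0].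
  move=> e; apply: eani; rewrite -[RHS]e /comb3 /= !(bilE Bbil).
  by rewrite (bilC Bbil e2 e1) (bilC Bbil e3 e1) (bilC Bbil e3 e2); ring.
move=> /ex[a1 a2 a3] b /ex[b1 b2 b3]; apply/eqP; rewrite -subr_eq0.
apply: contraNT p0 => ab.
have z (p r : A) : a * lp p + lp r = 0 -> b * lp p + lp r = 0 -> p = 0.
  move=> h1 h2; apply/eqP; rewrite -laurent_of_poly_eq0; apply/eqP; apply: (mulfI ab).
  by rewrite mulr0 -[RHS](subrr 0) -{1}h1 -h2; ring.
by rewrite (z _ _ a1 b1) (z _ _ a2 b2) (z _ _ a3 b3) /comb3 !scale0r !addr0.
Qed.

Lemma anisotropic_eq0 x : B x x = 0 -> x = 0.
Proof.
move=> x0; apply/eqP; apply: contraT => xn0.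
have /eqP : 0 = 1 :> E.
  by apply: (anisotropic_span (y := 0) xn0); rewrite x0 (bilC Bbil x) !(bil0l Bbil); ring.
by rewrite eq_sym oner_eq0.
Qed.

(* If the inequality failed, the discriminant of the plane spanned by x and y
   would be B x y ^ 2 times a series 1 + (terms of negative degree), that is,
   a square. *)
Lemma cauchy_schwarz x y : B x y != 0 ->
  2%:R * ldeg (B x y) <= ldeg (B x x) + ldeg (B y y).
Proof.
move=> b0; have x0 : x != 0 by apply: contra_neq b0 => ->; rewrite (bil0l Bbil).
have y0 : y != 0 by apply: contra_neq b0 => ->; rewrite (bilC Bbil) (bil0l Bbil).
have q0 : B x x != 0 by apply: contra_neq x0; exact: anisotropic_eq0.
have r0 : B y y != 0 by apply: contra_neq y0; exact: anisotropic_eq0.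
rewrite leNgt; apply/negP => lt.
have b20 : B x y ^+ 2 != 0 by rewrite sqrf_eq0.
have [|s s2 s0] := @sqrt_one_plus F (- (B x x * B y y / B x y ^+ 2)) two.
  apply: lboundN; apply: le_ldeg; first by rewrite !mulf_neq0 ?invr_eq0.
  by rewrite !ldegM ?ldegV ?mulf_neq0 ?invr_eq0// expr2 ldegM//; lia.
have rt t : t ^+ 2 = 1 -> ((- B x y + t * B x y * s) / B x x) ^+ 2 * B x x +
    2%:R * ((- B x y + t * B x y * s) / B x x) * B x y + B y y = 0.
  move=> t2; apply: (mulIf q0).
  transitivity (t ^+ 2 * (B x y ^+ 2 * s ^+ 2) - B x y ^+ 2 + B x x * B y y); first by field.
  by rewrite t2 s2; field.
have t1 : (1 : E) ^+ 2 = 1 by rewrite expr1n.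
have t2 : (-1 : E) ^+ 2 = 1 by rewrite sqrrN expr1n.
have := anisotropic_span x0 (rt _ t1) (rt _ t2).
have qV : (B x x)^-1 != 0 by rewrite invr_eq0.
move=> /(mulIf qV)/addrI/eqP; rewrite -subr_eq0 -!mulrBl opprK.
by rewrite !mulf_eq0 (negPf b0) (negPf s0) !orbF -[_ + _]/(2%:R) (negPf laurent_two).
Qed.

Lemma ultrametric x y n : lbound (B x x) n -> lbound (B y y) n ->
  lbound (B (x + y) (x + y)) n.
Proof.
move=> xn yn; rewrite (bil_sqD Bbil); apply: lboundD => //; apply: lboundD => //.
apply: lbound_twice; have [->|b0] := eqVneq (B x y) 0; first exact: lbound0.
have x0 : B x x != 0.
  by apply: contra_neq b0 => /anisotropic_eq0->; rewrite (bil0l Bbil).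
have y0 : B y y != 0.
  by apply: contra_neq b0 => /anisotropic_eq0->; rewrite (bilC Bbil) (bil0l Bbil).
apply: le_ldeg => //; have := cauchy_schwarz b0.
by have := ldeg_le x0 xn; have := ldeg_le y0 yn; lia.
Qed.

Lemma lbound_div4 (f : E) n : lbound (4%:R * f) n -> lbound f n.
Proof.
move=> fn k nk; have := fn k nk; have -> : 4%:R = lcst 4%:R :> E by rewrite rmorph_nat.
rewrite lcoef_cstM => /eqP; rewrite mulf_eq0.
by rewrite (natrM F 2 2) mulf_eq0 (negPf two) => /eqP.
Qed.

(** A converse of [ultrametric]: the value at x - y differs from that at x + y by 4 B x y, and 2x is
    the sum of x + y and x - y. *)
Lemma parallelogram x y n : lbound (B (x + y) (x + y)) n -> lbound (B x y) n ->
  lbound (B x x) n /\ lbound (B y y) n.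
Proof.
move=> xyn bn; have bn2 := lbound_twice bn.
have dn : lbound (B (x - y) (x - y)) n.
  have -> : B (x - y) (x - y) = B (x + y) (x + y) - 2%:R * (2%:R * B x y).
    by rewrite !(bil_sqD Bbil) (bil_sqN Bbil) (bilNr Bbil); ring.
  by apply: lboundB => //; apply: lbound_twice.
have dn' : lbound (B (y - x) (y - x)) n by rewrite -opprB (bil_sqN Bbil).
split; apply: lbound_div4.
  have -> : 4%:R * B x x = B ((x + y) + (x - y)) ((x + y) + (x - y)).
    by rewrite addrACA subrr addr0 !(bilE Bbil); ring.
  exact: ultrametric xyn dn.
have -> : 4%:R * B y y = B ((x + y) + (y - x)) ((x + y) + (y - x)).
  by rewrite [x + y]addrC addrACA subrr addr0 !(bilE Bbil); ring.
exact: ultrametric xyn dn'.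
Qed.

(** Descent: as long as the three degrees are only bounded by some N > n, the cross terms are
    bounded by N - 1, and [parallelogram] lowers the common bound to N - 1. *)
Lemma orthogonal_degrees u1 u2 u3 n : lbound (B (u1 + u2 + u3) (u1 + u2 + u3)) n ->
  (forall N : int, lbound (B u1 u1) N -> lbound (B u2 u2) N -> lbound (B u3 u3) N ->
    n < N -> [/\ lbound (B u1 u2) (N - 1), lbound (B u1 u3) (N - 1) & lbound (B u2 u3) (N - 1)]) ->
  [/\ lbound (B u1 u1) n, lbound (B u2 u2) n & lbound (B u3 u3) n].
Proof.
move=> sn cr.
have st (t : nat) : lbound (B u1 u1) (n + t%:Z) -> lbound (B u2 u2) (n + t%:Z) ->
    lbound (B u3 u3) (n + t%:Z) ->
    [/\ lbound (B u1 u1) n, lbound (B u2 u2) n & lbound (B u3 u3) n].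
  elim: t => [|t IH] b1 b2 b3; first by rewrite addr0 in b1 b2 b3.
  have [|c12 c13 c23] := cr _ b1 b2 b3; first lia.
  have e : n + t.+1%:Z - 1 = n + t%:Z by lia.
  rewrite e in c12 c13 c23.
  have sn' : lbound (B (u1 + u2 + u3) (u1 + u2 + u3)) (n + t%:Z).
    by apply: lbound_le sn _; lia.
  have [|b12 b3'] := parallelogram sn'.
    by rewrite (bilDl Bbil); apply: lboundD.
  by have [b1' b2'] := parallelogram b12 c12; apply: IH.
have [M1 h1] := lboundP (B u1 u1); have [M2 h2] := lboundP (B u2 u2).
have [M3 h3] := lboundP (B u3 u3).
apply: (st (`|M1| + `|M2| + `|M3| + `|n|)%N).
- by apply: lbound_le h1 _; lia.
- by apply: lbound_le h2 _; lia.
- by apply: lbound_le h3 _; lia.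
Qed.

Lemma lbound_scale (p : A) v m n : lbound (B v v) m -> B v v m != 0 ->
  lbound (B (p *: v) (p *: v)) n -> p != 0 -> 2%:R * ldeg (lp p) + m <= n.
Proof.
move=> vm v0 pn p0; have p0' : lp p != 0 by rewrite laurent_of_poly_eq0.
have := ldeg_neq0 v0 => v0'; have := ldeg_le _ pn.
rewrite !(bilE Bbil) !ldegM ?mulf_neq0// (ldeg_eq vm v0) => /(_ isT); lia.
Qed.

(** The condition on l is a strict Cauchy-Schwarz inequality. Scaling v and w raises both of its
    sides equally, so the gain of one degree persists. *)
Lemma cross_scale (p r : A) v w mv mw l N : lbound (B v v) mv -> B v v mv != 0 ->
  lbound (B w w) mw -> B w w mw != 0 -> lbound (B v w) l -> 2%:R * l + 2%:R <= mv + mw ->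
  lbound (B (p *: v) (p *: v)) N -> lbound (B (r *: w) (r *: w)) N ->
  lbound (B (p *: v) (r *: w)) (N - 1).
Proof.
move=> vm v0 wm w0 vw lm pN rN; rewrite !(bilE Bbil).
have [->|p0] := eqVneq p 0; first by rewrite rmorph0 mul0r; exact: lbound0.
have [->|r0] := eqVneq r 0; first by rewrite rmorph0 mul0r mulr0; exact: lbound0.
have := lbound_scale vm v0 pN p0; have := lbound_scale wm w0 rN r0 => h1 h2.
have p0' : lp p != 0 by rewrite laurent_of_poly_eq0.
have r0' : lp r != 0 by rewrite laurent_of_poly_eq0.
apply: (lboundMle (ldeg_bound p0') (lboundM (ldeg_bound r0') vw)); lia.
Qed.

Definition reduced3 v1 v2 v3 (m1 m2 m3 : int) :=
  [/\ lbound (B v1 v1) m1 /\ B v1 v1 m1 != 0, lbound (B v2 v2) m2 /\ B v2 v2 m2 != 0,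
      lbound (B v3 v3) m3 /\ B v3 v3 m3 != 0, m1 <= m2 <= m3 &
      [/\ lbound (B v1 v2) (m1 - 1), lbound (B v1 v3) (m1 - 1) & lbound (B v2 v3) (m2 - 1)]].

Lemma reduced_degrees v1 v2 v3 m1 m2 m3 p n : reduced3 v1 v2 v3 m1 m2 m3 ->
  lbound (B (comb3 v1 v2 v3 p) (comb3 v1 v2 v3 p)) n <->
  [/\ lbound (B (p.1.1 *: v1) (p.1.1 *: v1)) n,
      lbound (B (p.1.2 *: v2) (p.1.2 *: v2)) n &
      lbound (B (p.2 *: v3) (p.2 *: v3)) n].
Proof.
move=> [[b1 c1] [b2 c2] [b3 c3] /andP[m12 m23] [b12 b13 b23]].
split=> [|[h1 h2 h3]]; last by apply: ultrametric => //; apply: ultrametric.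
move=> sn; apply: (orthogonal_degrees sn) => N h1 h2 h3 nN; split.
- by apply: (cross_scale b1 c1 b2 c2 b12 _ h1 h2); lia.
- by apply: (cross_scale b1 c1 b3 c3 b13 _ h1 h3); lia.
- by apply: (cross_scale b2 c2 b3 c3 b23 _ h2 h3); lia.
Qed.

Lemma basis3_swap12 v1 v2 v3 : basis3 v1 v2 v3 -> basis3 v2 v1 v3.
Proof.
move=> bv; apply: (@basis3_change _ _ _ _ _ (fun p : A * A * A => (p.1.2, p.1.1, p.2)) _ _ _ bv).
  by exists (fun p : A * A * A => (p.1.2, p.1.1, p.2)) => -[[? ?] ?].
by move=> p; rewrite /comb3 [p.1.1 *: _ + _]addrC.
Qed.

Lemma basis3_swap23 v1 v2 v3 : basis3 v1 v2 v3 -> basis3 v1 v3 v2.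
Proof.
move=> bv; apply: (@basis3_change _ _ _ _ _ (fun p : A * A * A => (p.1.1, p.2, p.1.2)) _ _ _ bv).
  by exists (fun p : A * A * A => (p.1.1, p.2, p.1.2)) => -[[? ?] ?].
by move=> p; rewrite /comb3 /= addrAC.
Qed.

Lemma basis3_add v1 v2 v3 a b : basis3 v1 v2 v3 -> basis3 v1 v2 (v3 + (a *: v1 + b *: v2)).
Proof.
move=> bv; apply: (@basis3_change _ _ _ _ _
   (fun p : A * A * A => (p.1.1 + p.2 * a, p.1.2 + p.2 * b, p.2)) _ _ _ bv).
  exists (fun p : A * A * A => (p.1.1 - p.2 * a, p.1.2 - p.2 * b, p.2)) => -[[x y] z] /=.
    by rewrite !addrK.
  by rewrite !subrK.
move=> p; rewrite /comb3 /= !scalerDr !scalerDl !scalerA.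
by rewrite [in RHS]addrACA -[RHS]addrA; congr (_ + _); rewrite addrC.
Qed.

Lemma basis3_neq0 v1 v2 v3 : basis3 v1 v2 v3 -> [/\ v1 != 0, v2 != 0 & v3 != 0].
Proof.
move=> /basis3P[vi _].
have c0 : comb3 v1 v2 v3 (0, 0, 0) = 0 by rewrite /comb3 /= !scale0r !addr0.
split; apply/eqP => v0.
- have /vi[/eqP] : comb3 v1 v2 v3 (1, 0, 0) = comb3 v1 v2 v3 (0, 0, 0).
    by rewrite c0 /comb3 /= v0 scaler0 !scale0r !addr0.
  by rewrite oner_eq0.
- have /vi[/eqP] : comb3 v1 v2 v3 (0, 1, 0) = comb3 v1 v2 v3 (0, 0, 0).
    by rewrite c0 /comb3 /= v0 scaler0 !scale0r !addr0.
  by rewrite oner_eq0.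
- have /vi[/eqP] : comb3 v1 v2 v3 (0, 0, 1) = comb3 v1 v2 v3 (0, 0, 0).
    by rewrite c0 /comb3 /= v0 scaler0 !scale0r !addr0.
  by rewrite oner_eq0.
Qed.

(** * Existence of reduced bases *)

Section Reduction.
Variable C : int.
Hypothesis Cmin : forall x, x != 0 -> C <= ldeg (B x x).

(** Subtracting the lower bound C turns degrees into natural numbers, so that a basis with the least
    total exists. Size reduction below never raises a degree, and minimality then keeps the degrees
    fixed. *)
Let deg_excess x : nat := `|ldeg (B x x) - C|.
Let total v1 v2 v3 : nat := (deg_excess v1 + deg_excess v2 + deg_excess v3)%N.

Let minimal v1 v2 v3 := basis3 v1 v2 v3 /\
  forall w1 w2 w3, basis3 w1 w2 w3 -> (total v1 v2 v3 <= total w1 w2 w3)%N.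

Let minimal_exists : exists v1 v2 v3, minimal v1 v2 v3.
Proof.
pose P n := `[< exists v1 v2 v3, basis3 v1 v2 v3 /\ total v1 v2 v3 = n >].
have Pex : exists n, P n by exists (total e1 e2 e3); apply/asboolP; exists e1, e2, e3.
have [n /asboolP[v1 [v2 [v3 [bv vn]]]] nmin] := ex_minnP Pex.
exists v1, v2, v3; split=> // w1 w2 w3 bw; rewrite vn; apply: nmin.
by apply/asboolP; exists w1, w2, w3.
Qed.

Let minimal_sorted : exists v1 v2 v3, minimal v1 v2 v3 /\
  ldeg (B v1 v1) <= ldeg (B v2 v2) <= ldeg (B v3 v3).
Proof.
have [v1 [v2 [v3 vm]]] := minimal_exists.
have s12 u1 u2 u3 : minimal u1 u2 u3 -> minimal u2 u1 u3.
  move=> [bu um]; split; first exact: basis3_swap12.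
  by move=> w1 w2 w3 /um; rewrite /total [(deg_excess u2 + _)%N]addnC.
have s23 u1 u2 u3 : minimal u1 u2 u3 -> minimal u1 u3 u2.
  move=> [bu um]; split; first exact: basis3_swap23.
  by move=> w1 w2 w3 /um; rewrite /total addnAC.
have [h12|h12] := leP (ldeg (B v1 v1)) (ldeg (B v2 v2));
have [h23|h23] := leP (ldeg (B v2 v2)) (ldeg (B v3 v3));
have [h13|h13] := leP (ldeg (B v1 v1)) (ldeg (B v3 v3)).
- by exists v1, v2, v3; rewrite h12 h23.
- by lia.
- by exists v1, v3, v2; rewrite h13 ltW//; split=> //; apply: s23.
- by exists v3, v1, v2; rewrite h12 ltW//; split=> //; apply/s12/s23.
- by exists v2, v1, v3; rewrite h13 ltW//; split=> //; apply: s12.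
- by exists v2, v3, v1; rewrite h23 ltW//; split=> //; apply/s23/s12.
- by lia.
- by exists v3, v2, v1; rewrite !ltW//; split=> //; apply/s12/s23/s12.
Qed.

Let Q0 v : v != 0 -> B v v != 0.
Proof. by apply: contra_neq; apply: anisotropic_eq0. Qed.

Let minimal_replace3 v1 v2 v3 w3 : minimal v1 v2 v3 -> basis3 v1 v2 w3 ->
  lbound (B w3 w3) (ldeg (B v3 v3)) ->
  minimal v1 v2 w3 /\ ldeg (B w3 w3) = ldeg (B v3 v3).
Proof.
move=> [bv vm] bw w3n; have [_ _ w30] := basis3_neq0 bw; have [_ _ v30] := basis3_neq0 bv.
have le := ldeg_le (Q0 w30) w3n; have := vm _ _ _ bw.
have := Cmin w30; have := Cmin v30; rewrite /total /deg_excess => c1 c2 tt.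
have e : ldeg (B w3 w3) = ldeg (B v3 v3) by lia.
by split=> //; split=> // t1 t2 t3 /vm; rewrite /total /deg_excess e.
Qed.

Let reduce12 v1 v2 v3 : minimal v1 v2 v3 -> ldeg (B v1 v1) <= ldeg (B v2 v2) ->
  exists w2, [/\ minimal v1 w2 v3, ldeg (B w2 w2) = ldeg (B v2 v2) &
    lbound (B v1 w2) (ldeg (B v1 v1) - 1)].
Proof.
move=> vm h12; have [v10 v20 v30] := basis3_neq0 vm.1.
(* [cauchy_schwarz] shows that a v1 has value of degree at most that of v2. The summand 0 v3 puts w2
   in the form of [basis3_add], after v2 has been moved to the last place. *)
pose a := lfloor (B v1 v2 / B v1 v1); pose w2 := v2 + ((- a) *: v1 + 0 *: v3).
have w2E : w2 = v2 + (- a) *: v1 by rewrite /w2 scale0r addr0.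
have sm : minimal v1 v3 v2.
  have [bv vmin] := vm; split; first exact: basis3_swap23.
  by move=> t1 t2 t3 /vmin; rewrite /total addnAC.
have bw : basis3 v1 v3 w2 by apply: basis3_add; exact: sm.1.
have [|sm' ew] := minimal_replace3 sm bw.
  rewrite w2E; apply: ultrametric; first exact/ldeg_bound/Q0.
  have [a0|a0] := eqVneq a 0.
    by rewrite a0 oppr0 scale0r (bil0l Bbil); exact: lbound0.
  have b0 : B v1 v2 != 0.
    apply: contra_neq a0 => b0; apply/polyP => i.
    by rewrite /a b0 mul0r coef_lfloor coef0 lcoef0.
  have cs := cauchy_schwarz b0.
  have da : lbound (lp a) (ldeg (B v1 v2) - ldeg (B v1 v1)).
    have hf : lbound (B v1 v2 / B v1 v1) (ldeg (B v1 v2) - ldeg (B v1 v1)).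
      apply: le_ldeg; first by rewrite mulf_neq0 ?invr_eq0 ?Q0.
      by rewrite ldegM ?invr_eq0 ?Q0// ldegV ?Q0.
    have [neg|pos] := ltP (ldeg (B v1 v2) - ldeg (B v1 v1)) 0.
      case/eqP: a0; apply/polyP => i; rewrite /a coef_lfloor coef0 hf//; lia.
    have sz : (size a <= `|ldeg (B v1 v2) - ldeg (B v1 v1)|.+1)%N.
      by apply: size_lfloor; apply: lbound_le hf _; lia.
    by apply: lbound_le (proj1 (lbound_poly _ _) sz) _; lia.
  rewrite !(bilE Bbil) !rmorphN !mulNr mulrN opprK.
  by apply: (lboundMle da (lboundM da (ldeg_bound (Q0 v10)))); lia.
exists w2; split=> //.
  have [bv vmin] := sm'; split; first exact: basis3_swap23.
  by move=> t1 t2 t3 /vmin; rewrite /total addnAC.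
rewrite w2E !(bilE Bbil) rmorphN mulNr.
have -> : B v1 v2 - lp a * B v1 v1 = (B v1 v2 / B v1 v1 - lp a) * B v1 v1.
  by rewrite mulrBl divfK// Q0.
by apply: (lboundMle (lfloorP _) (ldeg_bound (Q0 v10))); lia.
Qed.

Let pair_degrees v1 v2 (m1 m2 : int) (x1 x2 : A) (n : int) : lbound (B v1 v1) m1 -> B v1 v1 m1 != 0 ->
  lbound (B v2 v2) m2 -> B v2 v2 m2 != 0 -> lbound (B v1 v2) (m1 - 1) -> m1 <= m2 ->
  lbound (B (x1 *: v1 + x2 *: v2) (x1 *: v1 + x2 *: v2)) n ->
  lbound (B (x1 *: v1) (x1 *: v1)) n /\ lbound (B (x2 *: v2) (x2 *: v2)) n.
Proof.
move=> b1 c1 b2 c2 b12 m12 h.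
have [||h1 h2 _] := @orthogonal_degrees (x1 *: v1) (x2 *: v2) 0 n => //.
  by rewrite addr0.
move=> N h1 h2 _ nN; rewrite !(bilC Bbil _ 0) !(bil0l Bbil); split; try exact: lbound0.
by apply: (cross_scale b1 c1 b2 c2 b12 _ h1 h2); lia.
Qed.

Let reduce3 v1 v2 v3 (m1 := ldeg (B v1 v1)) (m2 := ldeg (B v2 v2)) :
  minimal v1 v2 v3 -> m1 <= m2 <= ldeg (B v3 v3) -> lbound (B v1 v2) (m1 - 1) ->
  exists w3, [/\ minimal v1 v2 w3, ldeg (B w3 w3) = ldeg (B v3 v3),
    lbound (B v1 w3) (m1 - 1) & lbound (B v2 w3) (m2 - 1)].
Proof.
move=> vm /andP[m12 m23] b12; have [v10 v20 v30] := basis3_neq0 vm.1.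
have [b1 c1] := ldegP (Q0 v10); have [b2 c2] := ldegP (Q0 v20).
set D := B v1 v1 * B v2 v2 - B v1 v2 ^+ 2.
have D0 : D != 0.
  apply: (@ldeg_neq0 _ _ (m1 + m2)); rewrite /D lcoefB lcoefM_top//.
  rewrite expr2 (lcoef_top0 (lboundM b12 b12)); last lia.
  by rewrite subr0 mulf_neq0.
(* h1 and h2 are the coordinates of the orthogonal projection of v3 to the plane of v1 and v2; their
   polynomial parts are subtracted from v3. *)
pose h1 := (B v2 v2 * B v1 v3 - B v1 v2 * B v2 v3) / D.
pose h2 := (B v1 v1 * B v2 v3 - B v1 v2 * B v1 v3) / D.
have kh1 : h1 * D = B v2 v2 * B v1 v3 - B v1 v2 * B v2 v3 by rewrite divfK.
have kh2 : h2 * D = B v1 v1 * B v2 v3 - B v1 v2 * B v1 v3 by rewrite divfK.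
have cmb s t : (h1 * s + h2 * t) * D = (B v2 v2 * B v1 v3 - B v1 v2 * B v2 v3) * s +
    (B v1 v1 * B v2 v3 - B v1 v2 * B v1 v3) * t by rewrite -kh1 -kh2; ring.
have k1 : B v1 v3 = h1 * B v1 v1 + h2 * B v1 v2.
  by apply: (mulIf D0); rewrite cmb /D; ring.
have k2 : B v2 v3 = h1 * B v1 v2 + h2 * B v2 v2.
  by apply: (mulIf D0); rewrite cmb /D; ring.
clearbody h1 h2.
pose x1 := lfloor h1; pose x2 := lfloor h2.
pose w3 := v3 + ((- x1) *: v1 + (- x2) *: v2).
have f1 := lfloorP h1; have f2 := lfloorP h2.
have w13 : lbound (B v1 w3) (m1 - 1).
  have -> : B v1 w3 = (h1 - lp x1) * B v1 v1 + (h2 - lp x2) * B v1 v2.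
    by rewrite /w3 !(bilE Bbil) !rmorphN k1; ring.
  by apply: lboundD; [apply: (lboundMle f1 b1)|apply: (lboundMle f2 b12)]; clear; lia.
have w23 : lbound (B v2 w3) (m2 - 1).
  have -> : B v2 w3 = (h1 - lp x1) * B v1 v2 + (h2 - lp x2) * B v2 v2.
    by rewrite /w3 !(bilE Bbil) !rmorphN k2 (bilC Bbil v2 v1); ring.
  by apply: lboundD; [apply: (lboundMle f1 b12)|apply: (lboundMle f2 b2)];
    clear -m12; lia.
have bw : basis3 v1 v2 w3 by apply: basis3_add; exact: vm.1.
have [_ _ w30] := basis3_neq0 bw.
suff w3n : lbound (B w3 w3) (ldeg (B v3 v3)).
  by have [vm' e] := minimal_replace3 vm bw w3n; exists w3.
apply: le_ldeg; first exact: Q0.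
(* If the degree th of w3 exceeded that of v3, then X = v3 - w3 would have degree at most th. By
   reducedness B w3 X would have degree below th, and [parallelogram] applied to v3 = w3 + X would
   bound w3 by th - 1. *)
rewrite leNgt; apply/negP; set th := ldeg (B w3 w3) => lt.
pose X := x1 *: v1 + x2 *: v2.
have v3E : w3 + X = v3.
  by rewrite /w3 /X -addrA addrACA !scaleNr !addNr !addr0.
have wth := ldeg_bound (Q0 w30); rewrite -/th in wth.
have Xth : lbound (B X X) th.
  have -> : X = v3 - w3 by rewrite -v3E addrC addKr.
  apply: ultrametric; last by rewrite (bil_sqN Bbil).
  by apply: le_ldeg; [exact: Q0|exact: ltW].
have [h1th h2th] := pair_degrees b1 c1 b2 c2 b12 m12 Xth.
have cr (x : A) v m : m <= ldeg (B v3 v3) -> lbound (B v v) m -> B v v m != 0 ->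
    lbound (B v w3) (m - 1) -> lbound (B (x *: v) (x *: v)) th ->
    lbound (B w3 (x *: v)) (th - 1).
  move=> m3 bm cm vw xth; rewrite (bilZr Bbil) (bilC Bbil w3).
  have [->|x0] := eqVneq x 0; first by rewrite rmorph0 mul0r; exact: lbound0.
  have := lbound_scale bm cm xth x0 => dx.
  have x0' : lp x != 0 by rewrite laurent_of_poly_eq0.
  apply: (lboundMle (ldeg_bound x0') vw); move: dx m3 lt; clearbody th; clear; lia.
have wX : lbound (B w3 X) (th - 1).
  rewrite (bilDr Bbil); apply: lboundD.
    by apply: (cr _ _ m1) => //; exact: le_trans m23.
  by apply: (cr _ _ m2).
have [||w3n _] := @parallelogram w3 X (th - 1) => //.
  by rewrite v3E; apply: le_ldeg; [exact: Q0|move: lt; clear; lia].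
by have := ldeg_le (Q0 w30) w3n; rewrite -/th; clear; lia.
Qed.

Lemma reduced_basis_exists : exists v1 v2 v3 m1 m2 m3,
  basis3 v1 v2 v3 /\ reduced3 v1 v2 v3 m1 m2 m3.
Proof.
have [v1 [v2 [v3 [vm /andP[h12 h23]]]]] := minimal_sorted.
have [w2 [wm ew w12]] := reduce12 vm h12.
have [|w3 [wm' ew3 w13 w23]] := reduce3 wm _ w12; first by rewrite ew h12 h23.
have [v10 w20 w30] := basis3_neq0 wm'.1.
exists v1, w2, w3, (ldeg (B v1 v1)), (ldeg (B w2 w2)), (ldeg (B w3 w3)).
split; first exact: wm'.1.
by split=> //; [exact/ldegP/Q0|exact/ldegP/Q0|exact/ldegP/Q0|rewrite ew3 ew h12 h23].
Qed.

End Reduction.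
End Anisotropic.
End Definite.

(** * Successive minima from numbers of vectors *)

Section Minima.
Variable F : finFieldType.
Hypothesis q_odd : odd #|F|.
Local Notation A := {poly F}.
Local Notation E := (laurent F).
Local Notation lp := (@laurent_of_poly F).

(* number of coefficients of a polynomial p with 2 deg p + m <= n *)
Definition radius (n m : int) : nat := if m <= n then (`|n - m|%N./2).+1 else 0%N.

(** [radius n m] exceeds [radius (n - 2) m] by 1 exactly when m <= n. The sums therefore determine,
    for every n, how many of the m's are at most n. *)
Lemma radius_inj (m1 m2 m3 m1' m2' m3' : int) : m1 <= m2 <= m3 -> m1' <= m2' <= m3' ->
  (forall n, radius n m1 + radius n m2 + radius n m3 =
             radius n m1' + radius n m2' + radius n m3')%N ->
  [/\ m1 = m1', m2 = m2' & m3 = m3'].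
Proof.
move=> /andP[h12 h23] /andP[h12' h23'] e.
have r2 n m : radius n m = (radius (n - 2%:R) m + (m <= n)%R)%N.
  by clear; rewrite /radius; case: ifPn; case: ifPn => ? ?; lia.
have c n : ((m1 <= n)%R + (m2 <= n)%R + (m3 <= n)%R =
    (m1' <= n)%R + (m2' <= n)%R + (m3' <= n)%R)%N.
  have := e n; have := e (n - 2%:R); rewrite !(r2 n).
  move: (radius _ m1) (radius _ m2) (radius _ m3) => a1 a2 a3.
  move: (radius _ m1') (radius _ m2') (radius _ m3') => b1 b2 b3.
  move: (nat_of_bool (m1 <= n)) (nat_of_bool (m2 <= n)) (nat_of_bool (m3 <= n)).
  move: (nat_of_bool (m1' <= n)) (nat_of_bool (m2' <= n)) (nat_of_bool (m3' <= n)).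
  by clear; lia.
have main (x1 x2 x3 y1 y2 y3 : int) : x1 <= x2 -> x2 <= x3 -> y1 <= y2 -> y2 <= y3 ->
  (forall n, ((x1 <= n)%R + (x2 <= n)%R + (x3 <= n)%R =
    (y1 <= n)%R + (y2 <= n)%R + (y3 <= n)%R)%N) -> [/\ y1 <= x1, y2 <= x2 & y3 <= x3].
  clear => h1 h2 h3 h4 e; split; rewrite leNgt; apply/negP => lt.
  - have := e x1; rewrite lexx (lt_geF lt) (lt_geF (lt_le_trans lt h3)).
    by rewrite (lt_geF (lt_le_trans lt (le_trans h3 h4))).
  - have := e x2; rewrite lexx h1 (lt_geF lt) (lt_geF (lt_le_trans lt h4)).
    by case: (_ <= _); case: (_ <= _).
  - have := e x3; rewrite lexx h2 (le_trans h1 h2) (lt_geF lt).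
    by case: (_ <= _); case: (_ <= _).
have [a1 a2 a3] := main _ _ _ _ _ _ h12 h23 h12' h23' c.
have [b1 b2 b3] := main _ _ _ _ _ _ h12' h23' h12 h23 (fun n => esym (c n)).
by split; apply/eqP; rewrite eq_le ?a1 ?a2 ?a3 ?b1 ?b2 ?b3.
Qed.

Section One.
Variables (L : lmodType A) (B : L -> L -> E).
Hypothesis Bbil : bilinear_form B.
Variables e1 e2 e3 : L.
Hypothesis ebas : basis3 e1 e2 e3.
Hypothesis eani : anisotropic B e1 e2 e3.

Lemma scale_radius (p : A) (v : L) m n : lbound (B v v) m -> B v v m != 0 ->
  lbound (B (p *: v) (p *: v)) n <-> (size p <= radius n m)%N.
Proof.
move=> bm cm; have [->|p0] := eqVneq p 0.
  by rewrite scale0r (bil0l Bbil) size_poly0; split=> // _; exact: lbound0.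
have p0' : lp p != 0 by rewrite laurent_of_poly_eq0.
have d : 2%:R * ldeg (lp p) + m <= n <-> (size p <= radius n m)%N.
  rewrite ldeg_poly//; move: p0; rewrite -size_poly_gt0 /radius.
  by move: (size p) => t t0; case: ifPn => h; split; lia.
split=> [h|/d h]; first by apply/d; apply: (lbound_scale (two_neq0 q_odd) Bbil bm cm h p0).
rewrite !(bilE Bbil).
apply: (lboundMle (ldeg_bound p0') (lboundM (ldeg_bound p0') bm)); lia.
Qed.

Lemma reduced_radius v1 v2 v3 m1 m2 m3 p n : reduced3 B v1 v2 v3 m1 m2 m3 ->
  lbound (B (comb3 v1 v2 v3 p) (comb3 v1 v2 v3 p)) n <->
  [/\ (size p.1.1 <= radius n m1)%N, (size p.1.2 <= radius n m2)%N &
      (size p.2 <= radius n m3)%N].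
Proof.
move=> vred; apply: (iff_trans (reduced_degrees (two_neq0 q_odd) Bbil ebas eani _ _ vred)).
have [[b1 c1] [b2 c2] [b3 c3] _ _] := vred.
have r1 := scale_radius p.1.1 n b1 c1; have r2 := scale_radius p.1.2 n b2 c2.
have r3 := scale_radius p.2 n b3 c3.
by split=> -[h1 h2 h3]; split; [exact/r1|exact/r2|exact/r3|exact/r1|exact/r2|exact/r3].
Qed.

Definition box_vec (v1 v2 v3 : L) n1 n2 n3 (i : 'rV[F]_n1 * 'rV[F]_n2 * 'rV[F]_n3) :=
  comb3 v1 v2 v3 (rVpoly i.1.1, rVpoly i.1.2, rVpoly i.2).

Lemma box_vec_inj v1 v2 v3 n1 n2 n3 : basis3 v1 v2 v3 ->
  injective (@box_vec v1 v2 v3 n1 n2 n3).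
Proof.
move=> bv [[x y] z] [[x' y'] z'] /((basis3P _ _ _).1 bv).1[].
by move=> /(can_inj rVpolyK)-> /(can_inj rVpolyK)-> /(can_inj rVpolyK)->.
Qed.

Lemma box_vec_surj v1 v2 v3 n1 n2 n3 (p : A * A * A) : (size p.1.1 <= n1)%N ->
  (size p.1.2 <= n2)%N -> (size p.2 <= n3)%N ->
  exists i, @box_vec v1 v2 v3 n1 n2 n3 i = comb3 v1 v2 v3 p.
Proof.
move=> h1 h2 h3; exists (poly_rV p.1.1, poly_rV p.1.2, poly_rV p.2).
by rewrite /box_vec /= !poly_rV_K.
Qed.

Lemma box_vec_radius v1 v2 v3 m1 m2 m3 n i : reduced3 B v1 v2 v3 m1 m2 m3 ->
  lbound (B (@box_vec v1 v2 v3 (radius n m1) (radius n m2) (radius n m3) i)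
    (@box_vec v1 v2 v3 (radius n m1) (radius n m2) (radius n m3) i)) n.
Proof. by move=> vred; apply/(reduced_radius _ _ vred); split; apply: size_poly. Qed.

Lemma box_vec_radius_surj v1 v2 v3 m1 m2 m3 n x : basis3 v1 v2 v3 ->
  reduced3 B v1 v2 v3 m1 m2 m3 -> lbound (B x x) n ->
  exists i, @box_vec v1 v2 v3 (radius n m1) (radius n m2) (radius n m3) i = x.
Proof.
move=> bv vred; have [p <-] := ((basis3P _ _ _).1 bv).2 x.
by move=> /(reduced_radius _ _ vred)[h1 h2 h3]; apply: box_vec_surj.
Qed.

End One.

(** The vectors of value degree at most n number q to the sum of the three radii. *)
Lemma minima_unique (L L' : lmodType A) (B : L -> L -> E) (B' : L' -> L' -> E)
   e1 e2 e3 e1' e2' e3' v1 v2 v3 w1 w2 w3 m1 m2 m3 m1' m2' m3' :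
  bilinear_form B -> bilinear_form B' ->
  basis3 e1 e2 e3 -> anisotropic B e1 e2 e3 ->
  basis3 e1' e2' e3' -> anisotropic B' e1' e2' e3' ->
  (forall n, iso_upto n (fun x => B x x) (fun x => B' x x)) ->
  basis3 v1 v2 v3 -> reduced3 B v1 v2 v3 m1 m2 m3 ->
  basis3 w1 w2 w3 -> reduced3 B' w1 w2 w3 m1' m2' m3' ->
  [/\ m1 = m1', m2 = m2' & m3 = m3'].
Proof.
move=> Bbil Bbil' eb ea eb' ea' iso vb vr wb wr.
have [_ _ _ h _] := vr; have [_ _ _ h' _] := wr.
apply: radius_inj => // n.
have := transport_sum (P := fun a => lbound a n) (Q := fun x => B x x)
  (Q' := fun x => B' x x) (fun _ => 1%N) (iso n) (fun _ => id)
  (box_vec_inj vb) (box_vec_inj wb)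
  (fun i => box_vec_radius Bbil eb ea i vr) (fun i => box_vec_radius Bbil' eb' ea' i wr)
  (fun x => box_vec_radius_surj Bbil eb ea vb vr) (fun x => box_vec_radius_surj Bbil' eb' ea' wb wr).
rewrite !sum_nat_const !muln1 !card_prod !card_mx !mul1n -!expnD => /eqP.
by rewrite eqn_exp2l ?(finNzRing_gt1 F)// => /eqP.
Qed.

End Minima.

(** * Minima (0, 2k+1, 2k+1) *)

Section Poisson.
Variable F : finFieldType.
Hypothesis q_odd : odd #|F|.
Local Notation A := {poly F}.
Local Notation E := (laurent F).
Local Notation lp := (@laurent_of_poly F).
Variable psi : F -> algC.
Hypothesis psi0 : psi 0 = 1.
Hypothesis psiD : {morph psi : x y / x + y >-> x * y}.
Hypothesis psi_nt : exists x, psi x != 1.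

Lemma sum_char_eq0 (I : finType) (P : pred I) (lam : I -> F) (sh : I -> I) (c : F) :
  injective sh -> (forall x, lam (sh x) = lam x + c) -> (forall x, P (sh x) = P x) ->
  psi c != 1 -> \sum_(x | P x) psi (lam x) = 0.
Proof.
move=> shi lamD Pl nt; set s := \sum_(x | _) _.
suff /eqP : s = psi c * s.
  rewrite -subr_eq0 -{1}[s]mul1r -mulrBl mulf_eq0 subr_eq0 eq_sym (negPf nt).
  by move/eqP.
rewrite {1}/s (reindex_inj shi) mulr_sumr.
by apply: eq_big => [x|x _]; rewrite ?Pl// lamD psiD mulrC.
Qed.

Lemma psi_scale_nt (c : F) : c != 0 -> exists t, psi (t * c) != 1.
Proof.
have [x x1] := psi_nt; move=> c0; exists (x / c).
by rewrite divfK.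
Qed.

Section Form.
Variable k : nat.
Let M : int := (2 * k + 1)%N%:Z.
Variables (w1 w2 b22 b23 b33 : E) (c2 c3 : F).
Hypotheses (w1b : lbound w1 (-1)) (w2b : lbound w2 (-1)).
Hypotheses (b22b : lbound b22 M) (b22c : b22 M = c2) (c20 : c2 != 0).
Hypotheses (b33b : lbound b33 M) (b33c : b33 M = c3) (c30 : c3 != 0).
Hypothesis (b23b : lbound b23 (M - 1)).

(** The first diagonal entry is exactly 1, which scaling by the inverse of the series B v1 v1
    achieves. *)
Definition bform (y z : E * E * E) : E :=
  y.1.1 * (z.1.1 + w1 * z.1.2 + w2 * z.2) +
  y.1.2 * (w1 * z.1.1 + b22 * z.1.2 + b23 * z.2) +
  y.2 * (w2 * z.1.1 + b23 * z.1.2 + b33 * z.2).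

Lemma bformC y z : bform y z = bform z y.
Proof. by rewrite /bform; ring. Qed.

Lemma bformDl x y z : bform (x + y) z = bform x z + bform y z.
Proof. by rewrite /bform /=; ring. Qed.

Lemma bform_sqD x y : bform (x + y) (x + y) = bform x x + 2%:R * bform x y + bform y y.
Proof. by rewrite /bform /=; ring. Qed.

Lemma lres_sqD u x y : lres u (bform (x + y) (x + y)) =
  lres u (bform x x) + 2%:R * lres u (bform x y) + lres u (bform y y).
Proof.
rewrite bform_sqD; move: (bform x x) (bform x y) (bform y y) => a b c.
by rewrite !lresDr [2%:R * b]mulr_natl mulr2n lresDr; ring.
Qed.

Let det := b22 * b33 - b23 ^+ 2 - w1 ^+ 2 * b33 + 2%:R * w1 * w2 * b23 - w2 ^+ 2 * b22.

Lemma det_bound : lbound det (M + M) /\ det (M + M) = c2 * c3.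
Proof.
have h1 : lbound (b23 ^+ 2) (M + M - 1) by apply: (lboundMle b23b b23b); lia.
have h2 : lbound (w1 ^+ 2 * b33) (M + M - 1).
  by apply: (lboundMle (lboundM w1b w1b) b33b); rewrite /M; lia.
have h3 : lbound (2%:R * w1 * w2 * b23) (M + M - 1).
  have w12 := lbound_twice w1b.
  by apply: (lboundMle (lboundM w12 w2b) b23b); rewrite /M; lia.
have h4 : lbound (w2 ^+ 2 * b22) (M + M - 1).
  by apply: (lboundMle (lboundM w2b w2b) b22b); rewrite /M; lia.
have r : lbound (- b23 ^+ 2 - w1 ^+ 2 * b33 + 2%:R * w1 * w2 * b23 - w2 ^+ 2 * b22) (M + M - 1).
  by apply: lboundB => //; apply: lboundD => //; apply: lboundB => //; apply: lboundN.
have -> : det = b22 * b33 + (- b23 ^+ 2 - w1 ^+ 2 * b33 + 2%:R * w1 * w2 * b23 - w2 ^+ 2 * b22).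
  by rewrite /det; ring.
split; first by apply: lboundD; [exact: lboundM|apply: lbound_le r _; lia].
by rewrite lcoefD (lcoefM_top b22b b33b) b22c b33c (lcoef_top0 r) ?addr0//; lia.
Qed.

Let det_neq0 : det != 0.
Proof.
by apply: (@ldeg_neq0 _ _ (M + M)); rewrite det_bound.2 mulf_neq0.
Qed.

(** g11, ..., g33 are the entries of the inverse Gram matrix, as cofactors over the determinant. *)
Definition g11 := (b22 * b33 - b23 ^+ 2) / det.
Definition g12 := (w2 * b23 - w1 * b33) / det.
Definition g13 := (w1 * b23 - w2 * b22) / det.
Definition g22 := (b33 - w2 ^+ 2) / det.
Definition g23 := (w1 * w2 - b23) / det.
Definition g33 := (b22 - w1 ^+ 2) / det.

Definition dform (y z : E * E * E) : E :=
  y.1.1 * (g11 * z.1.1 + g12 * z.1.2 + g13 * z.2) +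
  y.1.2 * (g12 * z.1.1 + g22 * z.1.2 + g23 * z.2) +
  y.2 * (g13 * z.1.1 + g23 * z.1.2 + g33 * z.2).

Let dV : lbound det^-1 (- (M + M)) /\ det^-1 (- (M + M)) = (c2 * c3)^-1.
Proof.
have [db dc] := det_bound; have d0 : det (M + M) != 0 by rewrite dc mulf_neq0.
by rewrite (lcoefV_top db d0) dc; split=> //; apply: lboundV.
Qed.

Let frac_bound (f : E) (m n : int) : lbound f m -> m - (M + M) <= n -> lbound (f / det) n.
Proof. by move=> fm mn; apply: (lboundMle fm dV.1). Qed.

Lemma g11P : lbound g11 0 /\ g11 0 = 1.
Proof.
have h1 : lbound (b23 ^+ 2) (M + M - 1) by apply: (lboundMle b23b b23b); lia.
have nb : lbound (b22 * b33 - b23 ^+ 2) (M + M).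
  by apply: lboundB; [exact: lboundM|apply: lbound_le h1 _; lia].
split; first by apply: frac_bound nb _; lia.
rewrite /g11 (_ : 0 = M + M + - (M + M)); last lia.
rewrite (lcoefM_top nb dV.1) dV.2 lcoefB (lcoefM_top b22b b33b) b22c b33c.
by rewrite (lcoef_top0 h1) ?subr0 ?divff ?mulf_neq0//; lia.
Qed.

Lemma g12b : lbound g12 (- M - 1).
Proof.
apply: (@frac_bound _ (M - 1)); last lia.
by apply: lboundB; [apply: (lboundMle w2b b23b)|apply: (lboundMle w1b b33b)]; lia.
Qed.

Lemma g13b : lbound g13 (- M - 1).
Proof.
apply: (@frac_bound _ (M - 1)); last lia.
by apply: lboundB; [apply: (lboundMle w1b b23b)|apply: (lboundMle w2b b22b)]; lia.
Qed.

Let diag_entry (b w : E) (c : F) : lbound b M -> b M = c -> lbound w (-1) ->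
  lbound ((b - w ^+ 2) / det) (- M) /\ ((b - w ^+ 2) / det) (- M) = c / (c2 * c3).
Proof.
move=> bb bc wb; have ww : lbound (w ^+ 2) (-2) by apply: (lboundMle wb wb).
have nb : lbound (b - w ^+ 2) M by apply: lboundB => //; apply: lbound_le ww _; rewrite /M; lia.
split; first by apply: frac_bound nb _; lia.
have e : - M = M + - (M + M) by lia.
by rewrite {1}e (lcoefM_top nb dV.1) dV.2 lcoefB bc (lcoef_top0 ww) ?subr0//; rewrite /M; lia.
Qed.

Lemma g22P : lbound g22 (- M) /\ g22 (- M) = c2^-1.
Proof.
have [h1 h2] := diag_entry b33b b33c w2b; split=> //; rewrite h2.
by field; rewrite c20 c30.
Qed.

Lemma g33P : lbound g33 (- M) /\ g33 (- M) = c3^-1.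
Proof.
have [h1 h2] := diag_entry b22b b22c w1b; split=> //; rewrite h2.
by field; rewrite c20 c30.
Qed.

Lemma g23b : lbound g23 (- M - 1).
Proof.
apply: (@frac_bound _ (M - 1)); last lia.
by apply: lboundB => //; apply: (lboundMle w1b w2b); rewrite /M; lia.
Qed.

Definition dual_vec (x : E * E * E) : E * E * E :=
  (g11 * x.1.1 + g12 * x.1.2 + g13 * x.2, g12 * x.1.1 + g22 * x.1.2 + g23 * x.2,
   g13 * x.1.1 + g23 * x.1.2 + g33 * x.2).

Definition dot (y z : E * E * E) : E := y.1.1 * z.1.1 + y.1.2 * z.1.2 + y.2 * z.2.

Lemma bform_dual y x : bform y (dual_vec x) = dot y x.
Proof.
rewrite bformC /bform /dual_vec /dot /= /g11 /g12 /g13 /g22 /g23 /g33.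
apply: (mulIf det_neq0); set iv := det^-1.
transitivity (det * iv * (y.1.1 * x.1.1 + y.1.2 * x.1.2 + y.2 * x.2) * det); last first.
  by rewrite /iv divff// mul1r.
by congr (_ * _); rewrite /det; ring.
Qed.

Lemma dform_dot x : dform x x = dot x (dual_vec x).
Proof. by rewrite /dform /dot /=; ring. Qed.

Section Level.
Variable (s : nat) (u : E).
Hypotheses (ub : lbound u (1 - s%:Z)) (u0 : u (1 - s%:Z) != 0).

(** Representatives of [in_ball] modulo [negligible]: degrees -1 to s-1 in the first coordinate,
    -k-1 to s-k-2 in the others. With deg u = 1 - s this is the range on which the phase depends. *)
Definition grid := ('rV[F]_s.+1 * 'rV[F]_s * 'rV[F]_s)%type.
Definition grid_vec (p : grid) : E * E * E :=
  (lmonom 1 (-1) * lp (rVpoly p.1.1), lmonom 1 (- k.+1%:Z) * lp (rVpoly p.1.2),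
   lmonom 1 (- k.+1%:Z) * lp (rVpoly p.2)).

Lemma grid_vecD p r : grid_vec (p + r) = grid_vec p + grid_vec r.
Proof. by rewrite /grid_vec /= !linearD /= !rmorphD !mulrDr. Qed.

Definition in_ball (y : E * E * E) := [/\ lbound y.1.1 (s%:Z - 1),
  lbound y.1.2 (s%:Z - k%:Z - 2) & lbound y.2 (s%:Z - k%:Z - 2)].
Definition negligible (y : E * E * E) := [/\ lbound y.1.1 (-2),
  lbound y.1.2 (- k%:Z - 2) & lbound y.2 (- k%:Z - 2)].

Lemma lbound_shift (e : int) (p : A) (n : nat) : (size p <= n)%N ->
  lbound (lmonom 1 e * lp p) (e + n%:Z - 1).
Proof.
move=> sp; apply: (lboundMle (@lbound_monom _ 1 e) (proj1 (lbound_poly _ _) sp)); lia.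
Qed.

Lemma lcoef_shift (e : int) (p : A) (j : nat) : (lmonom 1 e * lp p) (e + j%:Z) = p`_j.
Proof. by rewrite lcoef_monomM mul1r (_ : _ - _ = j%:Z) ?lcoef_poly//; lia. Qed.

Lemma size_rVpoly n (z : 'rV[F]_n) : (size (rVpoly z) <= n)%N.
Proof. exact: size_poly. Qed.

Lemma grid_ball p : in_ball (grid_vec p).
Proof.
split; rewrite /grid_vec /=.
- by apply: lbound_le (@lbound_shift (-1) _ _ (size_rVpoly p.1.1)) _; lia.
- by apply: lbound_le (@lbound_shift (- k.+1%:Z) _ _ (size_rVpoly p.1.2)) _; lia.
- by apply: lbound_le (@lbound_shift (- k.+1%:Z) _ _ (size_rVpoly p.2)) _; lia.
Qed.

Lemma negligible_ball y : negligible y -> in_ball y.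
Proof.
by case=> h1 h2 h3; split; [apply: lbound_le h1 _|apply: lbound_le h2 _|apply: lbound_le h3 _]; lia.
Qed.

Lemma lres_term (a b c : E) (l m n : int) : lbound a l -> lbound b m -> lbound c n ->
  l + m + n < s%:Z - 2 -> lres u (a * (b * c)) = 0.
Proof. by move=> al bm cn lt; apply: (lres_small ub (lboundM al (lboundM bm cn))); lia. Qed.

Lemma lres_negligible y z : in_ball y -> negligible z -> lres u (bform y z) = 0.
Proof.
case=> y1 y2 y3 [z1 z2 z3].
rewrite (_ : bform y z = y.1.1 * (1 * z.1.1) + y.1.1 * (w1 * z.1.2) + y.1.1 * (w2 * z.2) +
  y.1.2 * (w1 * z.1.1) + y.1.2 * (b22 * z.1.2) + y.1.2 * (b23 * z.2) +
  y.2 * (w2 * z.1.1) + y.2 * (b23 * z.1.2) + y.2 * (b33 * z.2)); last by rewrite /bform; ring.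
rewrite !lresDr.
rewrite (lres_term y1 (@lbound1 F) z1) ?(lres_term y1 w1b z2) ?(lres_term y1 w2b z3)
  ?(lres_term y2 w1b z1) ?(lres_term y2 b22b z2) ?(lres_term y2 b23b z3)
  ?(lres_term y3 w2b z1) ?(lres_term y3 b23b z2) ?(lres_term y3 b33b z3) ?addr0//;
  rewrite /M; clear; lia.
Qed.

Definition gamma : algC := \sum_(p : grid) psi (lres u (bform (grid_vec p) (grid_vec p))).

(** Dual vectors whose dual value has degree at most 0. There is one coefficient for each negative
    power of t in the grid, so their characters test integrality of grid points. *)
Definition dual_box := (F * 'rV[F]_k.+1 * 'rV[F]_k.+1)%type.
Definition dual_box_vec (x : dual_box) : E * E * E :=
  (lcst x.1.1, lp (rVpoly x.1.2), lp (rVpoly x.2)).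

Lemma truncation (y : E * E * E) : in_ball y ->
  exists p : grid, negligible (grid_vec p - y).
Proof.
case: y => [[y1 y2] y3] [/= h1 h2 h3].
have tr (e : int) (f : E) n (m := e + n%:Z - 1) : lbound f m ->
    exists p : 'rV[F]_n, lbound (lmonom 1 e * lp (rVpoly p) - f) (e - 1).
  move=> fm; pose f' := lmonom 1 (- e) * f.
  have fb : lbound f' (n%:Z - 1).
    by apply: (lboundMle (@lbound_monom _ 1 (- e)) fm); rewrite /m; lia.
  exists (poly_rV (lfloor f')); rewrite poly_rV_K ?size_lfloor//.
  have -> : lmonom 1 e * lp (lfloor f') - f = - (lmonom 1 e * (f' - lp (lfloor f'))).
    by rewrite mulrBr /f' mulrA lmonomM mul1r subrr lmonom10 mul1r opprB.
  by apply: lboundN; apply: (lboundMle (@lbound_monom _ 1 e) (lfloorP f')).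
have [|p1 q1] := tr (-1) y1 s.+1; first by apply: lbound_le h1 _; lia.
have [|p2 q2] := tr (- k.+1%:Z) y2 s; first by apply: lbound_le h2 _; lia.
have [|p3 q3] := tr (- k.+1%:Z) y3 s; first by apply: lbound_le h3 _; lia.
exists (p1, p2, p3); split=> /=; first exact: q1.
- by apply: lbound_le q2 _; lia.
- by apply: lbound_le q3 _; lia.
Qed.

Definition scale3 (c : E) (y : E * E * E) := (c * y.1.1, c * y.1.2, c * y.2).

Lemma dual_ball (x : dual_box) : in_ball (scale3 u^-1 (dual_vec (dual_box_vec x))).
Proof.
have uV : lbound u^-1 (s%:Z - 1) by apply: lbound_le (lboundV ub u0) _; lia.
have x1 : lbound (lcst x.1.1) 0 by apply: lbound_cst.
have sz (z : 'rV[F]_k.+1) : lbound (lp (rVpoly z)) k%:Z.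
  by apply: lbound_le (proj1 (lbound_poly _ _) (size_rVpoly z)) _; lia.
have [g1 _] := g11P; have [g2 _] := g22P; have [g3 _] := g33P.
split; rewrite /scale3 /dual_vec /dual_box_vec /=.
- apply: (lboundMle uV (n := 0)); last lia.
  apply: lboundD; first apply: lboundD.
  + by apply: (lboundMle g1 x1).
  + by apply: (lboundMle g12b (sz x.1.2)); rewrite /M; lia.
  + by apply: (lboundMle g13b (sz x.2)); rewrite /M; lia.
- apply: (lboundMle uV (n := - k%:Z - 1)); last lia.
  apply: lboundD; first apply: lboundD.
  + by apply: (lboundMle g12b x1); rewrite /M; lia.
  + by apply: (lboundMle g2 (sz x.1.2)); rewrite /M; lia.
  + by apply: (lboundMle g23b (sz x.2)); rewrite /M; lia.
- apply: (lboundMle uV (n := - k%:Z - 1)); last lia.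
  apply: lboundD; first apply: lboundD.
  + by apply: (lboundMle g13b x1); rewrite /M; lia.
  + by apply: (lboundMle g23b (sz x.1.2)); rewrite /M; lia.
  + by apply: (lboundMle g3 (sz x.2)); rewrite /M; lia.
Qed.

(* Completes the square by a translation by the grid point closest to u^-1 times the
   dual vector. *)
Lemma gaussian_transform (x : dual_box) :
  gamma * psi (- (u^-1 * dform (dual_box_vec x) (dual_box_vec x)) (-1)) =
  \sum_(p : grid) psi (lres u (bform (grid_vec p) (grid_vec p))) *
     psi (2%:R * dot (grid_vec p) (dual_box_vec x) (-1)).
Proof.
set X := dual_box_vec x; set yx := scale3 u^-1 (dual_vec X).
have un : u != 0 by exact: ldeg_neq0 u0.
have [p0 pn] := truncation (dual_ball x); rewrite -/X -/yx in pn.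
rewrite /gamma mulr_suml (reindex_inj (addIr p0)) /=; apply: eq_bigr => p _.
rewrite -!psiD; congr psi; rewrite grid_vecD.
set y := grid_vec p; set r := grid_vec p0 - yx in pn.
have -> : y + grid_vec p0 = y + yx + r by rewrite /r -addrA [yx + _]addrC subrK.
have byx z : bform z yx = u^-1 * dot z X.
  rewrite -bform_dual bformC (bformC z) /yx /scale3 /bform /=; ring.
have yb : in_ball (y + yx).
  have [h1 h2 h3] := grid_ball p; have [h1' h2' h3'] := dual_ball x.
  by split; apply: lboundD.
rewrite lres_sqD (lres_negligible yb pn) (lres_negligible (negligible_ball pn) pn).
rewrite mulr0 !addr0 lres_sqD !byx.
have e1 z : lres u (u^-1 * z) = z (-1) by rewrite /lres mulrA divff// mul1r.
have e2 : dot yx X = u^-1 * dform X X.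
  by rewrite dform_dot /yx /scale3 /dot /=; ring.
by rewrite !e1 e2; ring.
Qed.

Definition integral_grid (p : grid) := [&& (rVpoly p.1.1)`_0 == 0,
  [forall j : 'I_k.+1, (rVpoly p.1.2)`_j == 0] & [forall j : 'I_k.+1, (rVpoly p.2)`_j == 0]].

Lemma dot_residue (p : grid) (x : dual_box) :
  dot (grid_vec p) (dual_box_vec x) (-1) = x.1.1 * (rVpoly p.1.1)`_0 +
    (rVpoly p.1.2 * rVpoly x.1.2)`_k + (rVpoly p.2 * rVpoly x.2)`_k.
Proof.
rewrite /dot /grid_vec /dual_box_vec /= [_ * lcst _]mulrC -!mulrA -!rmorphM.
rewrite !lcoefD lcoef_cstM.
have e1 := @lcoef_shift (-1) (rVpoly p.1.1) 0; rewrite addr0 in e1; rewrite e1.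
have e2 q := @lcoef_shift (- k.+1%:Z) q k; have e : - k.+1%:Z + k%:Z = -1 by lia.
by rewrite e in e2; rewrite !e2.
Qed.

Lemma sum_dual_box (p : grid) :
  \sum_(x : dual_box) psi (2%:R * dot (grid_vec p) (dual_box_vec x) (-1)) =
  if integral_grid p then #|{: dual_box}|%:R else 0.
Proof.
case: ifPn => [/and3P[/eqP p1 /forallP p2 /forallP p3]|np].
  rewrite -sum1_card natr_sum; apply: eq_bigr => x _; rewrite dot_residue p1 mulr0 add0r.
  have z (q r : A) : (forall j : 'I_k.+1, q`_j == 0) -> (q * r)`_k = 0.
    by move=> q0; rewrite coefM big1// => i _; rewrite (eqP (q0 i)) mul0r.
  by rewrite !z// addr0 mulr0 psi0.
have lamD (x y : dual_box) : 2%:R * dot (grid_vec p) (dual_box_vec (x + y)) (-1) =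
    2%:R * dot (grid_vec p) (dual_box_vec x) (-1) + 2%:R * dot (grid_vec p) (dual_box_vec y) (-1).
  by rewrite !dot_residue /= !linearD /= !mulrDr !coefD; ring.
have two := two_neq0 q_odd.
suff [l0 hl] : exists l0, psi (2%:R * dot (grid_vec p) (dual_box_vec l0) (-1)) != 1.
  exact: (@sum_char_eq0 _ (fun=> true)
    (fun x => 2%:R * dot (grid_vec p) (dual_box_vec x) (-1)) _ _ (addIr l0) (fun x => lamD x l0)).
(* The monomial of complementary degree k - j brings the nonzero coefficient of index j to index
   k. *)
have mono (q : A) (j : 'I_k.+1) : q`_j != 0 -> exists r : 'rV[F]_k.+1, psi (2%:R * (q * rVpoly r)`_k) != 1.
  move=> q0; have [t ht] := psi_scale_nt (mulf_neq0 two q0).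
  exists (poly_rV (t *: 'X^(k - j))); rewrite poly_rV_K; last first.
    by rewrite (leq_trans (size_scale_leq _ _))// size_polyXn ltnS leq_subr.
  rewrite -scalerAr coefZ coefMXn ltnNge leq_subr /= subKn; last by rewrite -ltnS.
  by rewrite mulrCA.
move: np; rewrite !negb_and => /or3P[p1|/forallPn[j /mono[r hr]]|/forallPn[j /mono[r hr]]].
- have [t ht] := psi_scale_nt (mulf_neq0 two p1); exists (t, 0, 0).
  by rewrite dot_residue /= !linear0 /= !mulr0 !coef0 !addr0 mulrCA.
- exists (0, r, 0).
  by rewrite dot_residue /= !linear0 /= !mulr0 !coef0 mul0r addr0 add0r.
- exists (0, 0, r).
  by rewrite dot_residue /= !linear0 /= !mulr0 !coef0 mul0r !add0r.
Qed.

(** Sum [gaussian_transform] over the dual box and exchange the sums; by orthogonality of characters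
    only the integral grid points survive. *)
Lemma poisson_summation :
  gamma * \sum_(x : dual_box) psi (- (u^-1 * dform (dual_box_vec x) (dual_box_vec x)) (-1)) =
  #|{: dual_box}|%:R * \sum_(p : grid | integral_grid p)
     psi (lres u (bform (grid_vec p) (grid_vec p))).
Proof.
rewrite mulr_sumr; under eq_bigr do rewrite gaussian_transform.
rewrite exchange_big /= mulr_sumr [RHS]big_mkcond /=; apply: eq_bigr => p _.
by rewrite -mulr_sumr sum_dual_box; case: ifP => _; rewrite ?mulr0// mulrC.
Qed.

(** The bounds of low and high add up to s + 1 in the first coordinate and to s in the others: high
    is the orthogonal of low for the residue pairing, and low lies inside it. *)
Definition low_grid (p : grid) := [&& (size (rVpoly p.1.1) <= uphalf s)%N,
  (size (rVpoly p.1.2) <= s./2)%N & (size (rVpoly p.2) <= s./2)%N].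
Definition high_grid (p : grid) := [&& (size (rVpoly p.1.1) <= s./2.+1)%N,
  (size (rVpoly p.1.2) <= uphalf s)%N & (size (rVpoly p.2) <= uphalf s)%N].

Lemma lres_small_pair (p1 p2 q1 q2 : nat) y z :
  (p1 + q1 <= s.+1)%N -> (p2 + q2 <= s)%N -> (p1 + q2 <= s.+1)%N -> (p2 + q1 <= s.+1)%N ->
  lbound y.1.1 (p1%:Z - 2) -> lbound y.1.2 (p2%:Z - k%:Z - 2) -> lbound y.2 (p2%:Z - k%:Z - 2) ->
  lbound z.1.1 (q1%:Z - 2) -> lbound z.1.2 (q2%:Z - k%:Z - 2) -> lbound z.2 (q2%:Z - k%:Z - 2) ->
  lres u (bform y z) = 0.
Proof.
move=> h1 h2 h3 h4 y1 y2 y3 z1 z2 z3.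
rewrite (_ : bform y z = y.1.1 * (1 * z.1.1) + y.1.1 * (w1 * z.1.2) + y.1.1 * (w2 * z.2) +
  y.1.2 * (w1 * z.1.1) + y.1.2 * (b22 * z.1.2) + y.1.2 * (b23 * z.2) +
  y.2 * (w2 * z.1.1) + y.2 * (b23 * z.1.2) + y.2 * (b33 * z.2)); last by rewrite /bform; ring.
rewrite !lresDr.
rewrite (lres_term y1 (@lbound1 F) z1) ?(lres_term y1 w1b z2) ?(lres_term y1 w2b z3)
  ?(lres_term y2 w1b z1) ?(lres_term y2 b22b z2) ?(lres_term y2 b23b z3)
  ?(lres_term y3 w2b z1) ?(lres_term y3 b23b z2) ?(lres_term y3 b33b z3) ?addr0//;
  rewrite /M; move: h1 h2 h3 h4; clear; lia.
Qed.

Lemma grid_sizes (p : grid) (n1 n2 : nat) : (size (rVpoly p.1.1) <= n1)%N ->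
  (size (rVpoly p.1.2) <= n2)%N -> (size (rVpoly p.2) <= n2)%N ->
  [/\ lbound (grid_vec p).1.1 (n1%:Z - 2), lbound (grid_vec p).1.2 (n2%:Z - k%:Z - 2) &
     lbound (grid_vec p).2 (n2%:Z - k%:Z - 2)].
Proof.
move=> h1 h2 h3; split; rewrite /grid_vec /=.
- by apply: lbound_le (lbound_shift h1) _; lia.
- by apply: lbound_le (lbound_shift h2) _; lia.
- by apply: lbound_le (lbound_shift h3) _; lia.
Qed.

Lemma lres_low p : low_grid p -> lres u (bform (grid_vec p) (grid_vec p)) = 0.
Proof.
case/and3P => h1 h2 h3; have [y1 y2 y3] := grid_sizes h1 h2 h3.
by apply: (lres_small_pair _ _ _ _ y1 y2 y3 y1 y2 y3); clear; lia.
Qed.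

Lemma lres_high_low p r : high_grid p -> low_grid r ->
  lres u (bform (grid_vec p) (grid_vec r)) = 0.
Proof.
case/and3P => h1 h2 h3; have [y1 y2 y3] := grid_sizes h1 h2 h3.
case/and3P => h1' h2' h3'; have [z1 z2 z3] := grid_sizes h1' h2' h3'.
by apply: (lres_small_pair _ _ _ _ y1 y2 y3 z1 z2 z3); clear; lia.
Qed.

Definition lead_form (y : E * E * E) : E :=
  y.1.1 ^+ 2 + lmonom c2 M * y.1.2 ^+ 2 + lmonom c3 M * y.2 ^+ 2.

Lemma lres_high p : high_grid p ->
  lres u (bform (grid_vec p) (grid_vec p)) = lres u (lead_form (grid_vec p)).
Proof.
case/and3P => h1 h2 h3; have [] := grid_sizes h1 h2 h3.
move: (grid_vec p) => y y1 y2 y3.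
have tail (b : E) (c : F) : lbound b M -> b M = c -> lbound (b - lmonom c M) (M - 1).
  move=> bb bc; apply: lbound_pred; last by rewrite lcoefB lcoef_monom eqxx bc subrr.
  by apply: lboundB => //; exact: lbound_monom.
apply/eqP; rewrite -subr_eq0 -lresBr.
rewrite (_ : bform y y - lead_form y = y.1.1 * (w1 * y.1.2) + y.1.1 * (w2 * y.2) +
  y.1.2 * (w1 * y.1.1) + y.1.2 * ((b22 - lmonom c2 M) * y.1.2) + y.1.2 * (b23 * y.2) +
  y.2 * (w2 * y.1.1) + y.2 * (b23 * y.1.2) + y.2 * ((b33 - lmonom c3 M) * y.2)); last first.
  by rewrite /bform /lead_form; ring.
rewrite !lresDr.
rewrite (lres_term y1 w1b y2) ?(lres_term y1 w2b y3)
  ?(lres_term y2 w1b y1) ?(lres_term y2 (tail _ _ b22b b22c) y2) ?(lres_term y2 b23b y3)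
  ?(lres_term y3 w2b y1) ?(lres_term y3 b23b y2) ?(lres_term y3 (tail _ _ b33b b33c) y3) ?addr0//;
  rewrite /M; clear; lia.
Qed.

Lemma lres_mono (e n : int) (f : E) : lbound f n -> e + n = s%:Z - 2 ->
  lres u (lmonom 1 e * f) = u (1 - s%:Z) * f n.
Proof.
move=> fn en; have mf := lboundM (@lbound_monom _ 1 e) fn.
rewrite (lres_top ub mf); last by rewrite en; clear; lia.
by rewrite lcoef_monomM mul1r; congr (_ * f _); clear; lia.
Qed.

(** l is a monomial in a coordinate where d is longest, of the degree that brings the leading
    coefficient of d into the residue. Ties go against the first coordinate; otherwise l might fail
    to be low for s even. *)
Lemma grid_nondeg d : d != 0 -> exists l,
  lres u (bform (grid_vec d) (grid_vec l)) != 0 /\ (~~ high_grid d -> low_grid l).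
Proof.
move=> d0; set n1 := size (rVpoly d.1.1); set n2 := size (rVpoly d.1.2).
set n3 := size (rVpoly d.2).
have [b1 b2 b3] : [/\ (n1 <= s.+1)%N, (n2 <= s)%N & (n3 <= s)%N] by split; exact: size_rVpoly.
have Y1 : lbound (grid_vec d).1.1 (n1%:Z - 2).
  by rewrite /grid_vec /=; apply: lbound_le (lbound_shift (leqnn n1)) _; clear; lia.
have Y2 : lbound (grid_vec d).1.2 (n2%:Z - k%:Z - 2).
  by rewrite /grid_vec /=; apply: lbound_le (lbound_shift (leqnn n2)) _; clear; lia.
have Y3 : lbound (grid_vec d).2 (n3%:Z - k%:Z - 2).
  by rewrite /grid_vec /=; apply: lbound_le (lbound_shift (leqnn n3)) _; clear; lia.
have top (e : int) (q : A) : (0 < size q)%N -> (lmonom 1 e * lp q) (e + (size q).-1%:Z) != 0.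
  by move=> q0; rewrite lcoef_shift -lead_coefE lead_coef_eq0 -size_poly_gt0.
have mono (e : int) (j : nat) : lmonom 1 e * lp 'X^j = lmonom 1 (e + j%:Z).
  by rewrite -lmonomX lmonomM mul1r.
have hl : high_grid d = [&& (n1 <= s./2.+1)%N, (n2 <= uphalf s)%N & (n3 <= uphalf s)%N] by [].
have n0 : (0 < n1)%N || (0 < n2)%N || (0 < n3)%N.
  apply: contraNT d0; rewrite !negb_or -!leqNgt !leqn0 !size_poly_eq0 => /andP[/andP[/eqP z1 /eqP z2] /eqP z3].
  have r0 n (z : 'rV[F]_n) : rVpoly z = 0 -> z = 0.
    by move=> z0; apply: (can_inj rVpolyK); rewrite z0 linear0.
  by apply/eqP; case: d z1 z2 z3 {n1 n2 n3 b1 b2 b3 Y1 Y2 Y3 hl} => -[x1 x2] x3 /= /r0-> /r0-> /r0->.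
have [/andP[n12 n13]|nA] := boolP ((n2 < n1)%N && (n3 < n1)%N).
  have sX : (size ('X^(s - n1.-1) : A) <= s.+1)%N by rewrite size_polyXn; clear; lia.
  exists (poly_rV 'X^(s - n1.-1), 0, 0); split; last first.
    rewrite hl /low_grid /= poly_rV_K// !linear0 size_poly0 size_polyXn /= !andbT.
    by move: n12 n13 b1; clear; lia.
  rewrite bformC {2}/grid_vec /bform /= poly_rV_K// !linear0 !rmorph0 !mulr0 !mul0r !addr0 mono.
  rewrite (@lres_mono _ (n1%:Z - 2)); first last.
  - by move: n12 b1; clear; lia.
  - apply: lboundD; first apply: lboundD => //.
      by apply: (lboundMle w1b Y2); move: n12; clear; lia.
    by apply: (lboundMle w2b Y3); move: n13; clear; lia.
  rewrite mulf_neq0// !lcoefD.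
  rewrite (lcoef_top0 (lboundM w1b Y2)) ?(lcoef_top0 (lboundM w2b Y3)) ?addr0;
    try by move: n12 n13; clear; lia.
  have n1p : (0 < n1)%N by exact: leq_ltn_trans n12.
  rewrite (_ : n1%:Z - 2 = -1 + n1.-1%:Z); first exact: top n1p.
  by move: n1p; clear; lia.
have [/andP[/andP[n21 n23] n20]|nB] := boolP ((n1 <= n2)%N && (n3 <= n2)%N && (0 < n2)%N).
  have sX : (size ('X^(s - n2) : A) <= s)%N by rewrite size_polyXn; move: n20 b2; clear; lia.
  exists (0, poly_rV 'X^(s - n2), 0); split; last first.
    rewrite hl /low_grid /= poly_rV_K// !linear0 size_poly0 size_polyXn /= !andbT.
    by move: n21 n23 n20 b2; clear; lia.
  rewrite bformC {2}/grid_vec /bform /= poly_rV_K// !linear0 !rmorph0 !mulr0 !mul0r !addr0 !add0r mono.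
  have r1 : lbound (w1 * (grid_vec d).1.1) (n2%:Z + k%:Z - 2).
    by apply: (lboundMle w1b Y1); move: n21; clear; lia.
  have r3 : lbound (b23 * (grid_vec d).2) (n2%:Z + k%:Z - 2).
    by apply: (lboundMle b23b Y3); rewrite /M; move: n23; clear; lia.
  have r2 := lboundM b22b Y2.
  rewrite (@lres_mono _ (n2%:Z + k%:Z - 1)); first last.
  - by move: n20 b2; clear; lia.
  - apply: lboundD; first apply: lboundD.
    + by apply: lbound_le r1 _; clear; lia.
    + by apply: lbound_le r2 _; rewrite /M; clear; lia.
    + by apply: lbound_le r3 _; clear; lia.
  rewrite mulf_neq0// !lcoefD (lcoef_top0 r1) ?(lcoef_top0 r3) ?addr0 ?add0r;
    try by clear; lia.
  rewrite (_ : n2%:Z + k%:Z - 1 = M + (n2%:Z - k%:Z - 2)); last by rewrite /M; clear; lia.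
  rewrite (lcoefM_top b22b Y2) b22c mulf_neq0//.
  rewrite (_ : n2%:Z - k%:Z - 2 = - k.+1%:Z + n2.-1%:Z); first exact: top n20.
  by move: n20; clear; lia.
have [n31 n32 n30] : [/\ (n1 <= n3)%N, (n2 <= n3)%N & (0 < n3)%N].
  by move: n0 nA nB; clear; clearbody n1 n2 n3 => *; split; lia.
have sX : (size ('X^(s - n3) : A) <= s)%N by rewrite size_polyXn; move: n30 b3; clear; lia.
exists (0, 0, poly_rV 'X^(s - n3)); split; last first.
  rewrite hl /low_grid /= poly_rV_K// !linear0 size_poly0 size_polyXn /=.
  by move: n31 n32 n30 b3; clear; lia.
rewrite bformC {2}/grid_vec /bform /= poly_rV_K// !linear0 !rmorph0 !mulr0 !mul0r !add0r mono.
have r1 : lbound (w2 * (grid_vec d).1.1) (n3%:Z + k%:Z - 2).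
  by apply: (lboundMle w2b Y1); move: n31; clear; lia.
have r2 : lbound (b23 * (grid_vec d).1.2) (n3%:Z + k%:Z - 2).
  by apply: (lboundMle b23b Y2); rewrite /M; move: n32; clear; lia.
have r3 := lboundM b33b Y3.
rewrite (@lres_mono _ (n3%:Z + k%:Z - 1)); first last.
- by move: n30 b3; clear; lia.
- apply: lboundD; first apply: lboundD.
  + by apply: lbound_le r1 _; clear; lia.
  + by apply: lbound_le r2 _; clear; lia.
  + by apply: lbound_le r3 _; rewrite /M; clear; lia.
rewrite mulf_neq0// !lcoefD (lcoef_top0 r1) ?(lcoef_top0 r2) ?addr0 ?add0r;
  try by clear; lia.
rewrite (_ : n3%:Z + k%:Z - 1 = M + (n3%:Z - k%:Z - 2)); last by rewrite /M; clear; lia.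
rewrite (lcoefM_top b33b Y3) b33c mulf_neq0//.
rewrite (_ : n3%:Z - k%:Z - 2 = - k.+1%:Z + n3.-1%:Z); first exact: top n30.
by move: n30; clear; lia.
Qed.

Lemma sum_pairing d (P : pred grid) :
  (forall l0 t x, P l0 -> P (x + (\row_j (t * l0.1.1 0 j), \row_j (t * l0.1.2 0 j),
       \row_j (t * l0.2 0 j))) = P x) ->
  (exists2 l, P l & lres u (bform (grid_vec d) (grid_vec l)) != 0) ->
  \sum_(l | P l) psi (2%:R * lres u (bform (grid_vec d) (grid_vec l))) = 0.
Proof.
move=> Pst [l Pl l0]; have [t ht] := psi_scale_nt (mulf_neq0 (two_neq0 q_odd) l0).
pose l' : grid := (\row_j (t * l.1.1 0 j), \row_j (t * l.1.2 0 j), \row_j (t * l.2 0 j)).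
have scE n (z : 'rV[F]_n) : rVpoly (\row_j (t * z 0 j)) = t%:P * rVpoly z.
  rewrite mul_polyC -linearZ /=; congr rVpoly; apply/rowP => j; rewrite !mxE.
  by [].
apply: (@sum_char_eq0 _ P _ _ (2%:R * lres u (bform (grid_vec d) (grid_vec l'))) (addIr l')) => [x|x|].
- by rewrite grid_vecD !(bformC (grid_vec d)) bformDl lresDr mulrDr.
- exact: Pst.
- rewrite (_ : bform (grid_vec d) (grid_vec l') = lcst t * bform (grid_vec d) (grid_vec l)).
    by rewrite lresZr mulrCA.
  by rewrite /bform /grid_vec /= !scE !rmorphM /= -/(lcst t); ring.
Qed.

(** As for [gauss2], multiply by the conjugate sum; by nondegeneracy only the difference d = 0
    contributes. *)
Lemma gamma_neq0 : gamma != 0.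
Proof.
suff : gamma * \sum_(p : grid) psi (- lres u (bform (grid_vec p) (grid_vec p))) != 0.
  by rewrite mulf_eq0 negb_or => /andP[].
rewrite mulr_sumr.
have -> : \sum_(p : grid) gamma * psi (- lres u (bform (grid_vec p) (grid_vec p))) =
  \sum_(p : grid) \sum_(d : grid) psi (lres u (bform (grid_vec d) (grid_vec d))) *
     psi (2%:R * lres u (bform (grid_vec d) (grid_vec p))).
  apply: eq_bigr => p _; rewrite /gamma mulr_suml (reindex_inj (addIr p)) /=.
  apply: eq_bigr => d _; rewrite -!psiD; congr psi.
  by rewrite grid_vecD lres_sqD; ring.
rewrite exchange_big /= (bigD1 (0 : grid))//= [X in _ + X]big1 => [|d d0].
  have g0 : grid_vec 0 = 0 by rewrite /grid_vec /= !linear0 !rmorph0 !mulr0.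
  have b0 z : bform 0 z = 0 by rewrite /bform /=; ring.
  rewrite addr0 g0; under eq_bigr do rewrite !b0 !lres0r mulr0 !psi0 mulr1.
  rewrite sumr_const pnatr_eq0 -lt0n; apply/card_gt0P; exists (0 : grid); exact: isT.
rewrite -mulr_sumr sum_pairing ?mulr0//.
by have [l [hl _]] := grid_nondeg d0; exists l.
Qed.

(* Averaging over the translations by low_grid kills the terms outside its
   orthogonal, on which only the leading terms of the form contribute. *)
Lemma gamma_high :
  gamma = \sum_(p | high_grid p) psi (lres u (lead_form (grid_vec p))).
Proof.
have low0 : low_grid 0 by rewrite /low_grid /= !linear0 size_poly0.
have lowD x y : low_grid x -> low_grid y -> low_grid (x + y).
  move=> /and3P[h1 h2 h3] /and3P[h1' h2' h3']; rewrite /low_grid /= !linearD /=.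
  by rewrite !(leq_trans (size_polyD _ _)) ?geq_max ?h1 ?h2 ?h3.
have lowN x : low_grid (- x) = low_grid x by rewrite /low_grid /= !linearN /= !size_polyN.
have card0 : #|[pred l | low_grid l]|%:R != 0 :> algC.
  by rewrite pnatr_eq0 -lt0n; apply/card_gt0P; exists (0 : grid).
apply: (mulfI card0).
transitivity (\sum_(l | low_grid l) gamma); first by rewrite sumr_const mulr_natl.
have -> : \sum_(l | low_grid l) gamma = \sum_(p : grid) \sum_(l | low_grid l)
   psi (lres u (bform (grid_vec p) (grid_vec p))) *
     psi (2%:R * lres u (bform (grid_vec p) (grid_vec l))).
  rewrite [RHS]exchange_big /=; apply: eq_bigr => l ll.
  rewrite /gamma (reindex_inj (addIr l)) /=; apply: eq_bigr => p _.
  by rewrite -psiD grid_vecD lres_sqD (lres_low ll) addr0.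
rewrite [in RHS]big_mkcond mulr_sumr /=; apply: eq_bigr => p _.
rewrite -mulr_sumr; case: ifPn => hp.
  rewrite -(lres_high hp) mulrC; congr (_ * _).
  under eq_bigr => l ll do rewrite (lres_high_low hp ll) mulr0 psi0.
  by rewrite sumr_const.
rewrite mulr0 sum_pairing ?mulr0// => [l0 t x ll|].
  set y : grid := (_, _, _).
  have ly : low_grid y.
    have scE n (z : 'rV[F]_n) : rVpoly (\row_j (t * z 0 j)) = t%:P * rVpoly z.
      by rewrite mul_polyC -linearZ /=; congr rVpoly; apply/rowP => j; rewrite !mxE.
    move: ll => /and3P[h1 h2 h3]; rewrite /low_grid /y /= !scE !mul_polyC.
    by rewrite !(leq_trans (size_scale_leq _ _)).
  apply/idP/idP => h; last exact: lowD.
  by rewrite -[x](addrK y); apply: lowD => //; rewrite lowN.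
have p0 : p != 0.
  by apply: contraNneq hp => ->; rewrite /high_grid /= !linear0 size_poly0.
by have [l [hl lo]] := grid_nondeg p0; exists l => //; apply: lo.
Qed.

End Level.
End Form.
End Poisson.

(** The i-th element of a fibre of f goes to the i-th element of the fibre of g over the same
    point. *)
Lemma count_bijection (I : finType) (T : eqType) (f g : I -> T) :
  (forall a, #|[pred x | f x == a]| = #|[pred x | g x == a]|) ->
  exists2 h : I -> I, bijective h & forall x, g (h x) = f x.
Proof.
move=> fg.
pose Lf a := enum [pred x | f x == a]; pose Lg a := enum [pred x | g x == a].
have sz a : size (Lf a) = size (Lg a) by rewrite /Lf /Lg -[LHS]cardE -[RHS]cardE fg.
pose h x := nth x (Lg (f x)) (index x (Lf (f x))).
have idx x : (index x (Lf (f x)) < size (Lg (f x)))%N.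
  by rewrite -sz index_mem /Lf mem_enum inE eqxx.
have hP x : g (h x) = f x.
  by have := mem_nth x (idx x); rewrite -/(h x) /Lg mem_enum inE => /eqP.
exists h => //; apply: injF_bij => x y xy.
have fxy : f x = f y by rewrite -hP xy hP.
have : index x (Lf (f x)) = index y (Lf (f x)).
  move: xy; rewrite /h -fxy (set_nth_default x y); last by rewrite fxy idx.
  move/eqP; rewrite nth_uniq ?enum_uniq//; first by move/eqP.
  by rewrite fxy idx.
have mx : x \in Lf (f x) by rewrite /Lf mem_enum inE.
have my : y \in Lf (f x) by rewrite /Lf mem_enum inE fxy.
by move=> e; rewrite -(nth_index x mx) e nth_index.
Qed.

(** * Fourier inversion for finitely many series *)

Section Fourier.
Variable F : finFieldType.
Local Notation E := (laurent F).
Variable psi : F -> algC.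
Hypothesis psi0 : psi 0 = 1.
Hypothesis psiD : {morph psi : x y / x + y >-> x * y}.
Hypothesis psi_nt : exists x, psi x != 1.
Variables (I : finType) (f g : I -> E).
Hypothesis fb : forall x, lbound (f x) 0.
Hypothesis gb : forall x, lbound (g x) 0.
Hypothesis fg : forall v, \sum_x psi (lres v (f x)) = \sum_x psi (lres v (g x)).

Let near n (a b : E) := [forall i : 'I_n, a (- i%:Z) == b (- i%:Z)].

(** The monomial t^(i-1) reads the coefficient of t^-i, so the q^n frequencies spanned by these
    monomials detect agreement with a on n coefficients. *)
Let nearP n (h : I -> E) (a : E) :
  \sum_(c : {ffun 'I_n -> F}) psi (- lres (\sum_i lmonom (c i) (i%:Z - 1)) a) *
     \sum_x psi (lres (\sum_i lmonom (c i) (i%:Z - 1)) (h x)) =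
  #|F|%:R ^+ n * #|[pred x | near n (h x) a]|%:R.
Proof.
under eq_bigr => c _ do rewrite mulr_sumr.
rewrite exchange_big /= -[#|[pred x | _]|]sum1_card natr_sum mulr_sumr [RHS]big_mkcond /=.
apply: eq_bigr => x _.
have term (c : {ffun 'I_n -> F}) : psi (- lres (\sum_i lmonom (c i) (i%:Z - 1)) a) *
    psi (lres (\sum_i lmonom (c i) (i%:Z - 1)) (h x)) =
  \prod_i psi (c i * (h x (- i%:Z) - a (- i%:Z))).
  rewrite -psiD addrC -lresBr -(psi_sum psi0 psiD); congr psi.
  rewrite /lres mulr_suml lcoef_sum; apply: eq_bigr => i _.
  by rewrite lcoef_monomM lcoefB; congr (_ * (h x _ - a _)); lia.
under eq_bigr do rewrite term.
rewrite -(bigA_distr_bigA (fun (i : 'I_n) y => psi (y * (h x (- i%:Z) - a (- i%:Z))))) /=.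
under eq_bigr => i _ do under eq_bigr do rewrite mulrC.
under eq_bigr => i _ do rewrite (sum_psi psi0 psiD psi_nt).
rewrite inE /near; case: ifPn => [/forallP hn|/forallPn[i hi]].
  under eq_bigr => i _ do rewrite subr_eq0 hn.
  by rewrite prodr_const card_ord mulr1.
by rewrite (bigD1 i)//= subr_eq0 (negPf hi) mul0r.
Qed.

Let count_near n a : #|[pred x | near n (f x) a]| = #|[pred x | near n (g x) a]|.
Proof.
have q0 : #|F|%:R ^+ n != 0 :> algC.
  by rewrite expf_neq0// pnatr_eq0 -lt0n (ltn_trans _ (finNzRing_gt1 F)).
apply/eqP; rewrite -(eqr_nat algC) -(inj_eq (mulfI q0)) -!nearP.
by under eq_bigr do rewrite fg.
Qed.

(** As I is finite, one number of coefficients distinguishes a from all values different from it. *)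
Let separate (h : I -> E) (a : E) : (forall x, lbound (h x) 0) -> lbound a 0 ->
  exists n0, forall n, (n0 <= n)%N -> forall x, near n (h x) a = (h x == a).
Proof.
move=> hb ab.
have sep x : exists n0, forall n, (n0 <= n)%N -> near n (h x) a = (h x == a).
  have [->|ne] := eqVneq (h x) a.
    by exists 0%N => n _; apply/forallP => i.
  have [j hj] : exists j : nat, h x (- j%:Z) != a (- j%:Z).
    apply: contrapT => /forallNP e; case/eqP: ne; apply/laurentP => m.
    have [m0|m0] := ltP 0 m; first by rewrite hb// ab.
    have /negP := e `|m|%N; rewrite negbK (_ : - `|m|%N%:Z = m); last by lia.
    by move/eqP.
  exists j.+1 => n jn; apply/negbTE/forallPn; exists (Ordinal jn).
  exact: hj.
pose n0 x := projT1 (cid (sep x)).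
exists (\max_x n0 x)%N => n nn x; apply: (projT2 (cid (sep x))).
by apply: leq_trans nn; apply: leq_bigmax.
Qed.

Lemma fourier_count a : #|[pred x | f x == a]| = #|[pred x | g x == a]|.
Proof.
have [ab|nab] := EM (lbound a 0); last first.
  have no (h : I -> E) : (forall x, lbound (h x) 0) -> #|[pred x | h x == a]| = 0%N.
    by move=> hb; apply: eq_card0 => x; rewrite inE; apply/eqP => e; apply: nab; rewrite -e.
  by rewrite !no.
have [n1 h1] := separate fb ab; have [n2 h2] := separate gb ab.
pose n := maxn n1 n2; have := count_near n a.
rewrite (eq_card (B := [pred x | f x == a])); last first.
  by move=> x; rewrite !inE h1// leq_maxl.
rewrite [in RHS](eq_card (B := [pred x | g x == a]))//.
by move=> x; rewrite !inE h2// leq_maxr.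
Qed.

End Fourier.

(** * Lattice vectors as integral grid points *)

Section Elongated.
Variable F : finFieldType.
Hypothesis q_odd : odd #|F|.
Local Notation A := {poly F}.
Local Notation E := (laurent F).
Local Notation lp := (@laurent_of_poly F).

(* Gram coefficients of a reduced basis with successive minima (0, 2k+1, 2k+1) *)
Record elongated (L : lmodType A) (B : L -> L -> E) (v1 v2 v3 : L) (k : nat) (c2 c3 : F) :=
  Elongated {
    el_one : B v1 v1 = 1;
    el_12 : lbound (B v1 v2) (-1);
    el_13 : lbound (B v1 v3) (-1);
    el_22 : lbound (B v2 v2) (2 * k + 1)%N%:Z;
    el_c22 : B v2 v2 (2 * k + 1)%N%:Z = c2;
    el_c2 : c2 != 0;
    el_33 : lbound (B v3 v3) (2 * k + 1)%N%:Z;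
    el_c33 : B v3 v3 (2 * k + 1)%N%:Z = c3;
    el_c3 : c3 != 0;
    el_23 : lbound (B v2 v3) ((2 * k + 1)%N%:Z - 1) }.

Definition lp3 (p : A * A * A) : E * E * E := (lp p.1.1, lp p.1.2, lp p.2).

Section One.
Variables (L : lmodType A) (B : L -> L -> E).
Hypothesis Bbil : bilinear_form B.
Variables (v1 v2 v3 : L) (k : nat) (c2 c3 : F).
Hypothesis vbas : basis3 v1 v2 v3.
Hypothesis vani : anisotropic B v1 v2 v3.
Hypothesis vel : elongated B v1 v2 v3 k c2 c3.

Definition gram_form := bform (B v1 v2) (B v1 v3) (B v2 v2) (B v2 v3) (B v3 v3).
Definition dual_form := dform (B v1 v2) (B v1 v3) (B v2 v2) (B v2 v3) (B v3 v3).

Lemma gram_formE p r : B (comb3 v1 v2 v3 p) (comb3 v1 v2 v3 r) = gram_form (lp3 p) (lp3 r).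
Proof.
rewrite /gram_form /bform /comb3 /= !(bilE Bbil) (el_one vel).
by rewrite (bilC Bbil v2 v1) (bilC Bbil v3 v1) (bilC Bbil v3 v2); ring.
Qed.

Lemma elongated_reduced : reduced3 B v1 v2 v3 0 (2 * k + 1)%N%:Z (2 * k + 1)%N%:Z.
Proof.
split.
- by rewrite (el_one vel) lcoef1 oner_eq0; split=> //; exact: lbound1.
- by rewrite (el_c22 vel); split; [exact: el_22 vel|exact: el_c2 vel].
- by rewrite (el_c33 vel); split; [exact: el_33 vel|exact: el_c3 vel].
- by rewrite lexx andbT.
- split; [exact: (el_12 vel)|exact: (el_13 vel)|exact: (el_23 vel)].
Qed.

Section Level.
Variable s : nat.
Local Notation grid := (grid F s).

Lemma lfloor_shift (K : nat) (p : A) : (forall j, (j < K)%N -> p`_j = 0) ->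
  lp (lfloor (lmonom 1 (- K%:Z) * lp p)) = lmonom 1 (- K%:Z) * lp p.
Proof.
move=> p0; apply/laurentP => n; have [n0|n0] := ltP n 0; last first.
  by rewrite (_ : n = `|n|%N%:Z) ?lcoef_poly ?coef_lfloor//; lia.
rewrite lcoef_poly_neg// lcoef_monomM mul1r; have [m0|m0] := ltP (n - - K%:Z) 0.
  by rewrite lcoef_poly_neg.
by rewrite (_ : n - - K%:Z = `|n - - K%:Z|%N%:Z) ?lcoef_poly ?p0//; lia.
Qed.

(** At integral points the coordinates already are polynomials, and [lfloor] only changes their
    type. *)
Definition grid_poly (p : grid) : A * A * A :=
  (lfloor (grid_vec k p).1.1, lfloor (grid_vec k p).1.2, lfloor (grid_vec k p).2).

Lemma grid_polyK (p : grid) : integral_grid k p -> lp3 (grid_poly p) = grid_vec k p.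
Proof.
case/and3P => /eqP h1 /forallP h2 /forallP h3; rewrite /lp3 /grid_poly /=.
rewrite !lfloor_shift//.
- by move=> j; rewrite ltnS leqn0 => /eqP->.
- by move=> j jk; exact: (eqP (h3 (Ordinal jk))).
- by move=> j jk; exact: (eqP (h2 (Ordinal jk))).
Qed.

Lemma grid_vec_inj : injective (@grid_vec F k s).
Proof.
have mi e (p q : A) : lmonom 1 e * lp p = lmonom 1 e * lp q -> p = q.
  move=> /(mulfI (lmonom_neq0 e (oner_neq0 F))) e1; apply/eqP.
  by rewrite -subr_eq0 -laurent_of_poly_eq0 rmorphB subr_eq0; apply/eqP.
move=> [[x y] z] [[x' y'] z'] e.
have e1 := mi _ _ _ (congr1 (fun t : E * E * E => t.1.1) e).
have e2 := mi _ _ _ (congr1 (fun t : E * E * E => t.1.2) e).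
have e3 := mi _ _ _ (congr1 (fun t : E * E * E => t.2) e).
by congr (_, _, _); apply: (can_inj rVpolyK).
Qed.

Definition grid_lattice (i : {p : grid | integral_grid k p}) : L :=
  comb3 v1 v2 v3 (grid_poly (val i)).

Lemma grid_lattice_inj : injective grid_lattice.
Proof.
move=> i j /((basis3P _ _ _).1 vbas).1 e; apply/val_inj/grid_vec_inj.
by rewrite -(grid_polyK (valP i)) -(grid_polyK (valP j)) e.
Qed.

Lemma grid_lattice_value i : B (grid_lattice i) (grid_lattice i) =
  gram_form (grid_vec k (val i)) (grid_vec k (val i)).
Proof. by rewrite /grid_lattice gram_formE grid_polyK//; exact: valP. Qed.

(** The integral grid points have degree at most s-1 in the first coordinate and s-k-2 in the
    others. In a reduced basis these are the bounds equivalent to value degree at most 2s-2; the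
    subtraction in [rad2] truncates to 0 when s <= k. *)
Let rad1 : radius (2 * s%:Z - 2) 0 = s.
Proof. by rewrite /radius; case: ifPn => h; lia. Qed.
Let rad2 : radius (2 * s%:Z - 2) (2 * k + 1)%N%:Z = (s - k.+1)%N.
Proof. by rewrite /radius; case: ifPn => h; lia. Qed.

Let radP p := reduced_radius q_odd Bbil vbas vani p (2 * s%:Z - 2) elongated_reduced.

Lemma grid_lattice_bound i : lbound (B (grid_lattice i) (grid_lattice i)) (2 * s%:Z - 2).
Proof.
apply/radP; rewrite rad1 rad2 /grid_poly /=.
have sz n (z : 'rV[F]_n) : (size (rVpoly z) <= n)%N by exact: size_poly.
have sh (e : int) (z : 'rV[F]_s) (n : nat) : e + s%:Z <= n%:Z ->
    (size (lfloor (lmonom 1 e * lp (rVpoly z))%R) <= n)%N.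
  move=> en; apply: size_lfloor.
  apply: (lboundMle (@lbound_monom _ 1 e) (proj1 (lbound_poly _ _) (sz _ z))); lia.
split; [|by apply: sh; lia|by apply: sh; lia].
apply: size_lfloor.
apply: (lboundMle (@lbound_monom _ 1 (-1)) (proj1 (lbound_poly _ _) (sz _ (val i).1.1))); lia.
Qed.

Lemma grid_lattice_surj x : lbound (B x x) (2 * s%:Z - 2) -> exists i, grid_lattice i = x.
Proof.
have [p <-] := ((basis3P _ _ _).1 vbas).2 x => /radP[]; rewrite rad1 rad2 => h1 h2 h3.
pose r : grid := (poly_rV (p.1.1 * 'X), poly_rV (p.1.2 * 'X^(k.+1)), poly_rV (p.2 * 'X^(k.+1))).
have sX (q : A) K n : (size q <= n - K)%N -> (size (q * 'X^K)%R <= n)%N.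
  have [->|q0] := eqVneq q 0; first by rewrite mul0r size_poly0.
  rewrite size_mulXn//; move: q0; rewrite -size_poly_gt0; move: (size q) => t; lia.
have s1 : (size (p.1.1 * 'X)%R <= s.+1)%N by rewrite -['X]expr1; apply: sX; rewrite subn1.
have ri : integral_grid k r.
  rewrite /integral_grid /r !poly_rV_K ?sX// coefMX eqxx.
  by apply/and3P; split=> //; apply/forallP => j; rewrite coefMXn ltn_ord.
have vr : grid_vec k r = lp3 p.
  have sh K (q : A) : lmonom 1 (- K%:Z) * lp (q * 'X^K) = lp q.
    by rewrite rmorphM /= -lmonomX mulrCA lmonomM mul1r addNr lmonom10 mulr1.
  by rewrite /grid_vec /lp3 /= !poly_rV_K ?sX// !sh.
exists (exist _ r ri); rewrite /grid_lattice /=; congr comb3.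
have fl (q : A) : lfloor (lp q) = q.
  by apply/polyP => i; rewrite coef_lfloor lcoef_poly.
by rewrite /grid_poly vr /lp3 /= !fl -!surjective_pairing.
Qed.

Lemma sum_integral_grid (f : E -> algC) :
  \sum_(p : grid | integral_grid k p) f (gram_form (grid_vec k p) (grid_vec k p)) =
  \sum_i f (B (grid_lattice i) (grid_lattice i)).
Proof.
rewrite (reindex_omap (val : {p : grid | integral_grid k p} -> grid) insub); last first.
  by move=> p ip; rewrite insubT.
apply: eq_big => [i|i _]; last by rewrite grid_lattice_value.
by rewrite valK eqxx andbT; exact: (valP i).
Qed.

End Level.
End One.
End Elongated.

Section ElongatedPair.
Variable F : finFieldType.
Hypothesis q_odd : odd #|F|.
Local Notation A := {poly F}.
Local Notation E := (laurent F).
Local Notation lp := (@laurent_of_poly F).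

Lemma dual_form_bound (L : lmodType A) (B : L -> L -> E) v1 v2 v3 k c2 c3 (x : dual_box F k) :
  elongated B v1 v2 v3 k c2 c3 ->
  lbound (dual_form B v1 v2 v3 (dual_box_vec x) (dual_box_vec x)) 0.
Proof.
case=> e11 e12 e13 e22 c22 c20 e33 c33 c30 e23.
have [g1 _] := g11P q_odd e12 e13 e22 c22 c20 e33 c33 c30 e23.
have g2 := g12b q_odd e12 e13 e22 c22 c20 e33 c33 c30 e23.
have g3 := g13b q_odd e12 e13 e22 c22 c20 e33 c33 c30 e23.
have [g4 _] := g22P q_odd e12 e13 e22 c22 c20 e33 c33 c30 e23.
have g5 := g23b q_odd e12 e13 e22 c22 c20 e33 c33 c30 e23.
have [g6 _] := g33P q_odd e12 e13 e22 c22 c20 e33 c33 c30 e23.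
have x1 : lbound (dual_box_vec x).1.1 0 by exact: lbound_cst.
have sz (z : 'rV[F]_k.+1) : lbound (lp (rVpoly z)) k%:Z.
  by apply: lbound_le (proj1 (lbound_poly _ _) (size_poly _ _)) _; lia.
have x2 : lbound (dual_box_vec x).1.2 k%:Z by exact: sz.
have x3 : lbound (dual_box_vec x).2 k%:Z by exact: sz.
have tm (a b c : E) (l m n : int) : lbound a l -> lbound b m -> lbound c n -> l + m + n <= 0 ->
    lbound (a * (b * c)) 0.
  by move=> al bm cn h; apply: (lboundMle al (lboundM bm cn)); lia.
rewrite /dual_form /dform !mulrDr.
by do 5?[apply: lboundD]; (apply: tm; first [eassumption|by clear; lia]).
Qed.

Variable psi : F -> algC.
Hypothesis psi0 : psi 0 = 1.
Hypothesis psiD : {morph psi : x y / x + y >-> x * y}.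
Hypothesis psi_nt : exists x, psi x != 1.

Variables (L L' : lmodType A) (B : L -> L -> E) (B' : L' -> L' -> E).
Hypotheses (Bbil : bilinear_form B) (Bbil' : bilinear_form B').
Variables (v1 v2 v3 : L) (w1 w2 w3 : L') (k : nat) (c2 c3 : F).
Hypotheses (vbas : basis3 v1 v2 v3) (wbas : basis3 w1 w2 w3).
Hypotheses (vani : anisotropic B v1 v2 v3) (wani : anisotropic B' w1 w2 w3).
Hypotheses (vel : elongated B v1 v2 v3 k c2 c3) (wel : elongated B' w1 w2 w3 k c2 c3).
Hypothesis iso : forall n, iso_upto n (fun x => B x x) (fun x => B' x x).

Lemma dual_sums v :
  \sum_(x : dual_box F k) psi (lres v (dual_form B v1 v2 v3 (dual_box_vec x) (dual_box_vec x))) =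
  \sum_(x : dual_box F k) psi (lres v (dual_form B' w1 w2 w3 (dual_box_vec x) (dual_box_vec x))).
Proof.
(* For deg v <= -2 every residue is zero, since the dual values have degree at most 0. *)
have [vb|nvb] := EM (lbound v (-2)).
  have small f : lbound f 0 -> lres v f = 0.
    by move=> fb; apply: (lboundM vb fb).
  by apply: eq_bigr => x _; rewrite !small//; apply: dual_form_bound; eassumption.
have v0 : v != 0 by apply/eqP => e; apply: nvb => n _; rewrite e.
have dv : -1 <= ldeg v.
  rewrite leNgt; apply/negP => h; apply: nvb; apply: lbound_le (ldeg_bound v0) _; lia.
(* Chosen so that -u^-1 = v and deg u = 1 - s; as deg v >= -1, the absolute value changes
   nothing. *)
pose s := `|(ldeg v + 1)%R|%N; pose u := - v^-1.
have us : 1 - s%:Z = - ldeg v by rewrite /s; clear -dv; lia.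
have u0 : u (1 - s%:Z) != 0.
  rewrite us /u -[(- v^-1) _]/(- (v^-1 (- ldeg v))) oppr_eq0.
  by rewrite -ldegV// ldeg_lead// invr_eq0.
have ub : lbound u (1 - s%:Z).
  by rewrite us; apply: lboundN; apply: lboundV (ldeg_bound v0) (ldeg_lead v0).
have uE (a : E) : - (u^-1 * a) (-1) = lres v a.
  by rewrite /u invrN invrK mulNr -[X in - X]/(- lres v a) opprK.
have PS (M : lmodType A) (C : M -> M -> E) t1 t2 t3 (Cbil : bilinear_form C)
    (tbas : basis3 t1 t2 t3) (tani : anisotropic C t1 t2 t3)
    (tel : elongated C t1 t2 t3 k c2 c3) :
    (\sum_(p : grid F s | high_grid p) psi (lres u (lead_form k c2 c3 (grid_vec k p)))) *
    \sum_(x : dual_box F k) psi (lres v (dual_form C t1 t2 t3 (dual_box_vec x) (dual_box_vec x))) =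
    #|{: dual_box F k}|%:R *
    \sum_(i : {p : grid F s | integral_grid k p})
      psi (lres u (C (grid_lattice t1 t2 t3 i) (grid_lattice t1 t2 t3 i))) /\
    (\sum_(p : grid F s | high_grid p) psi (lres u (lead_form k c2 c3 (grid_vec k p)))) != 0.
  have [e11 e12 e13 e22 c22 c20 e33 c33 c30 e23] := tel.
  rewrite -(gamma_high q_odd psi0 psiD psi_nt e12 e13 e22 c22 c20 e33 c33 c30 e23 ub u0).
  split; last exact: (gamma_neq0 q_odd psi0 psiD psi_nt e12 e13 e22 c22 c20 e33 c33 c30 e23 ub u0).
  rewrite -(sum_integral_grid q_odd Cbil tel s (fun a => psi (lres u a))).
  rewrite -(poisson_summation q_odd psi0 psiD psi_nt e12 e13 e22 c22 c20 e33 c33 c30 e23 ub u0).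
  by congr (_ * _); apply: eq_bigr => x _; rewrite uE.
have [p1 g0] := PS _ _ _ _ _ Bbil vbas vani vel.
have [p2 _] := PS _ _ _ _ _ Bbil' wbas wani wel.
apply: (mulfI g0); rewrite p1 p2; congr (_ * _).
apply: (transport_sum (P := fun a => lbound a (2 * s%:Z - 2)) (fun a => psi (lres u a)) (iso (2 * s%:Z - 2))
  (e := @grid_lattice F L v1 v2 v3 k s) (e' := @grid_lattice F L' w1 w2 w3 k s)) => //.
- exact: (grid_lattice_inj q_odd).
- exact: (grid_lattice_inj q_odd).
- exact: (grid_lattice_bound q_odd Bbil vbas vani vel).
- exact: (grid_lattice_bound q_odd Bbil' wbas wani wel).
- exact: (grid_lattice_surj q_odd Bbil vbas vani vel).
- exact: (grid_lattice_surj q_odd Bbil' wbas wani wel).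
Qed.

Lemma dual_bijection : exists2 h : dual_box F k -> dual_box F k, bijective h &
  forall x, dual_form B' w1 w2 w3 (dual_box_vec (h x)) (dual_box_vec (h x)) =
            dual_form B v1 v2 v3 (dual_box_vec x) (dual_box_vec x).
Proof.
pose f (x : dual_box F k) := dual_form B v1 v2 v3 (dual_box_vec x) (dual_box_vec x).
pose g (x : dual_box F k) := dual_form B' w1 w2 w3 (dual_box_vec x) (dual_box_vec x).
suff cnt : forall a, #|[pred x | f x == a]| = #|[pred x | g x == a]|.
  by have [h hb hP] := count_bijection cnt; exists h.
apply: (fourier_count psi0 psiD psi_nt) => [x|x|v]; last exact: dual_sums.
  by apply: dual_form_bound; exact: vel.
by apply: dual_form_bound; exact: wel.
Qed.

End ElongatedPair.

(** * Gram matrices and changes of basis *)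

Section GramMatrices.
Variable F : fieldType.
Local Notation A := {poly F}.
Local Notation E := (laurent F).
Local Notation lp := (@laurent_of_poly F).

Definition gram_mx (L : lmodType A) (B : L -> L -> E) n (w : 'I_n -> L) : 'M[E]_n :=
  \matrix_(i, j) B (w i) (w j).

Definition tri (T : Type) (x1 x2 x3 : T) (i : 'I_3) : T :=
  if val i is j.+1 then (if j is _.+1 then x3 else x2) else x1.

Section Change.
Variables (L : lmodType A) (B : L -> L -> E).
Hypothesis Bbil : bilinear_form B.

Lemma bil_sum n (p r : 'I_n -> A) (w : 'I_n -> L) :
  B (\sum_i p i *: w i) (\sum_j r j *: w j) =
  \sum_i \sum_j lp (p i) * B (w i) (w j) * lp (r j).
Proof.
have suml (I : Type) (s : seq I) (f : I -> L) z : B (\sum_(i <- s) f i) z = \sum_(i <- s) B (f i) z.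
  elim: s => [|a s IH]; first by rewrite !big_nil (bil0l Bbil).
  by rewrite !big_cons (bilDl Bbil) IH.
rewrite suml; apply: eq_bigr => i _; rewrite (bilC Bbil) suml; apply: eq_bigr => j _.
by rewrite (bilZl Bbil) (bilZr Bbil) (bilC Bbil); ring.
Qed.

Lemma gram_mx_change n (S : 'M[A]_n) (w : 'I_n -> L) :
  gram_mx B (fun i => \sum_k S i k *: w k) =
  map_mx lp S *m gram_mx B w *m (map_mx lp S)^T.
Proof.
apply/matrixP => i j; rewrite !mxE bil_sum exchange_big /=; apply: eq_bigr => k _.
by rewrite !mxE mulr_suml; apply: eq_bigr => l _; rewrite !mxE.
Qed.

Lemma gram_mx_sym n (w : 'I_n -> L) : (gram_mx B w)^T = gram_mx B w.
Proof. by apply/matrixP => i j; rewrite !mxE (bilC Bbil). Qed.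

Lemma sum_tri (x1 x2 x3 : L) (p1 p2 p3 : A) :
  \sum_i tri p1 p2 p3 i *: tri x1 x2 x3 i = comb3 x1 x2 x3 (p1, p2, p3).
Proof. by rewrite !big_ord_recl big_ord0 addr0 addrA. Qed.

End Change.

Lemma basis3_coord (L : lmodType A) (w1 w2 w3 : L) n (x : 'I_n -> L) : basis3 w1 w2 w3 ->
  exists T : 'M[A]_(n, 3), forall i, x i = \sum_k T i k *: tri w1 w2 w3 k.
Proof.
move=> /basis3P[_ ws].
exists (\matrix_(i, k) let p := sval (cid (ws (x i))) in tri p.1.1 p.1.2 p.2 k) => i.
case E : (cid (ws (x i))) => [[[a b] c] p]; rewrite -p -sum_tri.
by apply: eq_bigr => k _; rewrite mxE E.
Qed.

Lemma basis3_coord_inj (L : lmodType A) (w1 w2 w3 : L) (p r : 'I_3 -> A) : basis3 w1 w2 w3 ->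
  \sum_k p k *: tri w1 w2 w3 k = \sum_k r k *: tri w1 w2 w3 k -> p =1 r.
Proof.
move=> /basis3P[wi _]; rewrite !big_ord_recl !big_ord0 !addr0 !addrA => e.
pose h (f : 'I_3 -> A) := (f ord0, f (lift ord0 ord0), f (lift ord0 (lift ord0 ord0))).
have [e0 e1 e2] : h p = h r by apply: wi.
by case=> [[|[|[|//]]] hk]; [move: e0|move: e1|move: e2];
  congr (p _ = r _); apply: val_inj.
Qed.

Lemma tri_eta (T : Type) (f : 'I_3 -> T) : exists x1 x2 x3, forall i, f i = tri x1 x2 x3 i.
Proof.
exists (f ord0), (f (@Ordinal 3 1 isT)), (f (@Ordinal 3 2 isT)).
by case=> [[|[|[|//]]] h]; congr f; apply: val_inj.
Qed.

Lemma basis3_mx (L : lmodType A) (w1 w2 w3 t1 t2 t3 : L) (T S : 'M[A]_3) :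
  basis3 w1 w2 w3 -> T *m S = 1%:M ->
  (forall i, tri t1 t2 t3 i = \sum_k T i k *: tri w1 w2 w3 k) -> basis3 t1 t2 t3.
Proof.
move=> wbas TS tE.
pose row (p : A * A * A) : 'rV[A]_3 := \row_i tri p.1.1 p.1.2 p.2 i.
pose unrow (r : 'rV[A]_3) : A * A * A :=
  (r 0 ord0, r 0 (@Ordinal 3 1 isT), r 0 (@Ordinal 3 2 isT)).
have rowK : cancel row unrow by case=> [[a b] c]; rewrite /unrow !mxE.
have unrowK : cancel unrow row.
  move=> r; apply/rowP => i; rewrite mxE /unrow /=.
  by case: i => [[|[|[|//]]] h]; congr (r _ _); apply: val_inj.
apply: (@basis3_change _ _ _ _ _ (fun p => unrow (row p *m T)) _ _ _ wbas).
  exists (fun p => unrow (row p *m S)) => p; rewrite unrowK -mulmxA ?TS ?mulmx1 ?rowK//.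
  by rewrite mulmx1C// mulmx1 rowK.
move=> [[a b] c]; rewrite -!sum_tri.
under eq_bigr do rewrite tE scaler_sumr.
rewrite exchange_big /=; apply: eq_bigr => k _.
under eq_bigr do rewrite scalerA.
rewrite -scaler_suml; congr (_ *: _).
have := congr1 (fun r : 'rV_3 => r 0 k) (unrowK (row (a, b, c) *m T)).
rewrite /row /= !mxE /= => ->; apply: eq_bigr => i _.
by rewrite mxE.
Qed.

End GramMatrices.

(** * The scaled dual lattice *)

Section DualLattice.
Variable F : finFieldType.
Hypothesis q_odd : odd #|F|.
Local Notation A := {poly F}.
Local Notation E := (laurent F).
Local Notation lp := (@laurent_of_poly F).
Local Notation D := (A^o * A^o * A^o)%type.

(* The factor t^(2k+1) makes the dual lattice reduced_flat in the basis order (2, 3, 1). *)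
Definition dual_lattice_form k (L : lmodType A) (B : L -> L -> E) v1 v2 v3 (x y : D) : E :=
  lmonom 1 (2 * k + 1)%N%:Z * dual_form B v1 v2 v3 (lp3 x) (lp3 y).

Local Notation e1 := ((0, 1, 0) : D).
Local Notation e2 := ((0, 0, 1) : D).
Local Notation e3 := ((1, 0, 0) : D).

Lemma dual_basis : basis3 e1 e2 e3.
Proof.
have cE p : comb3 e1 e2 e3 p = (p.2, p.1.1, p.1.2).
  case: p => [[a b] c]; rewrite /comb3 /=; congr (_, _, _);
  by rewrite /= /GRing.scale /= ?mulr0 ?mulr1 ?add0r ?addr0.
exists (fun x : D => (x.1.2, x.2, x.1.1)) => [p|p]; first by rewrite cE; case: p => [[]].
by rewrite cE; case: p => [[]].
Qed.

Section One.
Variables (L : lmodType A) (B : L -> L -> E).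
Hypothesis Bbil : bilinear_form B.
Variables (v1 v2 v3 : L) (k : nat) (c2 c3 : F).
Hypothesis vel : elongated B v1 v2 v3 k c2 c3.
Hypothesis nsq : - c3 / c2 \notin squares F.
Let M : int := (2 * k + 1)%N%:Z.
Let dB := dual_lattice_form k B v1 v2 v3.

Lemma dual_lattice_bil : bilinear_form dB.
Proof.
split=> [x y|a x y z].
  by congr (_ * _); rewrite /dual_form /dform; ring.
rewrite /dB /dual_lattice_form [RHS]addrC -[RHS]addrC mulrCA -mulrDr; congr (_ * _).
have -> : lp3 (a *: x + y) = (lp a * lp x.1.1 + lp y.1.1, lp a * lp x.1.2 + lp y.1.2, lp a * lp x.2 + lp y.2).
  by rewrite /lp3 /= !rmorphD !rmorphM.
by rewrite /dual_form /dform /lp3 /=; ring.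
Qed.

Lemma dual_lattice_flat : reduced_flat dB e1 e2 e3 k c2^-1 c3^-1 1.
Proof.
have [e11 e12 e13 e22 c22 c20 e33 c33 c30 e23] := vel.
have [g1 g1c] := g11P q_odd e12 e13 e22 c22 c20 e33 c33 c30 e23.
have g2 := g12b q_odd e12 e13 e22 c22 c20 e33 c33 c30 e23.
have g3 := g13b q_odd e12 e13 e22 c22 c20 e33 c33 c30 e23.
have [g4 g4c] := g22P q_odd e12 e13 e22 c22 c20 e33 c33 c30 e23.
have g5 := g23b q_odd e12 e13 e22 c22 c20 e33 c33 c30 e23.
have [g6 g6c] := g33P q_odd e12 e13 e22 c22 c20 e33 c33 c30 e23.
have tM (f : E) (m n : int) : lbound f m -> M + m <= n -> lbound (lmonom 1 M * f) n.
  by move=> fm h; apply: (lboundMle (@lbound_monom _ 1 M) fm).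
have cM (f : E) (m n : int) : M + m = n -> (lmonom 1 M * f) n = f m.
  by move=> h; rewrite lcoef_monomM mul1r -h addrAC subrr add0r.
have E0 := rmorph0 lp; have E1 := rmorph1 lp.
have d11 : dB e1 e1 = lmonom 1 M * g22 (B v1 v2) (B v1 v3) (B v2 v2) (B v2 v3) (B v3 v3).
  by congr (_ * _); rewrite /dual_form /dform /lp3 /= E0 E1; ring.
have d22 : dB e2 e2 = lmonom 1 M * g33 (B v1 v2) (B v1 v3) (B v2 v2) (B v2 v3) (B v3 v3).
  by congr (_ * _); rewrite /dual_form /dform /lp3 /= E0 E1; ring.
have d33 : dB e3 e3 = lmonom 1 M * g11 (B v1 v2) (B v1 v3) (B v2 v2) (B v2 v3) (B v3 v3).
  by congr (_ * _); rewrite /dual_form /dform /lp3 /= E0 E1; ring.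
have d12 : dB e1 e2 = lmonom 1 M * g23 (B v1 v2) (B v1 v3) (B v2 v2) (B v2 v3) (B v3 v3).
  by congr (_ * _); rewrite /dual_form /dform /lp3 /= E0 E1; ring.
have d13 : dB e1 e3 = lmonom 1 M * g12 (B v1 v2) (B v1 v3) (B v2 v2) (B v2 v3) (B v3 v3).
  by congr (_ * _); rewrite /dual_form /dform /lp3 /= E0 E1; ring.
have d23 : dB e2 e3 = lmonom 1 M * g13 (B v1 v2) (B v1 v3) (B v2 v2) (B v2 v3) (B v3 v3).
  by congr (_ * _); rewrite /dual_form /dform /lp3 /= E0 E1; ring.
have Mp : M + - M = 0 by rewrite subrr.
split.
- by rewrite d11; split; [apply: tM g4 _|rewrite (cM _ (- M)) ?g4c//]; rewrite /M; clear; lia.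
- by rewrite d22; split; [apply: tM g6 _|rewrite (cM _ (- M)) ?g6c//]; rewrite /M; clear; lia.
- by rewrite d33; split; [apply: tM g1 _|rewrite (cM _ 0) ?g1c//]; rewrite /M; clear; lia.
- by rewrite d12 d13 d23; split; [apply: tM g5 _|apply: tM g2 _|apply: tM g3 _]; rewrite /M; clear; lia.
split; rewrite ?oner_neq0 ?invr_eq0//.
apply: contra nsq => /squaresP[z zz]; apply/squaresP; exists (z * (c3 / c2)).
by rewrite exprMn -zz; field; rewrite c20 oner_neq0 c30.
Qed.

Definition dual_elt (z : dual_box F k) : D := (z.1.1%:P, rVpoly z.1.2, rVpoly z.2).
Definition dual_coord (x : D) : dual_box F k :=
  ((x.1.1 : A)`_0, poly_rV (x.1.2 : A), poly_rV (x.2 : A)).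

Lemma dual_eltK : cancel dual_elt dual_coord.
Proof. by case=> [[a b] c]; rewrite /dual_coord /dual_elt /= coefC eqxx !rVpolyK. Qed.

Lemma dual_elt_value z : dB (dual_elt z) (dual_elt z) =
  lmonom 1 M * dual_form B v1 v2 v3 (dual_box_vec z) (dual_box_vec z).
Proof. by []. Qed.

(** [flat_values] with n = 2k+1 and j = k+1 shows that the dual vectors of scaled value degree at
    most 2k+1 are exactly those of the dual box. *)
Lemma dual_coordK x : lbound (dB x x) M -> dual_elt (dual_coord x) = x.
Proof.
have [g gK' gK] := dual_basis; rewrite -(gK x); move: (g x) => p.
move=> pb; have := flat_values (e := 0) (n := M) (j := k.+1) (p := p) dual_lattice_bil dual_lattice_flat.
rewrite /lcst polyC0 rmorph0 mul0r subr0 => /(_ pb (lexx _)).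
case; first by rewrite /M; clear; lia.
have -> : comb3 e1 e2 e3 p = (p.2, p.1.1, p.1.2).
  case: (p) => [[a b] c]; rewrite /comb3 /=; congr (_, _, _);
  by rewrite /= /GRing.scale /= ?mulr0 ?mulr1 ?add0r ?addr0.
move=> c [-> s1 s2 _].
by rewrite /dual_elt /dual_coord /= !poly_rV_K// coefC eqxx.
Qed.

End One.
End DualLattice.

(** H and H' are t G^-1 and t G'^-1, so inverting S H' S^T = H gives the congruence for G' and G
    with T = S^-1. *)
Lemma congruence_inverse (K : fieldType) n (G G' H H' S T : 'M[K]_n) (t : K) :
  t != 0 -> G *m H = t%:M -> H *m G = t%:M -> G' *m H' = t%:M -> S *m T = 1%:M ->
  S *m H' *m S^T = H -> T^T *m G' *m T = G.
Proof.
move=> t0 GH HG GH' ST SH; have TS := mulmx1C ST.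
have XH : T^T *m G' *m T *m H = t%:M.
  rewrite -SH !mulmxA -[T^T *m G' *m T *m S]mulmxA TS mulmx1 -[T^T *m G' *m H']mulmxA GH'.
  by rewrite mul_mx_scalar -scalemxAl -trmx_mul ST trmx1 scalemx1.
by apply: (scalerI t0); rewrite -!mul_mx_scalar -[in LHS]HG mulmxA XH mul_scalar_mx mul_mx_scalar.
Qed.

Section ElongatedIsometry.
Variable F : finFieldType.
Hypothesis q_odd : odd #|F|.
Local Notation A := {poly F}.
Local Notation E := (laurent F).
Local Notation lp := (@laurent_of_poly F).
Local Notation D := (A^o * A^o * A^o)%type.
Local Notation e1 := ((0, 1, 0) : D).
Local Notation e2 := ((0, 0, 1) : D).
Local Notation e3 := ((1, 0, 0) : D).

Lemma gram_dual (L : lmodType A) (B : L -> L -> E) v1 v2 v3 k c2 c3 :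
  bilinear_form B -> elongated B v1 v2 v3 k c2 c3 ->
  gram_mx B (tri v1 v2 v3) *m
    gram_mx (dual_lattice_form k B v1 v2 v3) (tri e3 e1 e2) =
  (lmonom 1 (2 * k + 1)%N%:Z)%:M.
Proof.
move=> Bbil vel; have [e11 e12 e13 e22 c22 c20 e33 c33 c30 e23] := vel.
set t := lmonom 1 _.
have E0 := rmorph0 lp; have E1 := rmorph1 lp.
have key (x y : D) : bform (B v1 v2) (B v1 v3) (B v2 v2) (B v2 v3) (B v3 v3) (lp3 x)
    (dual_vec (B v1 v2) (B v1 v3) (B v2 v2) (B v2 v3) (B v3 v3) (lp3 y)) = dot (lp3 x) (lp3 y).
  exact: (bform_dual q_odd e12 e13 e22 c22 c20 e33 c33 c30 e23).
apply/matrixP => i j; rewrite !mxE.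
have -> : t *+ (i == j) = t * dot (lp3 (tri e3 e1 e2 i)) (lp3 (tri e3 e1 e2 j)).
  case: i => [[|[|[|//]]] hi]; case: j => [[|[|[|//]]] hj];
  by rewrite /dot /lp3 /= E0 E1; ring.
rewrite -key !big_ord_recl big_ord0 !mxE /dual_lattice_form -/t.
have s21 := bilC Bbil v2 v1; have s31 := bilC Bbil v3 v1; have s32 := bilC Bbil v3 v2.
case: i => [[|[|[|//]]] hi]; case: j => [[|[|[|//]]] hj];
by rewrite /bform /dual_form /dform /dual_vec /lp3 /= E0 E1 ?s21 ?s31 ?s32 ?e11; ring.
Qed.

Variables (L L' : lmodType A) (B : L -> L -> E) (B' : L' -> L' -> E).
Hypotheses (Bbil : bilinear_form B) (Bbil' : bilinear_form B').
Variables (v1 v2 v3 : L) (w1 w2 w3 : L') (k : nat) (c2 c3 : F).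
Hypotheses (vbas : basis3 v1 v2 v3) (wbas : basis3 w1 w2 w3).
Hypotheses (vani : anisotropic B v1 v2 v3) (wani : anisotropic B' w1 w2 w3).
Hypotheses (vel : elongated B v1 v2 v3 k c2 c3) (wel : elongated B' w1 w2 w3 k c2 c3).
Hypothesis nsq : - c3 / c2 \notin squares F.
Hypothesis iso : forall n, iso_upto n (fun x => B x x) (fun x => B' x x).
Let M : int := (2 * k + 1)%N%:Z.
Let dB := dual_lattice_form k B v1 v2 v3.
Let dB' := dual_lattice_form k B' w1 w2 w3.

Lemma dual_iso_upto : iso_upto M (fun x => dB x x) (fun x => dB' x x).
Proof.
have [psi [psi0 psiD psi_nt]] := additive_character F.
have [h [h' hK h'K] hP] := dual_bijection q_odd psi0 psiD psi_nt Bbil Bbil' vbas wbas vani wani vel wel iso.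
exists (fun x => dual_elt (h (dual_coord k x))), (fun x => dual_elt (h' (dual_coord k x))).
have hE z : dB' (dual_elt (h z)) (dual_elt (h z)) = dB (dual_elt z) (dual_elt z).
  by rewrite /dB /dB' !dual_elt_value hP.
split=> x xb.
  have xE : dual_elt (dual_coord k x) = x by exact: (dual_coordK q_odd vel nsq xb).
  by rewrite hE xE dual_eltK hK xE.
have xE : dual_elt (dual_coord k x) = x by exact: (dual_coordK q_odd wel nsq xb).
by rewrite -hE h'K xE dual_eltK h'K xE.
Qed.

Lemma elongated_isometry : exists u1 u2 u3, basis3 u1 u2 u3 /\ same_gram B B' v1 v2 v3 u1 u2 u3.
Proof.
have dbil : bilinear_form dB by exact: dual_lattice_bil.
have dbil' : bilinear_form dB' by exact: dual_lattice_bil.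
have [u1 [u2 [u3 [ubas [[g11 g12 g22] [g13 g23 g33]]]]]] :=
  flat_isometry q_odd dbil dbil' (dual_basis F) (dual_lattice_flat q_odd vel nsq)
    (dual_basis F) (dual_lattice_flat q_odd wel nsq) dual_iso_upto.
pose coord (x : D) := tri (x.1.1 : A) (x.1.2 : A) (x.2 : A).
have coordE (x : D) : x = \sum_i coord x i *: tri e3 e1 e2 i.
  rewrite !big_ord_recl big_ord0 /coord /tri /= addr0; case: x => [[a b] c].
  by congr (_, _, _); rewrite /= /GRing.scale /= ?mulr0 ?mulr1 ?add0r ?addr0.
(* The order 3, 1, 2 undoes the reordering of the dual basis, so that S acts on the coordinates in
   which the dual matrix is inverse to the Gram matrix. *)
pose S : 'M[A]_3 := \matrix_(i, j) coord (tri u3 u1 u2 i) j.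
have SE i : tri u3 u1 u2 i = \sum_j S i j *: tri e3 e1 e2 j.
  by rewrite [LHS]coordE; apply: eq_bigr => j _; rewrite mxE.
have Hgram : map_mx lp S *m gram_mx dB' (tri e3 e1 e2) *m (map_mx lp S)^T = gram_mx dB (tri e3 e1 e2).
  rewrite -gram_mx_change//; apply/matrixP => i j; rewrite !mxE -!SE.
  have b21 := bilC dbil e2 e1; have b31 := bilC dbil e3 e1; have b32 := bilC dbil e3 e2.
  have c21 := bilC dbil' u2 u1; have c31 := bilC dbil' u3 u1; have c32 := bilC dbil' u3 u2.
  case: i => [[|[|[|//]]] hi]; case: j => [[|[|[|//]]] hj]; rewrite /tri /=;
  rewrite ?g11 ?g12 ?g13 ?g22 ?g23 ?g33//.
  - by rewrite b31 -g13 c31.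
  - by rewrite b32 -g23 c32.
  - by rewrite b21 -g12 c21.
have ubas' : basis3 u3 u1 u2 by apply/basis3_swap12/basis3_swap23.
have ebas : basis3 e3 e1 e2 by apply/basis3_swap12/basis3_swap23/dual_basis.
have [T TE] := basis3_coord (tri e3 e1 e2) ubas'.
have TS : T *m S = 1%:M.
  apply/matrixP => i; apply: (basis3_coord_inj ebas).
  transitivity (tri e3 e1 e2 i).
    rewrite TE; under [RHS]eq_bigr do rewrite SE scaler_sumr.
    rewrite exchange_big; apply: eq_bigr => j _; rewrite !mxE scaler_suml.
    by apply: eq_bigr => k' _; rewrite scalerA.
  rewrite (bigD1 i)//= big1 ?addr0 ?mxE ?eqxx ?scale1r// => j ji.
  by rewrite mxE eq_sym (negPf ji) scale0r.
have ST := mulmx1C TS.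
have [u1' [u2' [u3' tE]]] := tri_eta (fun i => \sum_k T^T i k *: tri w1 w2 w3 k).
exists u1', u2', u3'; split.
  apply: (basis3_mx (T := T^T) (S := S^T) wbas) => [|i]; last by rewrite -tE.
  by rewrite -trmx_mul ST trmx1.
have GH := gram_dual Bbil vel; have GH' := gram_dual Bbil' wel.
rewrite -/dB -/dB' in GH GH'; set t := lmonom 1 _ in GH GH'.
have t0 : t != 0 by exact: lmonom_neq0 (oner_neq0 F).
have STe : map_mx lp S *m map_mx lp T = 1%:M by rewrite -map_mxM ST map_mx1.
have HG : gram_mx dB (tri e3 e1 e2) *m gram_mx B (tri v1 v2 v3) = t%:M.
  by rewrite -[LHS]trmxK trmx_mul !gram_mx_sym// GH tr_scalar_mx.
suff gE : gram_mx B' (tri u1' u2' u3') = gram_mx B (tri v1 v2 v3).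
  have ge (i j : 'I_3) : B' (tri u1' u2' u3' i) (tri u1' u2' u3' j) =
      B (tri v1 v2 v3 i) (tri v1 v2 v3 j).
    by have := congr1 (fun X : 'M_3 => X i j) gE; rewrite !mxE.
  pose o1 : 'I_3 := lift ord0 ord0; pose o2 : 'I_3 := ord_max.
  split; split; [exact: (ge ord0 ord0)|exact: (ge ord0 o1)|exact: (ge o1 o1)|
    exact: (ge ord0 o2)|exact: (ge o1 o2)|exact: (ge o2 o2)].
have -> : gram_mx B' (tri u1' u2' u3') =
    (map_mx lp T)^T *m gram_mx B' (tri w1 w2 w3) *m map_mx lp T.
  transitivity (gram_mx B' (fun i => \sum_k T^T i k *: tri w1 w2 w3 k)).
    by apply/matrixP => i j; rewrite [LHS]mxE [RHS]mxE -!tE.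
  by rewrite gram_mx_change// !map_trmx trmxK.
exact: (congruence_inverse t0 GH HG GH' STe Hgram).
Qed.

End ElongatedIsometry.

(** * Lattices with two equal minima *)

Section EqualMinima.
Variable F : finFieldType.
Hypothesis q_odd : odd #|F|.
Local Notation A := {poly F}.
Local Notation E := (laurent F).
Local Notation lp := (@laurent_of_poly F).

(** A nontrivial zero would give a vector whose components attain degree N while its value has
    degree below N, contradicting [reduced_degrees]. The exponents d_i are constrained only where
    c_i is nonzero, so minima of the wrong parity can be left out. *)
Lemma isotropic_lead (L : lmodType A) (B : L -> L -> E) v1 v2 v3 m1 m2 m3 :
  bilinear_form B -> basis3 v1 v2 v3 -> anisotropic B v1 v2 v3 ->
  reduced3 B v1 v2 v3 m1 m2 m3 -> forall (c1 c2 c3 : F) (d1 d2 d3 : nat) (N : int),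
  (c1 != 0 -> (2 * d1)%N%:Z + m1 = N) -> (c2 != 0 -> (2 * d2)%N%:Z + m2 = N) ->
  (c3 != 0 -> (2 * d3)%N%:Z + m3 = N) ->
  B v1 v1 m1 * c1 ^+ 2 + B v2 v2 m2 * c2 ^+ 2 + B v3 v3 m3 * c3 ^+ 2 = 0 ->
  [/\ c1 = 0, c2 = 0 & c3 = 0].
Proof.
move=> Bbil vbas vani vred c1 c2 c3 d1 d2 d3 N h1 h2 h3 lead.
have [[b1 l1] [b2 l2] [b3 l3] /andP[m12 m23] [b12 b13 b23]] := vred.
have term (v : L) (m : int) (c : F) (d : nat) (y := (c%:P * 'X^d) *: v) :
    lbound (B v v) m -> (c != 0 -> (2 * d)%N%:Z + m = N) ->
    lbound (B y y) N /\ B y y N = B v v m * c ^+ 2.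
  have yE : B y y = lcst (c ^+ 2) * (lmonom 1 (2 * d)%N%:Z * B v v).
    rewrite /y !(bilE Bbil) lmonomX !rmorphM /= -/(lcst c) mul2n -addnn exprD rmorphM !rmorphXn /=.
    by ring.
  move=> bm h; rewrite yE lcoef_cstM lcoef_monomM mul1r.
  have [->|c0] := eqVneq c 0.
    by rewrite expr0n rmorph0 !(mul0r, mulr0); split=> //; exact: lbound0.
  rewrite -(h c0) addrAC subrr add0r; split; last exact: mulrC.
  by apply: lbound_cstM; apply: (lboundM (@lbound_monom _ 1 _) bm).
have [y1 z1] := term _ _ _ _ b1 h1; have [y2 z2] := term _ _ _ _ b2 h2.
have [y3 z3] := term _ _ _ _ b3 h3.
have two := two_neq0 q_odd.
have y12 : lbound (B ((c1%:P * 'X^d1) *: v1) ((c2%:P * 'X^d2) *: v2)) (N - 1).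
  by apply: (cross_scale two Bbil b1 l1 b2 l2 b12 _ y1 y2); move: m12; clear; lia.
have y13 : lbound (B ((c1%:P * 'X^d1) *: v1) ((c3%:P * 'X^d3) *: v3)) (N - 1).
  by apply: (cross_scale two Bbil b1 l1 b3 l3 b13 _ y1 y3); move: m12 m23; clear; lia.
have y23 : lbound (B ((c2%:P * 'X^d2) *: v2) ((c3%:P * 'X^d3) *: v3)) (N - 1).
  by apply: (cross_scale two Bbil b2 l2 b3 l3 b23 _ y2 y3); move: m23; clear; lia.
pose p : A * A * A := (c1%:P * 'X^d1, c2%:P * 'X^d2, c3%:P * 'X^d3).
have : lbound (B (comb3 v1 v2 v3 p) (comb3 v1 v2 v3 p)) (N - 1).
  rewrite /comb3 /p /=; move: y1 y2 y3 z1 z2 z3 y12 y13 y23.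
  move: (_ *: v1) (_ *: v2) (_ *: v3) => x1 x2 x3 y1 y2 y3 z1 z2 z3 y12 y13 y23.
  rewrite !(bil_sqD Bbil) (bilDl Bbil) mulrDr.
  have -> : B x1 x1 + 2%:R * B x1 x2 + B x2 x2 + (2%:R * B x1 x3 + 2%:R * B x2 x3) + B x3 x3 =
    B x1 x1 + B x2 x2 + B x3 x3 + (2%:R * B x1 x2 + 2%:R * B x1 x3 + 2%:R * B x2 x3) by ring.
  apply: lboundD; last by do 2?[apply: lboundD]; apply: lbound_twice.
  by apply: lbound_pred; [do 2?[apply: lboundD]|rewrite !lcoefD z1 z2 z3].
move/(reduced_degrees two Bbil vbas vani _ _ vred) => /= [s1 s2 s3].
have fin (v : L) (m : int) (c : F) (d : nat) (y := (c%:P * 'X^d) *: v) : B v v m != 0 ->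
    B y y N = B v v m * c ^+ 2 -> lbound (B y y) (N - 1) -> c = 0.
  move=> l yN yb; have : B y y N = 0 by apply: yb; clear; lia.
  by rewrite yN => /eqP; rewrite mulf_eq0 (negPf l) sqrf_eq0 => /eqP.
by split; [apply: fin l1 z1 s1|apply: fin l2 z2 s2|apply: fin l3 z3 s3].
Qed.

(** If -l2/l1 were a square, the leading forms of v1 and v2 would already cancel. If m3 - m were
    even, [binary_universal] would cancel the leading term of v3. *)
Lemma minima_equal12 (L : lmodType A) (B : L -> L -> E) v1 v2 v3 m m3 :
  bilinear_form B -> basis3 v1 v2 v3 -> anisotropic B v1 v2 v3 ->
  reduced3 B v1 v2 v3 m m m3 ->
  - B v2 v2 m / B v1 v1 m \notin squares F /\ exists k, m3 = m + (2 * k + 1)%N%:Z.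
Proof.
move=> Bbil vbas vani vred.
have iso := isotropic_lead Bbil vbas vani vred.
have [[b1 l1] [b2 l2] [b3 l3] /andP[_ m23] _] := vred; split.
  apply/negP => /squaresP[c e].
  have [||||_ /eqP] := iso c 1 0 0%N 0%N 0%N m; rewrite ?eqxx ?add0r ?oner_eq0//.
  by rewrite -e; field.
have [e|] := boolP (odd `|m3 - m|).
  exists (`|m3 - m|%N./2); move: m23 e; clear; lia.
move=> ne; have [x [y e]] := binary_universal q_odd (- B v3 v3 m3) l1 l2.
pose d := `|m3 - m|%N./2.
have [||||_ _ /eqP] := iso x y 1 d d 0%N m3; rewrite ?oner_eq0 ?add0r//.
- by move=> _; move: m23 ne; rewrite /d; clear; lia.
- by move=> _; move: m23 ne; rewrite /d; clear; lia.
- by rewrite e expr1n mulr1 addNr.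
Qed.

Lemma minima_equal23 (L : lmodType A) (B : L -> L -> E) v1 v2 v3 m1 m :
  bilinear_form B -> basis3 v1 v2 v3 -> anisotropic B v1 v2 v3 ->
  reduced3 B v1 v2 v3 m1 m m ->
  - B v3 v3 m / B v2 v2 m \notin squares F /\ exists k, m = m1 + (2 * k + 1)%N%:Z.
Proof.
move=> Bbil vbas vani vred.
have iso := isotropic_lead Bbil vbas vani vred.
have [[b1 l1] [b2 l2] [b3 l3] /andP[m12 _] _] := vred; split.
  apply/negP => /squaresP[c e].
  have [||||_ _ /eqP] := iso 0 c 1 0%N 0%N 0%N m; rewrite ?eqxx ?add0r ?oner_eq0//.
  by rewrite -e; field.
have [e|] := boolP (odd `|m - m1|).
  exists (`|m - m1|%N./2); move: m12 e; clear; lia.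
move=> ne; have [x [y e]] := binary_universal q_odd (- B v1 v1 m1) l2 l3.
pose d := `|m - m1|%N./2.
have [||||/eqP] := iso 1 x y d 0%N 0%N m; rewrite ?oner_eq0 ?add0r//.
- by move=> _; move: m12 ne; rewrite /d; clear; lia.
- by rewrite -addrA e expr1n mulr1 subrr.
Qed.

End EqualMinima.

Section Scaling.
Variable F : fieldType.
Local Notation A := {poly F}.
Local Notation E := (laurent F).
Local Notation lp := (@laurent_of_poly F).
Variable c : E.
Hypothesis c0 : c != 0.

Lemma bilinear_scale (L : lmodType A) (B : L -> L -> E) :
  bilinear_form B -> bilinear_form (fun x y => c * B x y).
Proof.
move=> Bbil; split=> [x y|a x y z]; first by rewrite (bilC Bbil).
by rewrite Bbil.2; ring.
Qed.

Lemma anisotropic_scale (L : lmodType A) (B : L -> L -> E) e1 e2 e3 :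
  anisotropic B e1 e2 e3 -> anisotropic (fun x y => c * B x y) e1 e2 e3.
Proof.
move=> ani x1 x2 x3 x0; apply: ani; apply: (mulfI c0); rewrite mulr0 -[RHS]x0.
by ring.
Qed.

Lemma iso_upto_scale (L L' : Type) (Q : L -> E) (Q' : L' -> E) :
  (forall n, iso_upto n Q Q') -> forall n, iso_upto n (fun x => c * Q x) (fun x => c * Q' x).
Proof.
move=> iso n; have [p [p' [h h']]] := iso (n - ldeg c).
have down (f : E) : lbound (c * f) n -> lbound f (n - ldeg c).
  move=> fn; rewrite -[f](mulKf c0).
  apply: (lboundMle (ldeg_bound (invr_neq0 c0)) fn); rewrite ldegV//; lia.
by exists p, p'; split=> x /down; [move=> /h[-> ->]|move=> /h'[-> ->]].
Qed.

End Scaling.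

Section Drivers.
Variable F : finFieldType.
Hypothesis q_odd : odd #|F|.
Local Notation A := {poly F}.
Local Notation E := (laurent F).
Local Notation lp := (@laurent_of_poly F).
Variables (L L' : lmodType A) (B : L -> L -> E) (B' : L' -> L' -> E).

Lemma same_gram_scale (c : E) v1 v2 v3 u1 u2 u3 : c != 0 ->
  same_gram (fun x y => c * B x y) (fun x y => c * B' x y) v1 v2 v3 u1 u2 u3 ->
  same_gram B B' v1 v2 v3 u1 u2 u3.
Proof.
by move=> c0 [[g1 g2 g3] [g4 g5 g6]]; split; split; apply: (mulfI c0).
Qed.

Hypotheses (Bbil : bilinear_form B) (Bbil' : bilinear_form B').
Hypothesis Bani : forall e1 e2 e3, basis3 e1 e2 e3 -> anisotropic B e1 e2 e3.
Hypothesis Bani' : forall e1 e2 e3, basis3 e1 e2 e3 -> anisotropic B' e1 e2 e3.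
Hypothesis iso : forall n, iso_upto n (fun x => B x x) (fun x => B' x x).
Variables (v1 v2 v3 : L) (w1 w2 w3 : L').
Hypotheses (vbas : basis3 v1 v2 v3) (wbas : basis3 w1 w2 w3).

Lemma isometry_equal12 m m3 : reduced3 B v1 v2 v3 m m m3 -> reduced3 B' w1 w2 w3 m m m3 ->
  exists u1 u2 u3, basis3 u1 u2 u3 /\ same_gram B B' v1 v2 v3 u1 u2 u3.
Proof.
move=> vred wred.
have [vn [k ek]] := minima_equal12 q_odd Bbil vbas (Bani vbas) vred.
have [wn _] := minima_equal12 q_odd Bbil' wbas (Bani' wbas) wred.
pose c : E := lmonom 1 (- m); have c0 : c != 0 by exact: lmonom_neq0 (oner_neq0 F).
have flat (M : lmodType A) (C : M -> M -> E) t1 t2 t3 : reduced3 C t1 t2 t3 m m m3 ->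
    - C t2 t2 m / C t1 t1 m \notin squares F ->
    reduced_flat (fun x y => c * C x y) t1 t2 t3 k (C t1 t1 m) (C t2 t2 m) (C t3 t3 m3).
  move=> [[b1 l1] [b2 l2] [b3 l3] _ [b12 b13 b23]] n.
  have sb (f : E) (i j : int) : lbound f i -> j = i - m -> lbound (c * f) j.
    by move=> fi ->; apply: (lboundMle (@lbound_monom _ 1 _) fi); clear -ek; lia.
  have sc (f : E) (i j : int) : j = i - m -> (c * f) j = f i.
    by move=> ->; rewrite lcoef_monomM mul1r opprK subrK.
  split; [split|split|split|split|split] => //.
  - by apply: (sb _ _ _ b1); clear -ek; lia.
  - by apply: sc; clear -ek; lia.
  - by apply: (sb _ _ _ b2); clear -ek; lia.
  - by apply: sc; clear -ek; lia.
  - by apply: (sb _ _ _ b3); clear -ek; lia.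
  - by apply: sc; clear -ek; lia.
  - by apply: (sb _ _ _ b12); clear -ek; lia.
  - by apply: (sb _ _ _ b13); clear -ek; lia.
  - by apply: (sb _ _ _ b23); clear -ek; lia.
have [u1 [u2 [u3 [ubas ug]]]] := flat_isometry q_odd (bilinear_scale c Bbil) (bilinear_scale c Bbil')
  vbas (flat _ _ _ _ _ vred vn) wbas (flat _ _ _ _ _ wred wn) (iso_upto_scale c0 iso _).
by exists u1, u2, u3; split=> //; apply: same_gram_scale c0 ug.
Qed.

(** In value degree at most m1 the radii are 1, 0, 0, so the vector matching v1 is a constant
    multiple of w1. *)
Lemma match_minimum m1 m : m1 < m -> reduced3 B v1 v2 v3 m1 m m -> reduced3 B' w1 w2 w3 m1 m m ->
  exists2 c : F, c != 0 & B' (c%:P *: w1) (c%:P *: w1) = B v1 v1.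
Proof.
move=> m1m vred wred; have [[b1 l1] _ _ _ _] := vred.
have [p [p' [h _]]] := iso m1; have [ey _] := h _ b1.
have [r er] := ((basis3P _ _ _).1 wbas).2 (p v1).
have : lbound (B' (comb3 w1 w2 w3 r) (comb3 w1 w2 w3 r)) m1 by rewrite er ey.
move/(reduced_radius q_odd Bbil' wbas (Bani' wbas) _ _ wred).
have -> : radius m1 m1 = 1%N by rewrite /radius lexx subrr.
have -> : radius m1 m = 0%N by rewrite /radius leNgt m1m.
rewrite !leqn0 !size_poly_eq0 => -[s1 /eqP s2 /eqP s3].
have [c0 ec] : exists c, r.1.1 = c%:P by exists (r.1.1)`_0; apply: size1_polyC.
have yE : p v1 = c0%:P *: w1 by rewrite -er /comb3 s2 s3 !scale0r !addr0 ec.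
exists c0; last by rewrite -yE ey.
apply: contraNneq l1 => z; rewrite -ey yE z polyC0 scale0r (bil0l Bbil') lcoef0; exact/eqP.
Qed.

(** The leading binary forms over F are equivalent: [binary_universal] represents a2, and the
    orthogonal vector can be scaled to a3 because both discriminant ratios are nonsquares. *)
Lemma match_leads m1 m : reduced3 B v1 v2 v3 m1 m m -> reduced3 B' w1 w2 w3 m1 m m ->
  - B v3 v3 m / B v2 v2 m \notin squares F -> - B' w3 w3 m / B' w2 w2 m \notin squares F ->
  exists u2 u3, [/\ basis3 w1 u2 u3, reduced3 B' w1 u2 u3 m1 m m,
    B' u2 u2 m = B v2 v2 m & B' u3 u3 m = B v3 v3 m].
Proof.
move=> [[_ _] [_ a20] [_ a30] _ _] [[b1 l1] [b2 b20] [b3 b30] m12 [b12 b13 b23]].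
move: (B v2 v2 m) (B v3 v3 m) a20 a30 => a2 a3 a20 a30 nv nw.
have [x [y exy]] := binary_universal q_odd a2 b20 b30.
pose f2 := B' w2 w2 m; pose f3 := B' w3 w3 m.
have {}exy : f2 * x ^+ 2 + f3 * y ^+ 2 = a2 by exact: exy.
have [s s2] : exists s, s ^+ 2 = a3 / (a2 * f2 * f3).
  have /squaresP[r er] := nonsquareM q_odd nv nw; exists (r / f3).
  by rewrite expr_div_n -er -/f2 -/f3; field; rewrite a20 b20 b30.
have s0 : s != 0 by rewrite -sqrf_eq0 s2 !mulf_neq0// invr_eq0 !mulf_neq0.
pose u2 := x%:P *: w2 + y%:P *: w3.
pose u3 := (- (s * f3 * y))%:P *: w2 + (s * f2 * x)%:P *: w3.
have ubas : basis3 w1 u2 u3.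
  have D0 : x * (s * f2 * x) - y * (- (s * f3 * y)) != 0.
    have -> : x * (s * f2 * x) - y * (- (s * f3 * y)) = s * (f2 * x ^+ 2 + f3 * y ^+ 2) by ring.
    by rewrite exy mulf_neq0.
  have := basis3_block (basis3_swap23 (basis3_swap12 wbas)) D0 (oner_neq0 F).
  by rewrite polyC1 scale1r => /basis3_swap23/basis3_swap12.
have val (c d e f : F) (z := c%:P *: w2 + d%:P *: w3) (z' := e%:P *: w2 + f%:P *: w3) :
    lbound (B' z z') m /\ B' z z' m = f2 * (c * e) + f3 * (d * f).
  have -> : B' z z' = lcst (c * e) * B' w2 w2 + lcst (d * f) * B' w3 w3 +
      lcst (c * f + d * e) * B' w2 w3.
    by rewrite !(bilE Bbil') (bilC Bbil' w3 w2) -!/(lcst _) rmorphD !rmorphM; ring.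
  split; last first.
    rewrite !lcoefD !lcoef_cstM (lcoef_top0 b23); last by lia.
    by rewrite /f2 /f3; ring.
  apply: lboundD; first by apply: lboundD; apply: lbound_cstM.
  by apply: lbound_cstM; apply: lbound_le b23 _; clear; lia.
have e2 : B' u2 u2 m = a2 by rewrite (val x y x y).2 -exy; ring.
have e3 : B' u3 u3 m = a3.
  rewrite (val _ _ _ _).2.
  transitivity (s ^+ 2 * (f2 * f3) * (f2 * x ^+ 2 + f3 * y ^+ 2)); first by ring.
  by rewrite exy s2; field; rewrite a20 b20 b30.
exists u2, u3; split=> //; split=> //.
- by rewrite e2; split=> //; exact: (val _ _ _ _).1.
- by rewrite e3; split=> //; exact: (val _ _ _ _).1.
split.
- by rewrite !(bilE Bbil'); apply: lboundD; apply: lbound_cstM.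
- by rewrite !(bilE Bbil'); apply: lboundD; apply: lbound_cstM.
apply: lbound_pred; first exact: (val _ _ _ _).1.
by rewrite (val _ _ _ _).2; ring.
Qed.

Lemma isometry_equal23 m1 m : reduced3 B v1 v2 v3 m1 m m -> reduced3 B' w1 w2 w3 m1 m m ->
  exists u1 u2 u3, basis3 u1 u2 u3 /\ same_gram B B' v1 v2 v3 u1 u2 u3.
Proof.
move=> vred wred.
have [vn [k ek]] := minima_equal23 q_odd Bbil vbas (Bani vbas) vred.
have [wn _] := minima_equal23 q_odd Bbil' wbas (Bani' wbas) wred.
have m1m : m1 < m by lia.
have [d d0 ed] := match_minimum m1m vred wred.
have [u2 [u3 [ubas ured e2 e3]]] := match_leads vred wred vn wn.
pose u1 := d%:P *: w1.
have tbas : basis3 u1 u2 u3.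
  have D0 : (1 : F) * 1 - 0 * 0 != 0 by rewrite mul0r subr0 mul1r oner_neq0.
  have := basis3_block (basis3_swap23 (basis3_swap12 ubas)) D0 d0.
  by rewrite polyC1 polyC0 !scale1r !scale0r addr0 add0r => /basis3_swap23/basis3_swap12.
have [[b1 l1] _ _ _ _] := vred; have f0 := ldeg_neq0 l1.
(* A monomial would only normalise the leading coefficient, whereas [elongated] asks for first entry
   1. The same factor serves L' because B' u1 u1 = B v1 v1. *)
pose c := (B v1 v1)^-1; have c0 : c != 0 by rewrite invr_eq0.
have cb : lbound c (- m1) by exact: lboundV.
have cl : c (- m1) = (B v1 v1 m1)^-1 by exact: lcoefV_top.
have elong (M : lmodType A) (C : M -> M -> E) t1 t2 t3 : C t1 t1 = B v1 v1 ->
    lbound (C t1 t2) (m1 - 1) -> lbound (C t1 t3) (m1 - 1) ->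
    lbound (C t2 t2) m -> C t2 t2 m = B v2 v2 m -> lbound (C t3 t3) m -> C t3 t3 m = B v3 v3 m ->
    lbound (C t2 t3) (m - 1) ->
    elongated (fun x y => c * C x y) t1 t2 t3 k (B v2 v2 m / B v1 v1 m1) (B v3 v3 m / B v1 v1 m1).
  move=> h1 h12 h13 h2 l2 h3 l3 h23.
  have [_ [_ l20] [_ l30] _ _] := vred.
  have top (f : E) : lbound f m -> (c * f) (2 * k + 1)%N%:Z = f m / B v1 v1 m1.
    move=> fm; have -> : (2 * k + 1)%N%:Z = - m1 + m by clear -ek; clear -ek; lia.
    by rewrite (lcoefM_top cb fm) cl mulrC.
  have bd (f : E) (i j : int) : lbound f i -> i - m1 <= j -> lbound (c * f) j.
    by move=> fi h; apply: (lboundMle cb fi); clear -h; lia.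
  split; rewrite ?h1 ?mulf_neq0 ?invr_eq0//.
  - by rewrite mulVf.
  - by apply: (bd _ _ _ h12); clear -ek; lia.
  - by apply: (bd _ _ _ h13); clear -ek; lia.
  - by apply: (bd _ _ _ h2); clear -ek; lia.
  - by rewrite top// l2.
  - by apply: (bd _ _ _ h3); clear -ek; lia.
  - by rewrite top// l3.
  - by apply: (bd _ _ _ h23); clear -ek; lia.
have vel : elongated (fun x y => c * B x y) v1 v2 v3 k (B v2 v2 m / B v1 v1 m1) (B v3 v3 m / B v1 v1 m1).
  by have [_ [? _] [? _] _ [? ? ?]] := vred; apply: elong.
have uel : elongated (fun x y => c * B' x y) u1 u2 u3 k (B v2 v2 m / B v1 v1 m1) (B v3 v3 m / B v1 v1 m1).
  have [_ [? _] [? _] _ [? ? ?]] := ured; apply: elong => //;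
  by rewrite (bilZl Bbil'); apply: lbound_cstM.
have nsq : - (B v3 v3 m / B v1 v1 m1) / (B v2 v2 m / B v1 v1 m1) \notin squares F.
  have [_ [_ l20] _ _ _] := vred.
  suff -> : - (B v3 v3 m / B v1 v1 m1) / (B v2 v2 m / B v1 v1 m1) = - B v3 v3 m / B v2 v2 m by [].
  by field; rewrite l1 l20.
have [t1 [t2 [t3 [sbas ug]]]] := elongated_isometry q_odd (bilinear_scale c Bbil) (bilinear_scale c Bbil')
  vbas tbas (anisotropic_scale c0 (Bani vbas)) (anisotropic_scale c0 (Bani' tbas)) vel uel nsq
  (iso_upto_scale c0 iso).
by exists t1, t2, t3; split=> //; apply: same_gram_scale c0 ug.
Qed.

End Drivers.

Lemma coordinate_basis (R : nzSemiRingType) (V : semiVectType R) :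
  exists v : 'I_(dim V) -> V, bijective (fun c : 'rV[R]_(dim V) => \sum_i c 0 i *: v i).
Proof.
exists (fun i => r2v (delta_mx 0 i)).
have cE (c : 'rV[R]_(dim V)) : \sum_i c 0 i *: r2v (delta_mx 0 i) =
    r2v c :> V.
  by rewrite [in RHS](row_sum_delta c) linear_sum; apply: eq_bigr => i _; rewrite linearZ.
exists (@v2r _ V) => x; rewrite cE.
  exact: r2vK.
exact: v2rK.
Qed.

(** * Quadratic lattices over F[t] *)

Section QuadraticLattices.
Variable F : fieldType.
Hypothesis two : 2%:R != 0 :> F.
Local Notation A := {poly F}.
Local Notation K := {fraction A}.
Local Notation E := (laurent F).
Local Notation lp := (@laurent_of_poly F).
Local Notation lq := (@laurent_of_frac F).
Local Notation "x %:F" := (@FracField.tofrac _ x).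

Lemma laurent_of_frac_poly (a : A) : lq a%:F = lp a.
Proof. by rewrite -[a%:F]divr1 -tofrac1 laurent_of_fracE ?oner_neq0// rmorph1 divr1. Qed.

Lemma laurent_of_frac_inj : injective lq.
Proof. exact: fmorph_inj. Qed.

Lemma degP (x : K) : x != 0 -> deg x = (ldeg (lq x))%:E.
Proof.
move=> x0; have d0 := denom_neq0 x; have n0 : numer x != 0.
  by apply: contraNneq x0 => n0; rewrite [x]numer_denom n0 tofrac0 mul0r.
rewrite /deg (negPf x0) /laurent_of_frac ldegM ?ldegV ?invr_eq0 ?laurent_of_poly_eq0//.
by rewrite !ldeg_poly//; congr (_%:E); lia.
Qed.

Lemma deg_lt (x y : K) : y != 0 -> (deg x < deg y)%E -> lbound (lq x) (ldeg (lq y) - 1).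
Proof.
move=> y0; have [->|x0] := eqVneq x 0; first by rewrite rmorph0 => _; exact: lbound0.
rewrite !degP// lte_fin => h.
have x0' : lq x != 0 by rewrite fmorph_eq0.
by apply: lbound_le (ldeg_bound x0') _; lia.
Qed.

Section Polar.
Variables (L : vectType A) (Q : quadratic_form L).

(** The division by 2 makes the diagonal equal to Q. *)
Definition polar_form (x y : L) : E := lq (polar Q x y / 2%:R).

Lemma two_frac : 2%:R != 0 :> K.
Proof.
by rewrite -(rmorph_nat (@FracField.tofrac A)) tofrac_eq0 -(rmorph_nat (@polyC F)) polyC_eq0.
Qed.

Lemma polar_form_bil : bilinear_form polar_form.
Proof.
split=> [x y|a x y z]; first by rewrite /polar_form /polar addrAC [x + y]addrC.
by rewrite /polar_form qformB mulrDl -mulrA rmorphD rmorphM /= laurent_of_frac_poly.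
Qed.

Lemma polar_form_diag x : polar_form x x = lq (Q x).
Proof.
congr (lq _); apply: (mulIf two_frac); rewrite divfK ?two_frac// /polar.
rewrite -[x + x]/(x *+ 2) -scaler_nat qformZ -polyC_natr.
have -> : ((2%:R : F)%:P)%:F = 2%:R :> K.
  by rewrite -(rmorph_nat (@FracField.tofrac A)) -(rmorph_nat (@polyC F)).
by ring.
Qed.

Lemma is_basis_tri (v : 'I_3 -> L) v1 v2 v3 : (forall i, v i = tri v1 v2 v3 i) ->
  is_basis v <-> basis3 v1 v2 v3.
Proof.
move=> vE.
pose row (p : A * A * A) : 'rV[A]_3 := \row_i tri p.1.1 p.1.2 p.2 i.
pose unrow (r : 'rV[A]_3) : A * A * A :=
  (r 0 ord0, r 0 (@Ordinal 3 1 isT), r 0 (@Ordinal 3 2 isT)).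
have rowK : cancel row unrow by case=> [[a b] c]; rewrite /unrow !mxE.
have unrowK : cancel unrow row.
  move=> r; apply/rowP => i; rewrite mxE /unrow /=.
  by case: i => [[|[|[|//]]] h]; congr (r _ _); apply: val_inj.
have cE p : \sum_i row p 0 i *: v i = comb3 v1 v2 v3 p.
  case: p => [[a b] c]; rewrite -sum_tri; apply: eq_bigr => i _.
  by rewrite mxE vE.
split=> [bv|bv].
  apply: (eq_bij (bij_comp bv (Bijective rowK unrowK))) => p.
  exact: cE.
apply: (eq_bij (bij_comp bv (Bijective unrowK rowK))) => r /=.
by rewrite -cE unrowK.
Qed.

Lemma definite_anisotropic e1 e2 e3 : definite Q -> basis3 e1 e2 e3 ->
  anisotropic polar_form e1 e2 e3.
Proof.
move=> defQ eb x1 x2 x3 x0.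
have bb : is_basis (tri e1 e2 e3) by apply/(@is_basis_tri _ e1 e2 e3).
pose x : 'rV[E]_3 := \row_i tri x1 x2 x3 i.
have Bbil := polar_form_bil.
have GE : map_mx lq (gram Q (tri e1 e2 e3)) = gram_mx polar_form (tri e1 e2 e3).
  by apply/matrixP => i j; rewrite !mxE.
have xE (i : 'I_3) : x 0 i = tri x1 x2 x3 i by rewrite mxE.
have /(defQ _ _ bb) xz : x *m map_mx lq (gram Q (tri e1 e2 e3)) *m x^T = 0.
  apply/matrixP => i j; rewrite !ord1 GE [RHS]mxE -[RHS]x0.
  rewrite !mxE !big_ord_recl big_ord0 !mxE !big_ord_recl !big_ord0 !mxE /tri /=.
  by rewrite (bilC Bbil e2 e1) (bilC Bbil e3 e1) (bilC Bbil e3 e2); ring.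
have z (i : 'I_3) : tri x1 x2 x3 i = 0 by rewrite -xE xz mxE.
by split; [exact: (z ord0)|exact: (z (lift ord0 ord0))|exact: (z ord_max)].
Qed.

Lemma dim3_basis : dim L = 3 -> exists w1 w2 w3 : L, basis3 w1 w2 w3.
Proof.
have : exists v : 'I_(dim L) -> L, is_basis v by exact: coordinate_basis.
move=> + d3; rewrite d3 => -[v vb]; have [w1 [w2 [w3 vE]]] := tri_eta v.
by exists w1, w2, w3; apply/(is_basis_tri vE).
Qed.

Lemma common_denominator (I : finType) (f : I -> K) :
  exists2 d : A, d != 0 & forall i, exists p, lp d * lq (f i) = lp p.
Proof.
exists (\prod_i denom (f i)); first by apply/prodf_neq0 => i _; exact: denom_neq0.
move=> i; exists (\prod_(j | j != i) denom (f j) * numer (f i)).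
rewrite (bigD1 i)//= /laurent_of_frac !rmorphM.
by field; rewrite laurent_of_poly_eq0 denom_neq0.
Qed.

(** If d is a common denominator of the Gram entries, then d B x x is a nonzero polynomial, of
    degree at least 0. *)
Lemma polar_form_lower_bound (w1 w2 w3 : L) : definite Q -> basis3 w1 w2 w3 ->
  exists C : int, forall x, x != 0 -> C <= ldeg (polar_form x x).
Proof.
move=> defQ wb; have Bbil := polar_form_bil.
have Bani := definite_anisotropic defQ wb.
have [d d0 dP] := common_denominator (fun ij : 'I_3 * 'I_3 =>
  polar Q (tri w1 w2 w3 ij.1) (tri w1 w2 w3 ij.2) / 2%:R).
exists (- ldeg (lp d)) => x x0.
have Bx : polar_form x x != 0.
  by apply: contra_neq x0; apply: (anisotropic_eq0 Bbil wb Bani).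
have d0' : lp d != 0 by rewrite laurent_of_poly_eq0.
suff [p pE] : exists p, lp d * polar_form x x = lp p.
  have p0 : p != 0 by rewrite -laurent_of_poly_eq0 -pE mulf_neq0.
  have := ldeg_poly_ge0 p0; rewrite -pE ldegM//; lia.
have [r <-] := ((basis3P _ _ _).1 wb).2 x; case: r => [[a b] c].
rewrite -sum_tri (bil_sum Bbil) mulr_sumr.
pose N i j := sval (cid (dP (i, j))).
have NE i j : lp d * polar_form (tri w1 w2 w3 i) (tri w1 w2 w3 j) = lp (N i j).
  by rewrite /N; case: cid.
exists (\sum_i \sum_j tri a b c i * N i j * tri a b c j).
rewrite rmorph_sum; apply: eq_bigr => i _; rewrite rmorph_sum mulr_sumr.
by apply: eq_bigr => j _; rewrite !rmorphM /= -NE; ring.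
Qed.

End Polar.

Lemma isospectral_iso_upto (L L' : vectType A) (Q : quadratic_form L) (Q' : quadratic_form L') :
  isospectral Q Q' ->
  forall n, iso_upto n (fun x => polar_form Q x x) (fun x => polar_form Q' x x).
Proof.
move=> isoQ n.
have bij a : exists fg : ([set v | Q v = a]%classic -> [set v | Q' v = a]%classic) *
    ([set v | Q' v = a]%classic -> [set v | Q v = a]%classic),
    cancel fg.1 fg.2 /\ cancel fg.2 fg.1.
  by have /card_bijP[f [g fK gK]] := isoQ a; exists (f, g).
pose fg a := sval (cid (bij a)).
have fK a : cancel (fg a).1 (fg a).2 by rewrite /fg; case: cid => ? [].
have gK a : cancel (fg a).2 (fg a).1 by rewrite /fg; case: cid => ? [].
have inL x : x \in [set v | Q v = Q x]%classic by apply/mem_set.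
have inL' x : x \in [set v | Q' v = Q' x]%classic by apply/mem_set.
pose h x := val ((fg (Q x)).1 (exist _ x (inL x))).
pose h' y := val ((fg (Q' y)).2 (exist _ y (inL' y))).
(* h' (h x) is computed in the fibre over Q' (h x), equal to Q x only propositionally; [hE] and
   [hE'] allow changing the fibre. *)
have hE a x (xa : x \in [set v | Q v = a]%classic) : h x = val ((fg a).1 (exist _ x xa)).
  have e : Q x = a by move/set_mem : xa.
  by subst a; rewrite /h; congr (val ((fg _).1 _)); apply: val_inj.
have hE' a y (ya : y \in [set v | Q' v = a]%classic) : h' y = val ((fg a).2 (exist _ y ya)).
  have e : Q' y = a by move/set_mem : ya.
  by subst a; rewrite /h'; congr (val ((fg _).2 _)); apply: val_inj.
have hQ x : Q' (h x) = Q x by rewrite /h; exact: (set_mem (valP ((fg (Q x)).1 _))).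
have hQ' y : Q (h' y) = Q' y by rewrite /h'; exact: (set_mem (valP ((fg (Q' y)).2 _))).
exists h, h'; split=> x _; rewrite !polar_form_diag ?hQ ?hQ'; split=> //.
  rewrite (hE' (Q x) _ (valP ((fg (Q x)).1 (exist _ x (inL x))))).
  by rewrite (_ : exist _ _ _ = (fg (Q x)).1 (exist _ x (inL x))) ?fK//; apply: val_inj.
rewrite (hE (Q' x) _ (valP ((fg (Q' x)).2 (exist _ x (inL' x))))).
by rewrite (_ : exist _ _ _ = (fg (Q' x)).2 (exist _ x (inL' x))) ?gK//; apply: val_inj.
Qed.

Lemma successive_minima_reduced (L : vectType A) (Q : quadratic_form L) mu1 mu2 mu3 :
  definite Q -> successive_minima Q [tuple mu1; mu2; mu3] ->
  exists v1 v2 v3 m1 m2 m3, [/\ basis3 v1 v2 v3, reduced3 (polar_form Q) v1 v2 v3 m1 m2 m3 &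
    [/\ mu1 = m1%:E, mu2 = m2%:E & mu3 = m3%:E]].
Proof.
move=> defQ [v [vb [vr1 vr2] muE]]; have [v1 [v2 [v3 vE]]] := tri_eta v.
have bas : basis3 v1 v2 v3 by apply/(is_basis_tri vE).
have Bbil := polar_form_bil Q; have Bani := definite_anisotropic defQ bas.
have [v10 v20 v30] := basis3_neq0 bas.
have nz x : x != 0 -> polar_form Q x x != 0.
  by apply: contra_neq; apply: (anisotropic_eq0 Bbil bas Bani).
have GE i j : lq (gram Q v i j) = polar_form Q (v i) (v j) by rewrite mxE.
pose o1 : 'I_3 := lift ord0 ord0; pose o2 : 'I_3 := ord_max.
have vz i : v i != 0 by rewrite vE; case: i => [[|[|[|//]]] h].
have gz i : gram Q v i i != 0 by rewrite -(fmorph_eq0 lq) /= GE nz.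
have dE i : deg (gram Q v i i) = (ldeg (polar_form Q (v i) (v i)))%:E by rewrite degP// GE.
have e0 : v ord0 = v1 by rewrite vE.
have e1 : v o1 = v2 by rewrite vE.
have e2 : v o2 = v3 by rewrite vE.
have lo (i j : 'I_3) : (i < j)%N -> lbound (polar_form Q (v i) (v j)) (ldeg (polar_form Q (v i) (v i)) - 1).
  by move=> ij; rewrite -!GE; apply: deg_lt => //; apply: vr2.
have le (i j : 'I_3) : (i <= j)%N -> ldeg (polar_form Q (v i) (v i)) <= ldeg (polar_form Q (v j) (v j)).
  by move=> /vr1; rewrite !dE lee_fin.
exists v1, v2, v3, (ldeg (polar_form Q v1 v1)), (ldeg (polar_form Q v2 v2)), (ldeg (polar_form Q v3 v3)).
split=> //; last first.
  by rewrite -e0 -e1 -e2 -!dE -!muE.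
split.
- by split; [exact/ldeg_bound/nz|exact/ldeg_lead/nz].
- by split; [exact/ldeg_bound/nz|exact/ldeg_lead/nz].
- by split; [exact/ldeg_bound/nz|exact/ldeg_lead/nz].
- by rewrite -e0 -e1 -e2 !le.
- by split; rewrite -?e0 -?e1 -?e2; apply: lo.
Qed.

End QuadraticLattices.

(** * From equal Gram matrices to an isometry *)

Section Isometry.
Variable F : finFieldType.
Hypothesis q_odd : odd #|F|.
Local Notation A := {poly F}.
Local Notation lq := (@laurent_of_frac F).

Lemma comb3_linear (L : lmodType A) (v1 v2 v3 : L) a p r :
  a *: comb3 v1 v2 v3 p + comb3 v1 v2 v3 r =
  comb3 v1 v2 v3 (a * p.1.1 + r.1.1, a * p.1.2 + r.1.2, a * p.2 + r.2).
Proof. by rewrite /comb3 /= !scalerDr !scalerDl !scalerA addrACA (addrACA (_ *: v1)). Qed.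

Lemma same_gram_isometric (L L' : vectType A) (Q : quadratic_form L) (Q' : quadratic_form L')
   v1 v2 v3 u1 u2 u3 :
  basis3 v1 v2 v3 -> basis3 u1 u2 u3 ->
  same_gram (polar_form Q) (polar_form Q') v1 v2 v3 u1 u2 u3 -> isometric Q Q'.
Proof.
move=> vb ub [[g11 g12 g22] [g13 g23 g33]].
have two := two_neq0 q_odd.
have Bbil := polar_form_bil Q; have Bbil' := polar_form_bil Q'.
have [g gK gK'] := vb; have [h hK hK'] := ub.
pose sigma x := comb3 u1 u2 u3 (g x).
have sE p : sigma (comb3 v1 v2 v3 p) = comb3 u1 u2 u3 p by rewrite /sigma gK.
have slin : linear sigma.
  by move=> a x y; rewrite -{1}(gK' x) -{1}(gK' y) comb3_linear sE -comb3_linear.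
pose s : {linear L -> L'} := HB.pack sigma (GRing.isLinear.Build _ _ _ _ sigma slin).
exists s; split.
  exists (fun y => comb3 v1 v2 v3 (h y)) => x; rewrite /= /sigma.
    by rewrite hK gK'.
  by rewrite gK hK'.
move=> x; apply: (laurent_of_frac_inj (F := F)).
rewrite -!(polar_form_diag two) -[in RHS](gK' x) /= /sigma; case: (g x) => [[a b] c].
rewrite /comb3 /= !(bilE Bbil) !(bilE Bbil').
rewrite (bilC Bbil v2 v1) (bilC Bbil v3 v1) (bilC Bbil v3 v2).
by rewrite (bilC Bbil' u2 u1) (bilC Bbil' u3 u1) (bilC Bbil' u3 u2) g11 g12 g13 g22 g23 g33.
Qed.

End Isometry.

Theorem theorem6p9 (F : finFieldType) (q_odd : odd #|F|)
    (L L' : vectType {poly F})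
    (Q : quadratic_form L) (Q' : quadratic_form L')
    (ternaryL : dim L = 3) (ternaryL' : dim L' = 3)
    (defQ : definite Q) (defQ' : definite Q')
    (isoQ : isospectral Q Q')
    (mu1 mu2 mu3 : \bar int)
    (muQ : successive_minima Q [tuple mu1; mu2; mu3]) :
  mu1 = mu2 \/ mu2 = mu3 -> isometric Q Q'.
Proof.
move=> mu; have two := two_neq0 q_odd.
have [v1 [v2 [v3 [m1 [m2 [m3 [vb vr [e1 e2 e3]]]]]]]] := successive_minima_reduced two defQ muQ.
have Bbil := polar_form_bil Q; have Bbil' := polar_form_bil Q'.
have Bani := definite_anisotropic defQ; have Bani' := definite_anisotropic defQ'.
have iso := isospectral_iso_upto two isoQ.
have [t1 [t2 [t3 tb]]] := dim3_basis ternaryL'.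
have [C lC] := polar_form_lower_bound two defQ' tb.
(* Minima are given for L alone. L' gets a reduced basis here, and counting vectors shows that its
   minima are the same. *)
have [w1 [w2 [w3 [n1 [n2 [n3 [wb wr]]]]]]] := reduced_basis_exists two Bbil' tb (Bani' _ _ _ tb) lC.
have [f1 f2 f3] := minima_unique q_odd Bbil Bbil' vb (Bani _ _ _ vb) tb (Bani' _ _ _ tb) iso vb vr wb wr.
subst n1 n2 n3.
suff [u1 [u2 [u3 [ub ug]]]] : exists u1 u2 u3, basis3 u1 u2 u3 /\
    same_gram (polar_form Q) (polar_form Q') v1 v2 v3 u1 u2 u3.
  exact: same_gram_isometric vb ub ug.
case: mu => mu.
  have m12 : m1 = m2 by move: mu; rewrite e1 e2 => -[].
  subst m2; exact: (isometry_equal12 q_odd Bbil Bbil' Bani Bani' iso vb wb vr wr).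
have m23 : m2 = m3 by move: mu; rewrite e2 e3 => -[].
subst m3; exact: (isometry_equal23 q_odd Bbil Bbil' Bani Bani' iso vb wb vr wr).
Qed.
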